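(* Let $\frac13<\beta\le\gamma<H$, let $(\Omega,\mathcal F,\mathbb P,(\theta_t)_{t\in\mathbb R})$ and the delayed $\gamma$-rough path cocycle $\mathbf B$ of fractional Brownian motion with Hurst parameter $H$ be as described in the context, let $r>0$, $A\in L(\mathbb R^n\times\mathbb R^n,\mathbb R^n)$, let $\pi=(\pi^{i,j})_{1\le i,j\le n}$ be finite signed measures on $[-r,0]$, and let $G\in C^4_b(\mathbb R^n\times\mathbb R^n,L(\mathbb R^d,\mathbb R^n))$ (if $A=0$, $G\in C^3_b$ suffices). For $\xi\in\mathscr D^\beta_{\mathbf B(\omega)}([-r,0])$ consider $$\mathrm dy_t=A\Big(y_t,\int_{-r}^0y_{\theta+t}\,\pi(\mathrm d\theta)\Big)\mathrm dt+G(y_t,y_{t-r})\,\mathrm d\mathbf B_t(\omega),\qquad y_s=\xi_s\ \text{ for } -r\le s\le0 .$$ This equation admits a unique solution globally in time; denote it by $(\phi^t_{\mathbf B(\omega)}(\xi))_{t\ge0}$. For $m\in\mathbb N$ set $$\varphi^m_\omega(\xi):=\big(\phi^{(m-1)r+t}_{\mathbf B(\omega)}(\xi)\big)_{0\le t\le r}.$$ Then $\varphi^m_\omega(\xi)\in\mathscr D^\beta_{\mathbf B(\theta_{mr}\omega)}([-r,0])$, the map $$\varphi^m_\omega:\mathscr D^\beta_{\mathbf B(\omega)}([-r,0])\to\mathscr D^\beta_{\mathbf B(\theta_{mr}\omega)}([-r,0]),\qquad \xi\mapsto\varphi^m_\omega(\xi),$$ is continuous, and the cocycle property $\varphi^{p+q}_\omega=\varphi^p_{\theta_{qr}\omega}\circ\varphi^q_\omega$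 holds for all $p,q\in\mathbb N$.
   Context: Notation: $m_{s,t}=(\delta m)_{s,t}=m_t-m_s$; $\|m\|_{\infty;J}$ sup norm; $\|m\|_{\alpha;J}=\sup_{s\ne t\in J}|m_t-m_s|/|t-s|^\alpha$, and $\|F\|_{\alpha;J}=\sup_{s\ne t\in J}|F_{s,t}|/|t-s|^\alpha$ for two-parameter $F$. Delayed rough path: for $\gamma\in(\frac13,\frac12]$, a triple $\mathbf X=(X,\mathbb X,\mathbb X(-r))$ with $X:\mathbb R\to\mathbb R^d$ locally $\gamma$-Hölder, $\mathbb X,\mathbb X(-r):\mathbb R^2\to\mathbb R^d\otimes\mathbb R^d$ continuous with finite $\|\cdot\|_{2\gamma;J}$ on compact $J$, and for $s<u<t$: $\mathbb X_{s,t}=\mathbb X_{s,u}+\mathbb X_{u,t}+X_{s,u}\otimes X_{u,t}$, $\mathbb X_{s,t}(-r)=\mathbb X_{s,u}(-r)+\mathbb X_{u,t}(-r)+X_{s-r,u-r}\otimes X_{u,t}$. Controlled paths: $\mathscr D^\beta_{\mathbf X}(J)$ is the Banach space of pairs $(m,m')$, $m:J\to\mathbb R^n$, $m':J\to L(\mathbb R^d,\mathbb R^n)$ $\beta$-Hölder (Gubinelli derivative), with $m^\#_{s,t}:=m_{s,t}-m'_sX_{s,t}$ of finite $\|\cdot\|_{2\beta;J}$; norm $\|m\|_{\infty;J}+\|m'\|_{\infty;J}+\|m'\|_{\beta;J}+\|m^\#\|_{2\beta;J}$. Rough integral and solution: if $\zeta_{s,t}=\zeta^0_sX_{s,t}+\zeta^1_sX_{s-r,t-r}+\zeta^\#_{s,t}$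 with $\zeta^0,\zeta^1$ $\beta$-Hölder and $\|\zeta^\#\|_{2\beta}<\infty$, then $\int_a^b\zeta\,\mathrm d\mathbf X:=\lim_{|\Pi|\to0}\sum_{t_j\in\Pi}(\zeta_{t_j}X_{t_j,t_{j+1}}+\zeta^0_{t_j}\mathbb X_{t_j,t_{j+1}}+\zeta^1_{t_j}\mathbb X_{t_j,t_{j+1}}(-r))$. A solution is a path $y$ on $[0,\infty)$, controlled on compact intervals with Gubinelli derivative $G(y_t,y_{t-r})$, satisfying the integrated equation on every $[s,t]$, $0\le s<t$; for $\zeta_t=G(y_t,y_{t-r})$ one uses $\zeta^0_s=\partial_1G(y_s,y_{s-r})y'_s$, $\zeta^1_s=\partial_2G(y_s,y_{s-r})y'_{s-r}$, with $y=\xi$ (and its Gubinelli derivative) on the initial delay interval. $\int_{-r}^0y_{\theta+t}\,\pi(\mathrm d\theta)$ means $\big(\sum_i\int_{-r}^0y^i_{\theta+t}\,\pi^{i,j}(\mathrm d\theta)\big)_{1\le j\le n}$. $C^k_b$: continuous and bounded together with all derivatives up to order $k$. Noise: $\frac13<H<\frac12$; $B=(B^1,\dots,B^d)$ is a two-sided fractional Brownian motion with Hurst parameter $H$ and independent components. It is lifted to a delayed $\gamma$-rough path $\overline{\mathbf B}=(B,\mathbb B,\mathbb B(-r))$ through (continuous versions of) $\mathbb B_{s,t}=\int_s^tB_{s,u}\otimes\mathrm d^\circ B_u$ and $\mathbb B_{s,t}(-r)=\int_s^tB_{s-r,u-r}\otimes\mathrm d^\circ B_u$, where $\mathrm d^\circ$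 denotes the symmetric integral: $\int_s^tu_x\otimes\mathrm d^\circ B_x$ is the $L^2(\Omega)$-limit as $\epsilon\to0$ of $\int_s^tu_x\otimes\frac{B_{x+\epsilon}-B_{x-\epsilon}}{2\epsilon}\,\mathrm dx$. $(\Omega,\mathcal F,\mathbb P,(\theta_t)_{t\in\mathbb R})$ is the canonical ergodic measurable metric dynamical system carrying this process: $\Omega$ is the path space of the process, $\mathbb P$ the law of $\overline{\mathbf B}$, $\mathbf B=(B,\mathbb B,\mathbb B(-r))$ the coordinate process, $\theta$ the shift. Thus $\mathbf B$ has the law of $\overline{\mathbf B}$, $\mathbf B(\omega)$ is a delayed $\gamma$-rough path for each $\omega$ (after discarding a shift-invariant null set), and $\mathbf B_{u,v}(\theta_s\omega)=\mathbf B_{u+s,v+s}(\omega)$. A path on $[(m-1)r,mr]$ is identified with a path on $[-r,0]$ by the time shift: $\varphi^m_\omega(\xi)$ is viewed as $[-r,0]\ni s\mapsto\phi^{mr+s}_{\mathbf B(\omega)}(\xi)$. *)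

(* Defs.v *)
From HB Require Import structures.
From mathcomp Require Import all_boot all_order all_algebra.
From mathcomp Require Import all_classical all_reals all_analysis.

Set Implicit Arguments.
Unset Strict Implicit.
Unset Printing Implicit Defensive.

Import Order.TTheory GRing.Theory Num.Theory.
Import numFieldNormedType.Exports.

Local Open Scope classical_set_scope.
Local Open Scope ring_scope.

(* Vectors of R^k are columns 'cV[R]_k, L(R^d, R^n) is 'M[R]_(n, d), and a
   tensor of R^d (x) R^d is the matrix of its components on e_i (x) e_j.
   The norms are the library ones on matrices (largest entry) and on products
   (largest component); all norms being equivalent here, this affects neither
   the spaces nor their topologies. *)

Definition incr (R : realType) (V : zmodType) (f : R -> V) : R -> R -> V :=
  fun s t => f t - f s.

Definition sup_norm (R : realType) (V : normedModType R) (J : set R)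
    (f : R -> V) : \bar R :=
  ereal_sup [set (`|f t|)%:E | t in J].

Definition holder (R : realType) (V : normedModType R) (alpha : R) (J : set R)
    (F : R -> R -> V) : \bar R :=
  ereal_sup [set (`|F p.1 p.2| / `|p.2 - p.1| `^ alpha)%:E
    | p in [set p : R * R | [/\ J p.1, J p.2 & p.1 != p.2]]].

(* Continuous sample paths (X, XX, XX(-r)) of a lifted process, normalized by
   X_0 = 0. *)
Record rpath (R : realType) (d : nat) := RPath {
  base : R -> 'cV[R]_d ;
  area : R * R -> 'M[R]_d ;
  darea : R * R -> 'M[R]_d ;
  base_at0 : base 0 = 0 ;
  base_continuous : continuous base ;
  area_continuous : continuous area ;
  darea_continuous : continuous darea }.

Definition delayed_rough_path (R : realType) (d : nat) (gamma r : R)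
    (w : rpath R d) : Prop :=
  [/\ forall J : set R, compact J ->
        [/\ (holder gamma J (incr (base w)) < +oo)%E,
            (holder (2 * gamma) J (fun s t => area w (s, t)) < +oo)%E &
            (holder (2 * gamma) J (fun s t => darea w (s, t)) < +oo)%E],
      forall s u t : R, s < u -> u < t ->
        area w (s, t) = area w (s, u) + area w (u, t) +
          incr (base w) s u *m (incr (base w) u t)^T &
      forall s u t : R, s < u -> u < t ->
        darea w (s, t) = darea w (s, u) + darea w (u, t) +
          incr (base w) (s - r) (u - r) *m (incr (base w) u t)^T].

Lemma zero_rpath_continuous (R : realType) (U V : normedModType R) :
  continuous (fun _ : U => 0 : V).
Proof. by move=> x; exact: cvg_cst. Qed.

Definition zero_rpath (R : realType) (d : nat) : rpath R d :=
  @RPath R d (fun=> 0) (fun=> 0) (fun=> 0) erefl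
    (@zero_rpath_continuous R R 'cV[R]_d)
    (@zero_rpath_continuous R (R * R)%type 'M[R]_d)
    (@zero_rpath_continuous R (R * R)%type 'M[R]_d).

HB.instance Definition _ (R : realType) (d : nat) := gen_eqMixin (rpath R d).
HB.instance Definition _ (R : realType) (d : nat) :=
  gen_choiceMixin (rpath R d).
HB.instance Definition _ (R : realType) (d : nat) :=
  isPointed.Build (rpath R d) (zero_rpath R d).

Definition cylinders (R : realType) (d : nat) : set (set (rpath R d)) :=
  [set E | exists A : set (measurableTypeR R), measurable A /\
    [\/ exists t i, E = [set w | A (base w t i 0)],
        exists st i j, E = [set w | A (area w st i j)] |
        exists st i j, E = [set w | A (darea w st i j)]]].

Definition Omega (R : realType) (d : nat) :=
  g_sigma_algebraType (@cylinders R d).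

Lemma shift_base_at0 (R : realType) (d : nat) (s : R) (w : rpath R d) :
  base w (0 + s) - base w s = 0.
Proof. by rewrite add0r subrr. Qed.

Lemma shift_base_continuous (R : realType) (d : nat) (s : R) (w : rpath R d) :
  continuous (fun t => base w (t + s) - base w s).
Proof.
move=> t.
have shift_cts : continuous (fun u : R => u + s).
  by move=> u; apply: (@cvgD R R^o); [exact: cvg_id|exact: cvg_cst].
have base_cts : {for t, continuous (fun u => base w (u + s))}.
  by apply: (continuous_comp (shift_cts t)); exact: base_continuous.
by apply: (cvgB base_cts); exact: cvg_cst.
Qed.

Lemma shift_area_continuous (R : realType) (d : nat) (s : R)
    (F : R * R -> 'M[R]_d) : continuous F ->
  continuous (fun p : R * R => F (p.1 + s, p.2 + s)).
Proof.
move=> cF p.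
have shift_cts : {for p, continuous (fun q : R * R => (q.1 + s, q.2 + s))}.
  have cst : (fun=> s : R^o) @ p --> (s : R^o) by exact: cvg_cst.
  have c1 : (fun q : R * R => q.1 + s : R^o) @ p --> (p.1 + s : R^o).
    by apply: (cvgD _ cst); exact: cvg_fst.
  have c2 : (fun q : R * R => q.2 + s : R^o) @ p --> (p.2 + s : R^o).
    by apply: (cvgD _ cst); exact: cvg_snd.
  exact: (cvg_pair c1 c2).
by apply: (continuous_comp shift_cts); exact: cF.
Qed.

Definition path_shift (R : realType) (d : nat) (s : R) (w : Omega R d) :
    Omega R d :=
  @RPath R d (fun t => base w (t + s) - base w s)
    (fun p => area w (p.1 + s, p.2 + s))
    (fun p => darea w (p.1 + s, p.2 + s))
    (shift_base_at0 s w) (@shift_base_continuous R d s w)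
    (shift_area_continuous (@area_continuous R d w))
    (shift_area_continuous (@darea_continuous R d w)).

Definition ergodic_mds (R : realType) (dO : measure_display)
    (O : measurableType dO) (P : probability O R) (theta : R -> O -> O) :
    Prop :=
  [/\ measurable_fun [set: measurableTypeR R * O]
        (fun x : measurableTypeR R * O => theta x.1 x.2),
      theta 0 = id,
      forall s t, theta (s + t) = theta s \o theta t,
      forall t (A : set O), measurable A -> P (theta t @^-1` A) = P A &
      forall A : set O, measurable A -> (forall t, theta t @^-1` A = A) ->
        P A = 0%E \/ P A = 1%E].

(* The case of zero variance is separate because normal_prob 0 0 is not a
   Dirac mass. *)
Definition centered_gaussian (R : realType) (dT : measure_display)
    (T : measurableType dT) (P : probability T R) (Z : T -> R) : Prop :=
  exists2 s : R, 0 <= s &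
    forall A : set (measurableTypeR R), measurable A ->
      P (Z @^-1` A) = if s == 0 then \d_(0 : R) A else normal_prob 0 s A.

Definition fbm (R : realType) (dT : measure_display) (T : measurableType dT)
    (P : probability T R) (H : R) (W : R -> T -> R) : Prop :=
  [/\ forall t, measurable_fun [set: T] (W t),
      forall w, continuous (W ^~ w),
      forall (k : nat) (c tau : 'I_k -> R),
        centered_gaussian P (fun w => \sum_(i < k) c i * W (tau i) w) &
      forall s t,
        ('E_P[(W s \* W t)%R])%E =
        (2^-1 * (`|s| `^ (2 * H) + `|t| `^ (2 * H)
                 - `|t - s| `^ (2 * H)))%:E].

Definition process_sigma_algebra (R : realType) (dT : measure_display)
    (T : measurableType dT) (W : R -> T -> R) : set (set T) :=
  <<s [set E | exists t (A : set (measurableTypeR R)),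
               measurable A /\ E = W t @^-1` A] >>.

(* Some of the events E i may be the full space, so that the product rule
   covers every subfamily. *)
Definition independent_processes (R : realType) (dT : measure_display)
    (T : measurableType dT) (P : probability T R) (d : nat)
    (W : 'I_d -> R -> T -> R) : Prop :=
  forall E : 'I_d -> set T, (forall i, process_sigma_algebra (W i) (E i)) ->
    P (\bigcap_(i in [set: 'I_d]) E i) = (\prod_(i < d) P (E i))%E.

Definition oriented_integral (R : realType) (f : R -> R) (s t : R) : R :=
  if s <= t then \int[lebesgue_measure]_(x in `[s, t]) f x
  else - \int[lebesgue_measure]_(x in `[t, s]) f x.

(* Even in eps, so letting eps tend to 0 from both sides changes nothing. *)
Definition symmetric_approx (R : realType) (T : Type) (u W : R -> T -> R)
    (s t eps : R) (w : T) : R :=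
  oriented_integral
    (fun x => u x w * ((W (x + eps) w - W (x - eps) w) / (2 * eps))) s t.

Definition is_symmetric_integral (R : realType) (dT : measure_display)
    (T : measurableType dT) (P : probability T R) (u W : R -> T -> R)
    (s t : R) (I : T -> R) : Prop :=
  (fun eps : R =>
     ('E_P[fun w => ((symmetric_approx u W s t eps w - I w) ^+ 2)%R])%E)
  @ 0^' --> 0%E.

Definition fbm_lift (R : realType) (dT : measure_display)
    (T : measurableType dT) (P : probability T R) (d : nat) (H r : R)
    (Bbar : T -> rpath R d) : Prop :=
  let W i t w := base (Bbar w) t i 0 in
  [/\ forall i, fbm P H (W i),
      independent_processes P W,
      forall s t i j,
        is_symmetric_integral P (fun x w => W i x w - W i s w) (W j) s t
          (fun w => area (Bbar w) (s, t) i j) &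
      forall s t i j,
        is_symmetric_integral P
          (fun x w => W i (x - r) w - W i (s - r) w) (W j) s t
          (fun w => darea (Bbar w) (s, t) i j)].

(* A controlled path on J is given by total functions on R of which only the
   values on J are relevant. *)
Definition cpath (R : realType) (d n : nat) : Type :=
  ((R -> 'cV[R]_n) * (R -> 'M[R]_(n, d)))%type.

Definition remainder (R : realType) (d n : nat) (X : R -> 'cV[R]_d)
    (m : cpath R d n) : R -> R -> 'cV[R]_n :=
  fun s t => incr m.1 s t - m.2 s *m incr X s t.

Definition controlled (R : realType) (d n : nat) (beta : R)
    (X : R -> 'cV[R]_d) (J : set R) : set (cpath R d n) :=
  [set m | (holder beta J (incr m.2) < +oo)%E /\
           (holder (2 * beta) J (remainder X m) < +oo)%E].

Definition cnorm (R : realType) (d n : nat) (beta : R) (X : R -> 'cV[R]_d)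
    (J : set R) (m : cpath R d n) : \bar R :=
  (sup_norm J m.1 + sup_norm J m.2 + holder beta J (incr m.2)
   + holder (2 * beta) J (remainder X m))%E.

Definition csub (R : realType) (d n : nat) (m1 m2 : cpath R d n) :
    cpath R d n :=
  (fun t => m1.1 t - m2.1 t, fun t => m1.2 t - m2.2 t).

Definition ceq_on (R : realType) (d n : nat) (J : set R)
    (m1 m2 : cpath R d n) : Prop :=
  forall t, J t -> m1.1 t = m2.1 t /\ m1.2 t = m2.2 t.

(* a :: s lists the points of a partition, as in itv_partition a b s. *)
Definition mesh (R : realType) (a : R) (s : seq R) : R :=
  \big[Num.max/0]_(0 <= j < size s)
    (nth a (a :: s) j.+1 - nth a (a :: s) j).

Definition partition_sum (R : realType) (V : zmodType) (F : R -> R -> V)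
    (a : R) (s : seq R) : V :=
  \sum_(0 <= j < size s) F (nth a (a :: s) j) (nth a (a :: s) j.+1).

Definition is_partition_limit (R : realType) (V : normedModType R)
    (F : R -> R -> V) (a b : R) (I : V) : Prop :=
  forall eps : R, 0 < eps -> exists2 delta : R, 0 < delta &
    forall s : seq R, itv_partition a b s -> mesh a s < delta ->
      `|partition_sum F a s - I| < eps.

(* Elements of L(R^d, L(R^d, R^n)) are families Z, with Z i the image of e_i;
   tensor_apply Z T is the image of the tensor T. *)
Definition tensor_apply (R : realType) (d n : nat) (Z : 'I_d -> 'M[R]_(n, d))
    (T : 'M[R]_d) : 'cV[R]_n :=
  \sum_(i < d) \sum_(j < d) T i j *: col j (Z i).

Definition is_rough_integral (R : realType) (d n : nat) (w : rpath R d)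
    (z : R -> 'M[R]_(n, d)) (z0 z1 : R -> 'I_d -> 'M[R]_(n, d))
    (a b : R) (I : 'cV[R]_n) : Prop :=
  is_partition_limit
    (fun s t => z s *m incr (base w) s t + tensor_apply (z0 s) (area w (s, t))
                + tensor_apply (z1 s) (darea w (s, t))) a b I.

Fixpoint bounded_Ck (R : realType) (V W : normedModType R) (k : nat)
    (f : V -> W) : Prop :=
  [/\ continuous f,
      exists M : R, forall x, `|f x| <= M &
      if k is k'.+1 then
        (forall x, differentiable f x) /\
        (forall v, bounded_Ck k' (fun x => 'D_v f x))
      else True].

Definition charge_integral (R : realType) (dT : measure_display)
    (T : measurableType dT) (nu : {charge set T -> \bar R}) (D : set T)
    (f : T -> R) : R :=
  let: exist P hP := cid (Hahn_decomposition nu) in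
  let: exist N hPN := cid hP in
  \int[jordan_pos hPN]_(x in D) f x - \int[jordan_neg hPN]_(x in D) f x.

(* A signed measure on [-r, 0] is given as a charge on the line, of which only
   the restriction to [-r, 0] is used. *)
Definition delay_average (R : realType) (n : nat) (r : R)
    (pi : 'I_n -> 'I_n -> {charge set (measurableTypeR R) -> \bar R})
    (y : R -> 'cV[R]_n) (t : R) : 'cV[R]_n :=
  \col_j \sum_(i < n)
    charge_integral (pi i j) `[- r, 0] (fun th => y (th + t) i 0).

Definition drift_integral (R : realType) (n : nat) (r : R)
    (A : {linear ('cV[R]_n * 'cV[R]_n)%type -> 'cV[R]_n})
    (pi : 'I_n -> 'I_n -> {charge set (measurableTypeR R) -> \bar R})
    (y : R -> 'cV[R]_n) (s t : R) : 'cV[R]_n :=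
  \col_k \int[lebesgue_measure]_(u in `[s, t])
    (A (y u, delay_average r pi y u)) k 0.

Definition gubinelli (R : realType) (d n : nat) (r : R)
    (G : 'cV[R]_n * 'cV[R]_n -> 'M[R]_(n, d)) (y : R -> 'cV[R]_n) (t : R) :
    'M[R]_(n, d) :=
  G (y t, y (t - r)).

(* y'_{s-r} in the delayed term: the Gubinelli derivative of the initial path
   up to time 0, that of the solution afterwards. If the two differ at 0 the
   integrand only jumps at time r; this does not affect the existence or the
   value of the limit defining the rough integral. *)
Definition delayed_gubinelli (R : realType) (d n : nat) (r : R)
    (G : 'cV[R]_n * 'cV[R]_n -> 'M[R]_(n, d)) (xi : cpath R d n)
    (y : R -> 'cV[R]_n) (s : R) : 'M[R]_(n, d) :=
  if s - r <= 0 then xi.2 (s - r) else gubinelli r G y (s - r).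

Definition is_solution (R : realType) (d n : nat) (beta r : R)
    (A : {linear ('cV[R]_n * 'cV[R]_n)%type -> 'cV[R]_n})
    (pi : 'I_n -> 'I_n -> {charge set (measurableTypeR R) -> \bar R})
    (G : 'cV[R]_n * 'cV[R]_n -> 'M[R]_(n, d)) (w : rpath R d)
    (xi : cpath R d n) (y : R -> 'cV[R]_n) : Prop :=
  [/\ forall s, - r <= s <= 0 -> y s = xi.1 s,
      forall a b, 0 <= a -> a < b ->
        controlled beta (base w) `[a, b] (y, gubinelli r G y) &
      forall s t, 0 <= s -> s < t -> exists2 I : 'cV[R]_n,
        is_rough_integral w (gubinelli r G y)
          (fun u i => 'd G (y u, y (u - r)) (col i (gubinelli r G y u), 0))
          (fun u i =>
             'd G (y u, y (u - r)) (0, col i (delayed_gubinelli r G xi y u)))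
          s t I &
        y t - y s = drift_integral r A pi y s t + I].

(* Solutions are determined on [-r, +oo[ only; earlier values are irrelevant. *)
Definition flow (R : realType) (d n : nat) (beta r : R)
    (A : {linear ('cV[R]_n * 'cV[R]_n)%type -> 'cV[R]_n})
    (pi : 'I_n -> 'I_n -> {charge set (measurableTypeR R) -> \bar R})
    (G : 'cV[R]_n * 'cV[R]_n -> 'M[R]_(n, d)) (w : rpath R d)
    (xi : cpath R d n) : R -> 'cV[R]_n :=
  xget (fun=> 0) [set y | is_solution beta r A pi G w xi y].

(* The solution on [(m-1)r, mr] with its Gubinelli derivative, transported to
   [-r, 0]; for m = 0 this is the initial path. *)
Definition varphi (R : realType) (d n : nat) (beta r : R)
    (A : {linear ('cV[R]_n * 'cV[R]_n)%type -> 'cV[R]_n})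
    (pi : 'I_n -> 'I_n -> {charge set (measurableTypeR R) -> \bar R})
    (G : 'cV[R]_n * 'cV[R]_n -> 'M[R]_(n, d)) (m : nat) (w : rpath R d)
    (xi : cpath R d n) : cpath R d n :=
  if m is 0%N then xi else
  let y := flow beta r A pi G w xi in
  (fun s => y (m%:R * r + s), fun s => gubinelli r G y (m%:R * r + s)).

(* Main.v *)
(* On one delay interval the delayed argument eta is a given path controlled by
   the shifted path Y = X(. - r), so the equation is an ordinary rough equation
   dy = drift + G(y, eta) dX driven by X with iterated integrals of (X, Y)
   against X. A solution is characterized without the rough integral by Davie's
   estimate: y_t - y_s - drift - germ(s, t) = O(|t - s|^(3 beta)), where the germ
   is the summand of the Riemann sums. By the sewing lemma one Picard step maps
   a ball of controlled paths on a short window into itself and halves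
   distances, also for two different data up to the distance of the data; this
   gives local existence, uniqueness and Lipschitz dependence. The drift is only
   linearly bounded, so the window for a solution of size K has length h with
   h^(1 - beta) of order 1 / K; then the increment over the window is of order
   h^beta, that is K h, and the solution grows at most exponentially.

   A path solves the delay equation if and only if, for every k, its translate
   to the interval [0, r] solves the one-interval equation for the path shifted
   by k r, the data being the previous piece. At the finitely many times k r the
   germ may have a wrong delayed derivative, but a partition has only one
   interval at each of them, which does not affect the limit of the Riemann
   sums. The flow is therefore an iteration of the one-interval solution map
   over the shifted paths: this yields global existence and uniqueness, the
   cocycle property, and continuity. Everything holds pathwise, for each
   delayed rough path. *)

Require Import Defs.
From HB Require Import structures.
From mathcomp Require Import all_boot all_order all_algebra.
From mathcomp Require Import all_classical all_reals all_analysis.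
From mathcomp Require Import measurable_realfun ring lra.
Import Order.TTheory GRing.Theory Num.Theory.
Import numFieldNormedType.Exports.
Local Open Scope classical_set_scope.
Local Open Scope ring_scope.

Set Implicit Arguments.
Unset Strict Implicit.
Unset Printing Implicit Defensive.

(** * Identities in abelian groups, matrix norms and Taylor estimates *)

(** The Gubinelli derivative of a solution is always [G (y, eta)], so no space of controlled paths
    has to be completed: iterates converge pointwise and estimates pass to the limit up to geometric
    errors. Smallness comes from one relation, [rho * p s t <= 1] on a window of length [h] with
    [rho = h ^ (- beta)]: radii and distances are measured in units of [rho], and terms without this
    unit become negligible once [rho] exceeds the threshold [Kst]. The second tool: a function of
    two times that is of order above 1, with whatever constant, is controlled by its additivity
    defect alone. Hence the constant in the Davie estimate of a given solution is immaterial, and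
    the difference of two solutions inherits the smallness of the difference of their germ defects;
    comparing these takes three derivatives of [G]. The obstacle to continuity is uniformity,
    because the windows depend on the size of the solution. An a priori bound is obtained with
    shrinking windows; restarting at an arbitrary time on the window that belongs to the final
    bound, and identifying the two solutions by uniqueness, gives one window for all data in a
    ball. *)

Section zmod_tactic.

Inductive zexp := ZVar of nat | ZAdd of zexp & zexp | ZOpp of zexp | ZZero.

Fixpoint zden (V : zmodType) (env : seq V) e : V :=
  match e with
  | ZVar i => env`_i
  | ZAdd a b => zden env a + zden env b
  | ZOpp a => - zden env a
  | ZZero => 0
  end.

Fixpoint zcoef e (i : nat) : int :=
  match e with
  | ZVar j => if i == j then 1 else 0
  | ZAdd a b => zcoef a i + zcoef b i
  | ZOpp a => - zcoef a i
  | ZZero => 0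
  end.

(** An additive expression is determined by the integer coefficients of its unknowns, which turns
    identities in an abelian group into a computation. An index outside [env] is consistent with
    this, because its value is the default 0. *)
Lemma zdenE (V : zmodType) (env : seq V) e :
  zden env e = \sum_(i < size env) env`_i *~ zcoef e i.
Proof.
elim: e => [j|a IHa b IHb|a IHa|] /=.
- have [js|sj] := ltnP j (size env).
    rewrite (bigD1 (Ordinal js)) //= eqxx mulr1z big1 ?addr0// => i /negPf.
    by rewrite -val_eqE /= => ->; rewrite mulr0z.
  rewrite nth_default// big1// => i _.
  by rewrite ltn_eqF ?mulr0z// (leq_trans (ltn_ord i)).
- by rewrite IHa IHb -big_split/=; apply: eq_bigr => i _; rewrite -mulrzDr.
- by rewrite IHa -sumrN; apply: eq_bigr => i _; rewrite mulrNz.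
- by rewrite big1// => i _; rewrite mulr0z.
Qed.

Lemma zden_eq (V : zmodType) (env : seq V) e1 e2 :
  all (fun i => zcoef e1 i == zcoef e2 i) (iota 0 (size env)) ->
  zden env e1 = zden env e2.
Proof.
move=> /allP h; rewrite !zdenE; apply: eq_bigr => i _; congr (_ *~ _).
by apply/eqP/h; rewrite mem_iota/=.
Qed.

End zmod_tactic.

Create HintDb zmod_db discriminated.
Ltac zsame_syn x y := constr_eq_nounivs x y.
Ltac zsame_unif x y :=
  match goal with _ => constr_eq_nounivs x y | _ => unify x y with zmod_db end.
Ltac zmem same x l :=
  lazymatch l with
  | nil => constr:(false)
  | cons ?y ?t =>
    match goal with
    | _ => let _ := match goal with _ => same x y end in constr:(true)
    | _ => zmem same x t
    end
  end.
Ltac zidx same x l :=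
  lazymatch l with
  | cons ?y ?t =>
    match goal with
    | _ => let _ := match goal with _ => same x y end in constr:(0%N)
    | _ => let i := zidx same x t in constr:(i.+1)
    end
  end.
Ltac zvars same e l :=
  lazymatch e with
  | (?a + ?b)%R => let l1 := zvars same a l in zvars same b l1
  | (- ?a)%R => zvars same a l
  | 0%R => l
  | _ => lazymatch zmem same e l with true => l | false => constr:(cons e l) end
  end.
Ltac zreify same e l :=
  lazymatch e with
  | (?a + ?b)%R =>
    let x := zreify same a l in let y := zreify same b l in constr:(ZAdd x y)
  | (- ?a)%R => let x := zreify same a l in constr:(ZOpp x)
  | 0%R => constr:(ZZero)
  | _ => let i := zidx same e l in constr:(ZVar i)
  end.
Ltac zmod_with same :=
  lazymatch goal with
  | |- @eq ?V ?a ?b =>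
    let l0 := zvars same a (@nil V) in let l := zvars same b l0 in
    let x := zreify same a l in let y := zreify same b l in
    refine (@zden_eq _ l x y _); vm_compute; reflexivity
  end.
(* [zmod] decides linear identities with integer coefficients in an abelian
   group, the maximal non-additive subterms being the unknowns; these are
   compared up to unification only if comparing them syntactically fails. *)
Ltac zmod := first [zmod_with zsame_syn | zmod_with zsame_unif].

Section matrix_norm.
Context {R : realType}.

Lemma mx_norm_ge_entry m n (A : 'M[R]_(m, n)) i j : `|A i j| <= `|A|.
Proof.
rewrite [`|A|]mx_normrE.
by apply: (le_bigmax _ (fun ij : 'I_m * 'I_n => `|A ij.1 ij.2|) (i, j)).
Qed.

Lemma mx_norm_le m n (A : 'M[R]_(m, n)) c :
  0 <= c -> (forall i j, `|A i j| <= c) -> `|A| <= c.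
Proof. by move=> c0 h; rewrite [`|A|]mx_normrE; apply: bigmax_le => // -[]. Qed.

Lemma mx_norm_mul m n q (A : 'M[R]_(m, n)) (B : 'M[R]_(n, q)) :
  `|A *m B| <= n%:R * `|A| * `|B|.
Proof.
apply: mx_norm_le => [|i j]; first by rewrite !mulr_ge0.
rewrite mxE; apply: le_trans (ler_norm_sum _ _ _) _.
apply: (@le_trans _ _ (\sum_(k < n) `|A| * `|B|)).
  by apply: ler_sum => k _; rewrite normrM ler_pM// mx_norm_ge_entry.
by rewrite sumr_const card_ord -mulrA -[leLHS]mulr_natl.
Qed.
End matrix_norm.

Section mvt.
Context {R : realType} {E : normedModType R}.

(** The norm is the largest entry, so the scalar mean value theorem for each entry of [f] along the
    segment from [x] to [x + v] suffices. *)
Lemma mvt_segment m n (f : E -> 'M[R]_(m, n)) x v C :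
  (forall y, differentiable f y) ->
  (forall t, 0 <= t <= 1 -> `|'d f (x + t *: v) v| <= C) ->
  `|f (x + v) - f x| <= C.
Proof.
move=> df dfC; apply: mx_norm_le => [|i j].
  (* The hypothesis at [t = 0] shows that [C] is nonnegative. *)
  by apply: le_trans (dfC 0 _); rewrite // lexx ler01.
pose l (t : R) := x + t *: v.
pose g (t : R) := f (l t) i j.
have dl t : is_diff t l (fun h => h *: v).
  have h1 : is_diff t (cst x + (fun t : R => t *: v)) (0 + (fun t : R => t *: v)).
    exact: is_diffD.
  by rewrite add0r in h1.
have dg (t : R) : is_derive t 1 g ('d f (l t) v i j).
  have dfl : differentiable (f \o l) t by exact: differentiable_comp.
  have dd : derivable (f \o l) t 1 by exact: diff_derivable.
  have -> : 'd f (l t) v i j = 'D_1 g t.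
    rewrite -[v]scale1r -(_ : 'd l t 1 = 1 *: v); last by rewrite diff_val.
    rewrite -[LHS]/(('d f (l t) \o 'd l t) 1 i j) -diff_comp//.
    by rewrite -deriveE// derive_mx// mxE.
  apply/derivableP; exact: (proj1 (derivable_mxP _ _ _) dd i j).
have [|t|c] := @MVT_segment R g (fun t => 'd f (l t) v i j) 0 1.
- exact: ler01.
- apply: continuous_subspaceT => {}t.
  by apply/differentiable_continuous/derivable1_diffP.
move=> /itvP c01.
rewrite /g /l scale1r scale0r addr0 subr0 mulr1 !mxE => ->.
by apply: le_trans (mx_norm_ge_entry _ _ _) _; apply: dfC; rewrite !c01.
Qed.
End mvt.

Section taylor.
Context {R : realType} {E : normedModType R} {m n : nat}.
Implicit Types (f : E -> 'M[R]_(m, n)) (x y a b v w : E).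

Lemma is_diff_shift f y v : differentiable f (y + v) ->
  is_diff y (fun z => f (z + v)) ('d f (y + v)).
Proof.
move=> df.
have h : is_diff y (id + cst v : E -> E) (id + 0) by exact: is_diffD.
rewrite addr0 in h.
have df' : is_diff ((id + cst v : E -> E) y) f ('d f (y + v)).
  exact: differentiableP.
exact: (is_diff_comp h df').
Qed.

Lemma is_diff_lin (l : {linear E -> 'M[R]_(m, n)}) x :
  continuous l -> is_diff x l l.
Proof.
move=> cl; apply: DiffDef; first exact: linear_differentiable.
exact: diff_lin.
Qed.

Lemma diff_cts f x : differentiable f x -> continuous ('d f x).
Proof. by move=> df; exact: diff_continuous. Qed.

(** Mean value inequality for the difference of [f] and its translate by [a], whose derivative is
    already of order [|a|]. *)
Lemma four_point f C : (forall x, differentiable f x) ->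
  (forall x a b, `|'d f (x + a) b - 'd f x b| <= C * `|a| * `|b|) ->
  forall x a v, `|f (x + a + v) - f (x + a) - (f (x + v) - f x)|
    <= C * `|a| * `|v|.
Proof.
move=> df dfC x a v.
pose h := (fun z => f (z + a)) - f.
have dh y : is_diff y h (('d f (y + a) : E -> _) - ('d f y : E -> _)).
  apply: is_diffB; last exact: differentiableP.
  exact: is_diff_shift.
have := @mvt_segment R E m n h x v (C * `|a| * `|v|).
rewrite /h !fctE.
rewrite (_ : _ - _ = f (x + a + v) - f (x + a) - (f (x + v) - f x)).
  apply => // t _; rewrite diff_val !fctE; exact: dfC.
rewrite (addrAC x v a); zmod.
Qed.

Variables (f : E -> 'M[R]_(m, n)) (M : R).
Hypothesis df : forall x, differentiable f x.
Hypothesis ddf : forall b x, differentiable (fun y => 'D_b f y) x.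
Hypothesis dddf : forall a b x, differentiable (fun y => 'D_a (fun z => 'D_b f z) y) x.
Hypothesis f0 : forall x, `|f x| <= M.
Hypothesis f1 : forall x a, `|'D_a f x| <= M * `|a|.
Hypothesis f2 : forall x a b, `|'D_a (fun y => 'D_b f y) x| <= M * `|b| * `|a|.
Hypothesis f3 : forall x a b c,
  `|'D_c (fun z => 'D_a (fun y => 'D_b f y) z) x| <= M * `|b| * `|a| * `|c|.

Lemma lip0 x v : `|f (x + v) - f x| <= M * `|v|.
Proof. by apply: mvt_segment => // t _; rewrite -deriveE. Qed.

Lemma bnd1 x v : `|'d f x v| <= M * `|v|.
Proof. by rewrite -deriveE. Qed.

Lemma lip1 x a v : `|'d f (x + a) v - 'd f x v| <= M * `|a| * `|v|.
Proof.
rewrite -!deriveE//.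
have := @mvt_segment R E m n (fun y => 'D_v f y) x a (M * `|a| * `|v|).
by apply=> // t _; rewrite -deriveE// mulrAC.
Qed.

Lemma four0 x a v :
  `|f (x + a + v) - f (x + a) - (f (x + v) - f x)| <= M * `|a| * `|v|.
Proof. by apply: four_point => // *; exact: lip1. Qed.

(** [four_point] for the directional derivative ['D_w f]; this is where the third derivative of [f]
    enters. *)
Lemma four1 x a v w :
  `|'d f (x + a + v) w - 'd f (x + a) w - ('d f (x + v) w - 'd f x w)|
    <= M * `|a| * `|v| * `|w|.
Proof.
rewrite -!deriveE// -mulrA -mulrA mulrC -mulrA -mulrA [leRHS]mulrC -!mulrA.
rewrite [`|v| * _]mulrC !mulrA.
apply: (@four_point (fun y => 'D_w f y)) => // {}x {}a b.
rewrite -!deriveE//.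
have := @mvt_segment R E m n (fun y => 'D_b (fun z => 'D_w f z) y) x a.
by apply => // t _; rewrite -deriveE// [leRHS]mulrAC [`|w| * _]mulrC.
Qed.

(** After subtraction of its linear part at [x], [f] has a derivative bounded by [M] times the
    distance to [x], which is at most [|v| + |w|] on the segment from [x + w] to [x + v]. *)
Lemma taylor2_diff x v w :
  `|f (x + v) - f (x + w) - 'd f x (v - w)|
    <= M * `|v - w| * (`|v| + `|w|).
Proof.
pose h := f - ('d f x : E -> _).
have dh y : is_diff y h (('d f y : E -> _) - ('d f x : E -> _)).
  apply: is_diffB; first exact: differentiableP.
  by apply: is_diff_lin; exact: diff_cts.
have M0 : 0 <= M by apply: le_trans (f0 x).
have := @mvt_segment R E m n h (x + w) (v - w) (M * `|v - w| * (`|v| + `|w|)).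
rewrite /h !fctE (_ : x + w + (v - w) = x + v); last by zmod.
rewrite (_ : _ - _ = f (x + v) - f (x + w) - 'd f x (v - w)); last first.
  by rewrite !(linearD ('d f x)) (linearN ('d f x)); zmod.
apply => // t /andP[t0 t1]; rewrite diff_val !fctE -addrA.
apply: le_trans (lip1 _ _ _) _; rewrite mulrAC ler_wpM2l ?mulr_ge0//.
have -> : w + t *: (v - w) = (1 - t) *: w + t *: v.
  by rewrite scalerBr scalerBl scale1r; zmod.
apply: le_trans (ler_normD _ _) _; rewrite addrC !normrZ.
rewrite (ger0_norm t0) (ger0_norm (_ : 0 <= 1 - t)) ?subr_ge0//.
by apply: lerD; rewrite ler_piMl// gerBl.
Qed.

(** The second order Taylor remainder depends on the base point in a Lipschitz way: the derivative
    in [v] of the difference of two remainders is a double increment of ['d f], which [four1]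
    bounds. *)
Lemma taylor2_shift x a v :
  `|f (x + a + v) - f (x + a) - 'd f (x + a) v - (f (x + v) - f x - 'd f x v)|
    <= M * `|a| * `|v| ^+ 2.
Proof.
pose h := (fun z => f (z + (x + a))) - (fun z => f (z + x))
          - (('d f (x + a) : E -> _) - ('d f x : E -> _)).
have dh y : is_diff y h (('d f (y + (x + a)) : E -> _)
   - ('d f (y + x) : E -> _) - (('d f (x + a) : E -> _) - ('d f x : E -> _))).
  apply: is_diffB; last first.
    by apply: is_diffB; apply: is_diff_lin; exact: diff_cts.
  by apply: is_diffB; exact: is_diff_shift.
have M0 : 0 <= M by apply: le_trans (f0 x).
have := @mvt_segment R E m n h 0 v (M * `|a| * `|v| ^+ 2).
rewrite /h !fctE !add0r !linear0 (addrC v x) (addrC v (x + a)).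
rewrite (_ : _ - _ = f (x + a + v) - f (x + a) - 'd f (x + a) v
   - (f (x + v) - f x - 'd f x v)); last by zmod.
apply => // t /andP[t0 t1]; rewrite add0r diff_val !fctE.
rewrite [t *: v + (x + a)]addrC [t *: v + x]addrC.
have := four1 x a (t *: v) v.
rewrite (_ : 'd f (x + a + t *: v) v - 'd f (x + a) v -
   ('d f (x + t *: v) v - 'd f x v) = 'd f (x + a + t *: v) v -
   'd f (x + t *: v) v - ('d f (x + a) v - 'd f x v)); last by zmod.
move=> h4; apply: le_trans h4 _.
rewrite normrZ (ger0_norm t0) expr2 !mulrA.
by rewrite ler_wpM2r// ler_wpM2r// -mulrA ler_wpM2l// ?mulr_ge0// ler_piMr.
Qed.

End taylor.

(** All that the rough estimates use about [G], under one constant: bounds, increments, double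
    increments and Taylor remainders. [dG] is an abstract map, linear in its last argument, so no
    differentiability has to be carried along. *)
Record C3_bound (R : realType) (E : normedModType R) (m n : nat)
    (G : E -> 'M[R]_(m, n)) (dG : E -> E -> 'M[R]_(m, n)) (M : R) : Prop :=
  C3Bound {
  C3_bound0 : forall x, `|G x| <= M ;
  C3_linear : forall x (k : R) u v, dG x (k *: u + v) = k *: dG x u + dG x v ;
  C3_bound1 : forall x v, `|dG x v| <= M * `|v| ;
  C3_lip0 : forall x v, `|G (x + v) - G x| <= M * `|v| ;
  C3_lip1 : forall x a v, `|dG (x + a) v - dG x v| <= M * `|a| * `|v| ;
  C3_four0 : forall x a v,
    `|G (x + a + v) - G (x + a) - (G (x + v) - G x)| <= M * `|a| * `|v| ;
  C3_four1 : forall x a v w,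
    `|dG (x + a + v) w - dG (x + a) w - (dG (x + v) w - dG x w)|
      <= M * `|a| * `|v| * `|w| ;
  C3_taylor_diff : forall x v w,
    `|G (x + v) - G (x + w) - dG x (v - w)| <= M * `|v - w| * (`|v| + `|w|) ;
  C3_taylor_shift : forall x a v,
    `|G (x + a + v) - G (x + a) - dG (x + a) v - (G (x + v) - G x - dG x v)|
      <= M * `|a| * `|v| ^+ 2 }.

Lemma C3_bound_le (R : realType) (E : normedModType R) (m n : nat)
    (G : E -> 'M[R]_(m, n)) (dG : E -> E -> 'M[R]_(m, n)) (M M' : R) :
  C3_bound G dG M -> M <= M' -> C3_bound G dG M'.
Proof.
move=> H MM; have M0 : 0 <= M by apply: le_trans (C3_bound0 H 0); exact: normr_ge0.
split=> //.
- by move=> x; apply: le_trans (C3_bound0 H x) _.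
- exact: C3_linear H.
- by move=> x v; apply: le_trans (C3_bound1 H x v) _; rewrite ler_wpM2r.
- by move=> x v; apply: le_trans (C3_lip0 H x v) _; rewrite ler_wpM2r.
- by move=> x a v; apply: le_trans (C3_lip1 H x a v) _; rewrite -!mulrA ler_wpM2r// mulr_ge0.
- by move=> x a v; apply: le_trans (C3_four0 H x a v) _; rewrite -!mulrA ler_wpM2r// mulr_ge0.
- by move=> x a v w; apply: le_trans (C3_four1 H x a v w) _; rewrite -!mulrA ler_wpM2r// !mulr_ge0.
- move=> x v w; apply: le_trans (C3_taylor_diff H x v w) _.
  by rewrite -!mulrA ler_wpM2r// !mulr_ge0// addr_ge0.
- move=> x a v; apply: le_trans (C3_taylor_shift H x a v) _.
  by rewrite -!mulrA ler_wpM2r// !mulr_ge0// exprn_ge0.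
Qed.

(** * Uniform derivative bounds from [bounded_Ck] *)

Section bounded_Ck_estimates.
Context {R : realType} {n m d : nat}.
Let E := ('cV[R]_n * 'cV[R]_n)%type.
Implicit Types (f : E -> 'M[R]_(m, d)) (x a b c : E).

Lemma bounded_CkS k f : bounded_Ck k.+1 f -> bounded_Ck k f.
Proof.
elim: k f => [|k IH] f [cf bf [df Df]]; first by split.
by split=> //; split=> // v; exact: IH.
Qed.

(** Indices of the canonical basis of [E]. [bounded_Ck] bounds each directional derivative by a
    constant depending on the direction; expanding the direction in this finite basis makes the
    bounds linear in it. *)
Let K : finType := ('I_n + 'I_n)%type.
Let e (k : K) : E :=
  match k with inl i => (delta_mx i 0, 0) | inr i => (0, delta_mx i 0) end.
Let co (k : K) (x : E) : R :=
  match k with inl i => x.1 i 0 | inr i => x.2 i 0 end.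

Let co_le k x : `|co k x| <= `|x|.
Proof.
by case: k => i; rewrite /co prod_normE le_max mx_norm_ge_entry ?orbT.
Qed.

Let coE x : x = \sum_(k : K) co k x *: e k.
Proof.
rewrite big_sumType /=.
have cvE (u : 'cV[R]_n) : u = \sum_(i < n) u i 0 *: delta_mx i 0.
  apply/matrixP => i j; rewrite summxE (bigD1 i)//= big1.
    by rewrite !mxE !eqxx (ord1 j) addr0 mulr1.
  by move=> k ki; rewrite !mxE eq_sym (negPf ki) mulr0.
have h1 : (\sum_(i < n) x.1 i 0 *: ((delta_mx i 0 : 'cV[R]_n), (0 : 'cV[R]_n)))
    = (x.1, 0).
  rewrite [x.1 in RHS]cvE.
  apply: (big_ind2 (fun (p : E) q => p = (q, 0))) => //.
    by move=> ? ? ? ? -> ->; congr pair; rewrite /= addr0.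
  by move=> i _; congr pair; rewrite /= scaler0.
have h2 : (\sum_(i < n) x.2 i 0 *: ((0 : 'cV[R]_n), (delta_mx i 0 : 'cV[R]_n)))
    = (0, x.2).
  rewrite [x.2 in RHS]cvE.
  apply: (big_ind2 (fun (p : E) q => p = (0, q))) => //.
    by move=> ? ? ? ? -> ->; congr pair; rewrite /= addr0.
  by move=> i _; congr pair; rewrite /= scaler0.
rewrite h1 h2 [LHS]surjective_pairing; congr pair; rewrite /= ?addr0 ?add0r//.
Qed.

Let derive_co f b : (forall x, differentiable f x) ->
  (fun x => 'D_b f x) = \sum_(k : K) co k b *: (fun x => 'D_(e k) f x).
Proof.
move=> df; apply/funext => x.
rewrite deriveE// [in LHS](coE b) linear_sum fct_sumE.
by apply: eq_bigr => k _; rewrite linearZ/= -deriveE.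
Qed.

Let derive_lin (g : K -> E -> 'M[R]_(m, d)) (s : K -> R) a :
  (forall k x, differentiable (g k) x) ->
  forall x, 'D_a (\sum_k s k *: g k) x =
  (\sum_k s k *: (fun x => 'D_a (g k) x)) x.
Proof.
move=> dg x.
have H : is_derive x a (\sum_k s k *: g k) (\sum_k s k *: 'D_a (g k) x).
  elim/big_ind2 : _ => [|? ? ? ? ? ?|k _].
  - exact: is_derive_cst.
  - exact: is_deriveD.
  - by apply: is_deriveZ; apply/derivableP/diff_derivable.
by rewrite derive_val fct_sumE.
Qed.

Let sum_le (g : K -> E -> 'M[R]_(m, d)) b x (M : K -> R) :
  (forall k, `|g k x| <= M k) ->
  `|(\sum_k co k b *: g k) x| <= (\sum_k M k) * `|b|.
Proof.
move=> gM; rewrite fct_sumE mulr_suml.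
apply: le_trans (ler_norm_sum _ _ _) _; apply: ler_sum => k _.
by rewrite normrZ mulrC ler_pM.
Qed.

Let bounded1 f : bounded_Ck 1 f ->
  exists M, forall x a, `|'D_a f x| <= M * `|a|.
Proof.
move=> [_ _ [df Df]].
have [M DM] := choice (fun k => let: And3 _ h _ := Df (e k) in h).
exists (\sum_k M k) => x a.
rewrite -[X in `|X|]/((fun x => 'D_a f x) x) derive_co//.
by apply: sum_le => k; exact: DM.
Qed.

Let bounded2 f : bounded_Ck 2 f ->
  exists M, forall x a b, `|'D_a (fun y => 'D_b f y) x| <= M * `|b| * `|a|.
Proof.
move=> [_ _ [df Df]].
have [M DM] := choice (fun k => bounded1 (Df (e k))).
exists (\sum_k M k) => x a b.
rewrite derive_co//.
rewrite derive_lin; last first.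
  by move=> k y; case: (Df (e k)) => _ _ [].
rewrite mulrAC mulr_suml.
by apply: sum_le => k; exact: DM.
Qed.

Let bounded3 f : bounded_Ck 3 f -> exists M, forall x a b c,
  `|'D_c (fun z => 'D_a (fun y => 'D_b f y) z) x| <= M * `|b| * `|a| * `|c|.
Proof.
move=> [_ _ [df Df]].
have [M DM] := choice (fun k => bounded2 (Df (e k))).
exists (\sum_k M k) => x a b c.
have -> : (fun y => 'D_b f y) = \sum_k co k b *: (fun y => 'D_(e k) f y).
  exact: derive_co.
have -> : (fun z => 'D_a (\sum_k co k b *: (fun y => 'D_(e k) f y)) z) =
    \sum_k co k b *: (fun z => 'D_a (fun y => 'D_(e k) f y) z).
  apply/funext; apply: derive_lin => k y.
  by case: (Df (e k)) => _ _ [].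
have -> : 'D_c (\sum_k co k b *: (fun z => 'D_a (fun y => 'D_(e k) f y) z)) x =
    (\sum_k co k b *:
      (fun x => 'D_c (fun z => 'D_a (fun y => 'D_(e k) f y) z) x)) x.
  by apply: derive_lin => k y; case: (Df (e k)) => _ _ [_ /(_ a)] [_ _ []].
rewrite [leRHS](_ : _ = (\sum_k M k * `|a| * `|c|) * `|b|); last first.
  by rewrite -!mulr_suml; ring.
by apply: sum_le => k; exact: DM.
Qed.

Lemma bounded_Ck_C3 f : bounded_Ck 3 f ->
  exists M, C3_bound f (fun x v => 'd f x v) M.
Proof.
move=> f3; have f2 := bounded_CkS f3; have f1 := bounded_CkS f2.
have [M1 h1] := bounded1 f1; have [M2 h2] := bounded2 f2.
have [M3 h3] := bounded3 f3.
have [_ [M0 h0] [df _]] := f3.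
pose M := `|M0| + `|M1| + `|M2| + `|M3|.
have le0 : M0 <= M by apply: le_trans (ler_norm _) _; rewrite /M -!addrA lerDl !addr_ge0.
have le1 : M1 <= M by apply: le_trans (ler_norm _) _; rewrite /M -!addrA addrCA lerDl !addr_ge0.
have le2 : M2 <= M by apply: le_trans (ler_norm _) _; rewrite /M addrAC lerDr !addr_ge0.
have le3 : M3 <= M by apply: le_trans (ler_norm _) _; rewrite /M lerDr !addr_ge0.
have ddf b x : differentiable (fun y => 'D_b f y) x.
  by case: f3 => _ _ [_ /(_ b)] [_ _ []].
have dddf a b x : differentiable (fun y => 'D_a (fun z => 'D_b f z) y) x.
  by case: f3 => _ _ [_ /(_ b)] [_ _ [_ /(_ a)]] [_ _ []].
have {}h0 x : `|f x| <= M by apply: le_trans (h0 x) _.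
have {}h1 x a : `|'D_a f x| <= M * `|a|.
  by apply: le_trans (h1 x a) _; rewrite ler_wpM2r.
have {}h2 x a b : `|'D_a (fun y => 'D_b f y) x| <= M * `|b| * `|a|.
  by apply: le_trans (h2 x a b) _; rewrite -!mulrA ler_wpM2r ?mulr_ge0.
have {}h3 x a b c : `|'D_c (fun z => 'D_a (fun y => 'D_b f y) z) x|
    <= M * `|b| * `|a| * `|c|.
  by apply: le_trans (h3 x a b c) _; rewrite -!mulrA ler_wpM2r ?mulr_ge0.
exists M; split=> //.
- by move=> x k u v; rewrite linearP.
- by move=> *; exact: bnd1.
- by move=> *; exact: lip0.
- by move=> *; exact: lip1.
- by move=> *; exact: four0.
- by move=> *; exact: four1.
- by move=> *; exact: taylor2_diff.
- by move=> *; exact: taylor2_shift.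
Qed.

End bounded_Ck_estimates.

(** * Sewing and limits along partitions *)

Section geometric.
Context {R : realType}.

Lemma geometric_small (l z e : R) : 0 <= l < 1 -> 0 < e ->
  exists j, l ^+ j * z < e.
Proof.
move=> /andP[l0 l1] e0.
have cl : geometric z l @ \oo --> (0 : R).
  by apply: cvg_geometric; rewrite ger0_norm.
have /cvgrPdist_lt/(_ _ e0)[j _ /(_ j (leqnn j))] := cl; rewrite sub0r normrN.
by exists j; rewrite mulrC; apply: le_lt_trans (ler_norm _) _.
Qed.

(** Used in place of limits of sequences: most limit passages below are made by carrying an error
    [l ^+ j * z] and discarding it here. *)
Lemma le_geometric_error (x y z l : R) : 0 <= l < 1 ->
  (forall j, x <= y + l ^+ j * z) -> x <= y.
Proof.
move=> l01 h; rewrite leNgt; apply/negP; rewrite -subr_gt0 => yx.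
have [j] := geometric_small z l01 yx.
by rewrite ltNge lerBlDl h.
Qed.

(** With [e k] the tail of the geometric series, the intervals [[u k - e k, u k + e k]] are nested;
    the limit is the supremum of their left ends. *)
Lemma geometric_limit_real (u : nat -> R) (C l : R) : 0 <= l < 1 ->
  (forall k, `|u k.+1 - u k| <= C * l ^+ k) ->
  exists L, forall k, `|L - u k| <= C * l ^+ k / (1 - l).
Proof.
move=> /andP[l0 l1] du.
have C0 : 0 <= C by have := du 0%N; rewrite expr0 mulr1; exact: le_trans.
have l10 : 0 < 1 - l by rewrite subr_gt0.
pose e k := C * l ^+ k / (1 - l).
have e0 k : 0 <= e k by rewrite divr_ge0 ?mulr_ge0 ?exprn_ge0// ltW.
have eS k : e k = e k.+1 + C * l ^+ k.
  by rewrite /e exprS; field; rewrite lt0r_neq0.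
have v_mono j k : (j <= k)%N -> u j - e j <= u k - e k.
  move=> /subnK <-; elim: (k - j)%N => // i IH; rewrite addSn.
  apply: le_trans IH _; have := du (i + j)%N; rewrite ler_norml eS => /andP[? _].
  lra.
have w_mono j k : (j <= k)%N -> u k + e k <= u j + e j.
  move=> /subnK <-; elim: (k - j)%N => // i IH; rewrite addSn.
  apply: le_trans IH; have := du (i + j)%N; rewrite ler_norml (eS (i + j)%N) => /andP[_ ?].
  lra.
have vw j k : u j - e j <= u k + e k.
  apply: le_trans (v_mono _ _ (leq_maxl j k)) _.
  apply: le_trans (w_mono _ _ (leq_maxr j k)).
  by rewrite lerD2l; apply: le_trans (e0 _); rewrite oppr_le0.
exists (sup (range (fun k => u k - e k))) => k.
have sv : has_sup (range (fun k => u k - e k)).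
  split; first by exists (u 0%N - e 0%N), 0%N.
  by exists (u 0%N + e 0%N) => _ [j _ <-].
rewrite ler_norml -/(e k); apply/andP; split.
  rewrite lerBrDr addrC.
  by apply: ub_le_sup; [exact: sv.2|exists k].
rewrite lerBlDr addrC.
by apply: ge_sup; [exact: sv.1|move=> _ [j _ <-]].
Qed.

Lemma geometric_limit m n (u : nat -> 'M[R]_(m, n)) (C l : R) : 0 <= l < 1 ->
  (forall k, `|u k.+1 - u k| <= C * l ^+ k) ->
  exists L, forall k, `|L - u k| <= C * l ^+ k / (1 - l).
Proof.
move=> l01 du.
have C0 : 0 <= C by have := du 0%N; rewrite expr0 mulr1; exact: le_trans.
have /choice [L hL] : forall ij : 'I_m * 'I_n, exists L, forall k,
    `|L - u k ij.1 ij.2| <= C * l ^+ k / (1 - l).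
  move=> [i j]; apply: geometric_limit_real => // k.
  by apply: le_trans (du k); have := mx_norm_ge_entry (u k.+1 - u k) i j; rewrite !mxE.
exists (\matrix_(i, j) L (i, j)) => k; apply: mx_norm_le.
  case/andP: l01 => l0 l1.
  by rewrite divr_ge0 ?mulr_ge0 ?exprn_ge0// subr_ge0 ltW.
by move=> i j; rewrite !mxE; exact: (hL (i, j)).
Qed.

End geometric.

Section sewing.
Context {R : realType}.
Implicit Types (th : R).

(** The factor by which the sum of the [th]-th powers of the lengths shrinks when an interval is
    halved; [sewing_const] is the sum of the geometric series with this ratio. *)
Definition halving_rate th : R := 2 `^ (1 - th).
Definition sewing_const th : R := (1 - halving_rate th)^-1.

Lemma halving_rate_itv th : 1 < th -> 0 <= halving_rate th < 1.
Proof.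
move=> th1; rewrite powR_ge0/= -(powRr0 2) /halving_rate.
by rewrite /powR pnatr_eq0/= ltr_expR ltr_pM2r ?ltr_subl_addr ?subr_lt0// ln_gt0// ltr1n.
Qed.

Lemma sewing_const_ge1 th : 1 < th -> 1 <= sewing_const th.
Proof.
move=> /halving_rate_itv /andP[l0 l1].
by rewrite invf_ge1 ?subr_gt0// gerBl.
Qed.

Lemma halving_powR th x : 0 <= x ->
  2 * (x / 2) `^ th = halving_rate th * x `^ th.
Proof.
move=> x0; rewrite powRM// ?invr_ge0//.
rewrite /halving_rate powRD; last by rewrite pnatr_eq0 implybT.
rewrite powRr1// -[2^-1](powR_inv1 (ler0n R 2)) -powRrM mulN1r; ring.
Qed.

(* Splitting [s, t] in the middle again and again pushes the crude bound with
   any exponent th' > 1 to scale 0, where it vanishes. *)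
Lemma halving_bound (V : normedModType R) (N : R -> R -> V) a b th th' C C' :
  1 < th -> 1 < th' -> 0 <= C ->
  (forall s u t, a <= s -> s <= u -> u <= t -> t <= b ->
    `|N s t - N s u - N u t| <= C * (t - s) `^ th) ->
  (forall s t, a <= s -> s <= t -> t <= b -> `|N s t| <= C' * (t - s) `^ th') ->
  forall s t, a <= s -> s <= t -> t <= b ->
    `|N s t| <= sewing_const th * C * (t - s) `^ th.
Proof.
move=> th1 th'1 C0 dN N' s t sa st tb.
apply: (@le_geometric_error _ _ _ (C' * (t - s) `^ th') (halving_rate th')).
  exact: halving_rate_itv.
move=> j; elim: j s t sa st tb => [|j IH] s t sa st tb.
  rewrite expr0 mul1r; apply: le_trans (N' _ _ sa st tb) _.
  rewrite lerDr !mulr_ge0 ?powR_ge0//.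
  by apply: le_trans (sewing_const_ge1 th1).
pose u := (s + t) / 2.
have su : s <= u by rewrite /u; lra.
have ut : u <= t by rewrite /u; lra.
have ub : u <= b by exact: le_trans ut tb.
have au : a <= u by exact: le_trans sa su.
have us2 : u - s = (t - s) / 2 by rewrite /u; field.
have tu2 : t - u = (t - s) / 2 by rewrite /u; field.
have := IH s u sa su ub; have := IH u t au ut tb; have := dN s u t sa su ut tb.
rewrite us2 tu2.
have H0 := ler_normD (N s t - N s u - N u t) (N s u + N u t).
have H1 := ler_normD (N s u) (N u t).
have ts0 : 0 <= t - s by rewrite subr_ge0.
have e1 := halving_powR th ts0; have e2 := halving_powR th' ts0.
rewrite (_ : _ + (N s u + N u t) = N s t) in H0; last by zmod.
move: e1 e2 H0 H1.
set p := _ `^ th; set p' := _ `^ th'; set q := (t - s) `^ th; set q' := (t - s) `^ th'.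
move=> e1 e2 H0 H1 h1 h2 h3.
(* [sewing_const th] solves [K = 1 + halving_rate th * K], so the induction reproduces the same
   constant at every level. *)
have Ke : sewing_const th * halving_rate th = sewing_const th - 1.
  rewrite /sewing_const; have /andP[_ l1] := halving_rate_itv th1.
  by field; rewrite subr_eq0 gt_eqF.
have {}e1 : 2 * (sewing_const th * C * p) = (sewing_const th - 1) * C * q.
  by rewrite -Ke; transitivity (sewing_const th * C * (2 * p)); [ring|rewrite e1; ring].
have {}e2 : 2 * (halving_rate th' ^+ j * (C' * p')) =
    halving_rate th' ^+ j.+1 * (C' * q').
  by rewrite exprSr; transitivity (halving_rate th' ^+ j * C' * (2 * p')); [ring|rewrite e2; ring].
lra.
Qed.

Lemma sum_double (V : zmodType) (F : nat -> V) n :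
  \sum_(i < n.*2) F i = \sum_(i < n) (F i.*2 + F i.*2.+1).
Proof.
elim: n => [|n IH]; first by rewrite !big_ord0.
by rewrite doubleS !big_ord_recr/= IH addrA.
Qed.

(** Projecting one dyadic grid of [[a, b]] onto each subinterval makes the sums over adjacent
    subintervals comparable cell by cell. The same projection later extends paths by constants to
    the whole line. *)
Definition clamp (s t x : R) := Num.max s (Num.min t x).

Lemma clamp_itv s t x : s <= t -> s <= clamp s t x <= t.
Proof.
by move=> st; rewrite /clamp /Num.max /Num.min; do !case: ifP => //; move=> *; lra.
Qed.

Lemma clamp_id s t x : s <= x -> x <= t -> clamp s t x = x.
Proof. by move=> sx xt; rewrite /clamp min_r// max_r. Qed.

Lemma clamp_le s t x : s <= t -> x <= s -> clamp s t x = s.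
Proof.
by move=> st xs; rewrite /clamp max_l// ge_min xs orbT.
Qed.

Lemma clamp_ge s t x : s <= t -> t <= x -> clamp s t x = t.
Proof. by move=> st tx; rewrite /clamp min_l// max_r. Qed.

Lemma clamp_splitl s u t x : s <= u -> u <= t ->
  clamp s u x = Num.min u (clamp s t x).
Proof.
move=> su ut; rewrite /clamp; case: (leP x u) => xu.
  by rewrite (min_r (le_trans xu ut)) min_r// ge_max su.
rewrite (max_r su) min_l// le_max; apply/orP; right.
by rewrite le_min ut ltW.
Qed.

Lemma clamp_splitr s u t x : s <= u -> u <= t ->
  clamp u t x = Num.max u (clamp s t x).
Proof. by move=> su ut; rewrite /clamp maxA (max_l su). Qed.

Lemma clamp_homo s t x y : s <= t -> x <= y -> clamp s t x <= clamp s t y.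
Proof.
move=> st xy; rewrite /clamp ge_max !le_max lexx/= le_min !ge_min lexx/= xy.
by rewrite !orbT.
Qed.

Lemma clamp_lip s t x y : s <= t -> x <= y ->
  clamp s t y - clamp s t x <= y - x.
Proof.
move=> st xy; have /andP[s_le _] := clamp_itv x st.
rewrite lerBlDr [X in X <= _]/clamp ge_max; apply/andP; split; first by lra.
apply: (@le_trans _ _ (y - x + Num.min t x)).
  case: (leP t x) => tx; last by rewrite subrK ge_min lexx orbT.
  by rewrite ge_min lerDr subr_ge0 xy.
by rewrite lerD2l /clamp le_max lexx orbT.
Qed.

Section dyadic_sums.
Variables (m n : nat) (Xi : R -> R -> 'M[R]_(m, n)) (a b th C : R).
Hypotheses (ab : a <= b) (th1 : 1 < th) (C0 : 0 <= C).
Hypothesis Xi_diag : forall s, a <= s <= b -> Xi s s = 0.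
Hypothesis Xi_defect : forall s u t, a <= s -> s <= u -> u <= t -> t <= b ->
  `|Xi s t - Xi s u - Xi u t| <= C * (t - s) `^ th.

Let grid k i : R := a + (b - a) * i%:R / 2 ^+ k.
(** Sum of [Xi] over the cells of level [k], projected onto [[s, t]]. Cells outside [[s, t]] become
    degenerate and vanish by [Xi_diag]. *)
Let J k s t := \sum_(i < (2 ^ k)%N) Xi (clamp s t (grid k i)) (clamp s t (grid k i.+1)).
Let h k : R := (b - a) / 2 ^+ k.
(** Half of the excess of [th] over 1 pays for geometric decay in the level; the other half leaves
    the exponent [1 + eps], still above 1, on [t - s]. *)
Let eps := (th - 1) / 2.
Let eps0 : 0 < eps. Proof. by rewrite divr_gt0// subr_gt0. Qed.

Let h_ge0 k : 0 <= h k.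
Proof. by rewrite divr_ge0 ?exprn_ge0// subr_ge0. Qed.

Let grid_le k i : grid k i <= grid k i.+1.
Proof.
rewrite /grid lerD2l ler_wpM2r ?invr_ge0 ?exprn_ge0// ler_wpM2l ?subr_ge0//.
by rewrite ler_nat.
Qed.

Let gridS k i : grid k i.+1 - grid k i = h k.
Proof. by rewrite /grid /h -natr1; ring. Qed.

Let grid_double k i : grid k.+1 i.*2 = grid k i.
Proof.
by rewrite /grid -mul2n natrM exprS; field; rewrite expf_neq0.
Qed.

(** A cell length [x] is at most [h k] and at most [t - s]; writing [x ^ th] as
    [x * x ^ eps * x ^ eps], each bound is used for one factor and the remaining [x] telescopes. *)
Let cell_sum k s t : a <= s -> s <= t -> t <= b ->
  \sum_(i < (2 ^ k)%N) C * (clamp s t (grid k i.+1) - clamp s t (grid k i)) `^ th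
   <= C * h k `^ eps * (t - s) `^ (1 + eps).
Proof.
move=> sa st tb.
pose x i := clamp s t (grid k i.+1) - clamp s t (grid k i).
have x0 i : 0 <= x i by rewrite subr_ge0 clamp_homo.
have xh i : x i <= h k by rewrite -(gridS k i) clamp_lip.
have xts i : x i <= t - s.
  by have /andP[? ?] := clamp_itv (grid k i) st; have /andP[? ?] := clamp_itv (grid k i.+1) st; rewrite /x; lra.
have ts0 : 0 <= t - s by rewrite subr_ge0.
apply: (@le_trans _ _ (\sum_(i < (2 ^ k)%N) C * h k `^ eps * (t - s) `^ eps * x i)).
  apply: ler_sum => i _; rewrite -/(x i) -!mulrA ler_wpM2l//.
  rewrite -(mulr_powRB1 (x0 i)); last by apply: lt_trans th1.
  rewrite (_ : th - 1 = eps + eps); last by rewrite /eps; field.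
  rewrite powRD; last by rewrite gt_eqF// addr_gt0.
  rewrite mulrC -mulrA ler_pM ?powR_ge0 ?mulr_ge0 ?powR_ge0//.
    by rewrite ge0_ler_powR ?nnegrE// ltW.
  by rewrite ler_wpM2r// ge0_ler_powR ?nnegrE// ltW.
rewrite -mulr_sumr (_ : \sum_(i < (2 ^ k)%N) x i = t - s); last first.
  rewrite -(big_mkord xpredT x) telescope_sumr//; congr (_ - _).
    by rewrite clamp_ge// /grid natrX mulfK ?expf_neq0// addrCA subrr addr0.
  by rewrite clamp_le// /grid mulr0 mul0r addr0.
rewrite powRD; last by rewrite gt_eqF// addr_gt0.
by rewrite powRr1// -!mulrA [_ * (t - s)]mulrC.
Qed.

Let J0 s t : a <= s -> s <= t -> t <= b -> J 0 s t = Xi s t.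
Proof.
move=> sa st tb; rewrite /J big_ord1 /grid expr0 !divr1 mulr0 mulr1 addr0.
by rewrite clamp_le// clamp_ge// addrCA subrr addr0.
Qed.

Let rate := 2^-1 `^ eps.

Let rate_itv : 0 <= rate < 1.
Proof.
rewrite powR_ge0/= -(powRr0 2^-1) /rate /powR invr_eq0 pnatr_eq0/= ltr_expR.
by rewrite ltr_nM2r ?lnV ?posrE// oppr_lt0 ln_gt0// ltr1n.
Qed.

Let hE k : h k `^ eps = (b - a) `^ eps * rate ^+ k.
Proof.
rewrite /h powRM ?invr_ge0 ?exprn_ge0 ?subr_ge0//; congr (_ * _).
rewrite -exprVn; transitivity (2^-1 `^ (k%:R * eps)).
  by rewrite powRrM powR_mulrn// invr_ge0.
by rewrite mulrC powRrM powR_mulrn// powR_ge0.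
Qed.

(** The next level inserts the midpoint of each cell, at the price of one defect per cell. *)
Let J_step k s t : a <= s -> s <= t -> t <= b ->
  `|J k.+1 s t - J k s t| <=
    C * (b - a) `^ eps * (t - s) `^ (1 + eps) * rate ^+ k.
Proof.
move=> sa st tb; rewrite /J expnS mul2n.
rewrite (sum_double (fun i => Xi (clamp s t (grid k.+1 i))
  (clamp s t (grid k.+1 i.+1)))) -sumrB.
apply: le_trans (ler_norm_sum _ _ _) _.
apply: le_trans (_ : _ <= C * h k `^ eps * (t - s) `^ (1 + eps)) _; last first.
  by rewrite hE; lra.
apply: le_trans (cell_sum k sa st tb).
apply: ler_sum => i _; rewrite grid_double -doubleS grid_double.
have /andP[? ?] := clamp_itv (grid k i) st.
have /andP[? ?] := clamp_itv (grid k i.+1) st.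
rewrite -normrN opprB opprD addrA.
apply: Xi_defect; first by lra.
- by rewrite clamp_homo// -grid_double.
- by rewrite clamp_homo// -(grid_double k i.+1) doubleS.
- by lra.
Qed.

(** A cell on one side of [u] contributes the same to both sides, since its projection onto the
    other side is degenerate. Only a cell that straddles [u] costs a defect. *)
Let J_additive k s u t : a <= s -> s <= u -> u <= t -> t <= b ->
  `|J k s t - J k s u - J k u t| <=
    rate ^+ k * (C * (b - a) `^ eps * (t - s) `^ (1 + eps)).
Proof.
move=> sa su ut tb; have st := le_trans su ut.
rewrite /J -!sumrB; apply: le_trans (ler_norm_sum _ _ _) _.
apply: le_trans (_ : _ <= C * h k `^ eps * (t - s) `^ (1 + eps)) _; last first.
  by rewrite hE; lra.
apply: le_trans (cell_sum k sa st tb); apply: ler_sum => i _.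
set g := grid k i; set g' := grid k i.+1; have gg' : g <= g' := grid_le k i.
rewrite !(clamp_splitl _ su ut) !(clamp_splitr _ su ut).
have pq : clamp s t g <= clamp s t g' by exact: clamp_homo.
have /andP[sp pt] := clamp_itv g st; have /andP[sq qt] := clamp_itv g' st.
move: pq sp pt sq qt.
set p := clamp s t g; set q := clamp s t g' => pq sp pt sq qt.
case: (leP q u) => qu.
  have pu := le_trans pq qu.
  rewrite (min_r pu) (max_l pu) Xi_diag ?subrr ?sub0r ?oppr0 ?normr0.
    by rewrite mulr_ge0 ?powR_ge0.
  by lra.
case: (leP p u) => pu.
  by apply: Xi_defect => //; lra.
rewrite Xi_diag; last by lra.
by rewrite subr0 subrr normr0 mulr_ge0 ?powR_ge0.
Qed.

(** The limits of the dyadic sums are additive, because their additivity defect decays geometrically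
    in the level. Comparison with level 0 gives only the exponent [1 + eps] and a constant depending
    on [[a, b]]; [halving_bound] then restores the exponent [th] with a universal constant. *)
Lemma sewing : exists I : R -> 'M[R]_(m, n),
  forall s t, a <= s -> s <= t -> t <= b ->
    `|I t - I s - Xi s t| <= sewing_const th * C * (t - s) `^ th.
Proof.
pose K s t := C * (b - a) `^ eps * (t - s) `^ (1 + eps).
have /choice [L] : forall st : R * R, exists L, a <= st.1 -> st.1 <= st.2 ->
    st.2 <= b -> forall k, `|L - J k st.1 st.2| <= K st.1 st.2 * rate ^+ k / (1 - rate).
  move=> [s t] /=; case: (boolP [&& a <= s, s <= t & t <= b]) => [/and3P[sa st tb]|/and3P H].
    have [L hL] := geometric_limit rate_itv (fun k => J_step k sa st tb).
    by exists L.
  by exists 0 => ? ? ?; exfalso; apply: H.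
move=> hL; pose I x := L (a, x).
have r1 : 0 < 1 - rate by rewrite subr_gt0; case/andP: rate_itv.
have L_add s t : a <= s -> s <= t -> t <= b -> L (a, t) - L (a, s) = L (s, t).
  move=> sa st tb.
  have h1 := hL (a, t) (lexx _) (le_trans sa st) tb.
  have h2 := hL (a, s) (lexx _) sa (le_trans st tb).
  have h3 := hL (s, t) sa st tb.
  apply/eqP; rewrite -subr_eq0 -normr_le0.
  pose Z := (K a t + K a s + K s t) / (1 - rate) + K a t.
  apply: (@le_geometric_error _ _ 0 Z rate rate_itv) => k.
  have := J_additive k (lexx a) sa st tb.
  have := h1 k; have := h2 k; have := h3 k => /= {}h3 {}h2 {}h1 h4.
  rewrite (_ : _ - L (s, t) = (L (a, t) - J k a t) - (L (a, s) - J k a s)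
     - (L (s, t) - J k s t) + (J k a t - J k a s - J k s t)); last by zmod.
  apply: le_trans (ler_normD _ _) _.
  apply: le_trans (lerD (ler_normB _ _) (lexx _)) _.
  apply: le_trans (lerD (lerD (ler_normB _ _) (lexx _)) (lexx _)) _.
  apply: le_trans (lerD (lerD (lerD h1 h2) h3) h4) _.
  by rewrite add0r /Z -/(K a t); lra.
exists I => s t sa st tb.
apply: (@halving_bound _ (fun s t => I t - I s - Xi s t) a b th (1 + eps) C
  (C * (b - a) `^ eps / (1 - rate))) => //.
- by rewrite ltrDl.
- move=> {sa st tb s t}s u t sa su ut tb.
  rewrite (_ : _ - (I t - I u - Xi u t) = - (Xi s t - Xi s u - Xi u t)); last by zmod.
  by rewrite normrN; exact: Xi_defect.
- move=> {sa st tb s t}s t sa st tb; rewrite /I L_add//.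
  have := hL (s, t) sa st tb 0%N; rewrite /= J0// expr0 mulr1.
  by rewrite /K; lra.
Qed.

End dyadic_sums.
End sewing.

(** * Limits of sums along partitions of vanishing mesh *)

Section partitions.
Context {R : realType}.

Lemma mesh_cons a x (s : seq R) : mesh a (x :: s) = Num.max (x - a) (mesh x s).
Proof.
rewrite /mesh /= big_nat_recl//=; congr Num.max.
by apply: eq_big_nat => i /andP[_ ik]; rewrite !(set_nth_default a x)//= ltnW.
Qed.

Lemma partition_sum_cons (V : zmodType) (F : R -> R -> V) a x (s : seq R) :
  partition_sum F a (x :: s) = F a x + partition_sum F x s.
Proof.
rewrite /partition_sum/= big_nat_recl//=; congr (_ + _).
by apply: eq_big_nat => i /andP[_ ik]; rewrite !(set_nth_default a x)//= ltnW.
Qed.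

Lemma partition_sum_le (V : normedModType R) (F : R -> R -> V)
    (g : R -> R -> R) delta (s : seq R) a b :
  (forall x, g x x = 0) ->
  (forall x y z, x < y -> y <= z -> g x z = g x y + g y z) ->
  (forall x y, a <= x -> x < y -> y <= b -> y - x < delta -> `|F x y| <= g x y) ->
  itv_partition a b s -> mesh a s < delta ->
  `|partition_sum F a s| <= g a b.
Proof.
move=> g0 gD; elim: s a => [|x s IH] a Fg ps.
  by rewrite (itv_partition_nil ps) g0 /partition_sum/= big_geq// normr0.
have ax : a < x by case: ps => /= /andP[].
have psx := itv_partition_cons ps; have xb := itv_partition_le psx.
rewrite mesh_cons gt_max => /andP[xad ms].
rewrite partition_sum_cons (gD _ x)//; apply: le_trans (ler_normD _ _) _.
apply: lerD; first exact: Fg.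
apply: IH => // u v xu uv vb uvd; apply: Fg => //.
by rewrite (le_trans _ xu) ?ltW.
Qed.

Lemma partition_sum_telescope (V : zmodType) (I : R -> V) a b (s : seq R) :
  itv_partition a b s -> partition_sum (fun x y => I y - I x) a s = I b - I a.
Proof.
elim: s a => [|x s IH] a ps.
  by rewrite (itv_partition_nil ps) /partition_sum/= big_geq// subrr.
rewrite partition_sum_cons (IH x); last exact: itv_partition_cons ps.
by zmod.
Qed.

Lemma partition_sumB (V : zmodType) (F F' : R -> R -> V) a (s : seq R) :
  partition_sum F a s - partition_sum F' a s =
  partition_sum (fun x y => F x y - F' x y) a s.
Proof. by rewrite /partition_sum -sumrB. Qed.

(** The additive control [g] may depend on [eps]. This admits errors that are not proportional to
    the length, as long as they occur at finitely many points. *)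
Lemma is_partition_limit_intro (V : normedModType R) (F : R -> R -> V)
    (I : R -> V) a b :
  (forall eps, 0 < eps -> exists2 g : R -> R -> R,
    [/\ forall x, g x x = 0,
        forall x y z, x < y -> y <= z -> g x z = g x y + g y z &
        g a b < eps] &
    exists2 delta, 0 < delta & forall x y, a <= x -> x < y -> y <= b ->
      y - x < delta -> `|I y - I x - F x y| <= g x y) ->
  is_partition_limit F a b (I b - I a).
Proof.
move=> h eps e0; have [g [g0 gD ge] [delta d0 Fg]] := h _ e0.
exists delta => // s ps ms; apply: le_lt_trans ge.
rewrite -(partition_sum_telescope I ps) -normrN opprB partition_sumB.
exact: partition_sum_le ps ms.
Qed.

Lemma fine_partition (a b delta : R) : a < b -> 0 < delta ->
  exists2 s, itv_partition a b s & mesh a s < delta.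
Proof.
move=> ab d0; pose n := Num.bound ((b - a) / (delta / 2)).
have : b - a <= n%:R * (delta / 2).
  rewrite -ler_pdivrMr ?divr_gt0// ltW// archi_boundP// divr_ge0//; lra.
move: (n); clear n => n; elim: n a ab => [|n IH] a ab h; first by exfalso; move: h; rewrite mul0r; lra.
have [bd|bd] := ltP (b - a) delta.
  exists [:: b]; first exact: itv_partition1.
  rewrite mesh_cons gt_max bd /mesh/= big_geq//.
have [||s ps ms] := IH (a + delta / 2); first by lra.
  by move: h; rewrite -natr1 mulrDl mul1r; lra.
exists (a + delta / 2 :: s).
  by case: ps => ps ls; split=> //=; rewrite ps andbT; lra.
by rewrite mesh_cons gt_max ms andbT; lra.
Qed.

Lemma partition_limit_unique (V : normedModType R) (F : R -> R -> V) a b I I' :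
  a < b -> is_partition_limit F a b I -> is_partition_limit F a b I' -> I = I'.
Proof.
move=> ab h h'; apply/eqP; rewrite -subr_eq0 -normr_le0 leNgt.
apply/negP => I0; have e0 : 0 < `|I - I'| / 2 by rewrite divr_gt0.
have [d1 d10 h1] := h _ e0; have [d2 d20 h2] := h' _ e0.
have [|s ps ms] := @fine_partition a b (Num.min d1 d2) ab.
  by rewrite lt_min d10.
move: ms; rewrite lt_min => /andP[m1 m2].
have := h1 s ps m1; have := h2 s ps m2.
rewrite -[`|_ - I|]normrN opprB.
have := ler_normD (I - partition_sum F a s) (partition_sum F a s - I').
rewrite addrA subrK; lra.
Qed.

End partitions.

(** * Tensors and the algebra of the germ *)

Section tensor.
Context {R : realType} {n d : nat}.
Local Notation U := ('cV[R]_d * 'cV[R]_d)%type.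
Implicit Types (B : U -> 'M[R]_(n, d)) (T S : 'M[R]_d).

(* The extension of B from pairs (v (x) x, w (x) x), where it is B(v, w) x, to
   pairs of tensors. *)
Definition tensor_pair B T S : 'cV[R]_n :=
  tensor_apply (fun i => B (delta_mx i 0, 0)) T +
  tensor_apply (fun i => B (0, delta_mx i 0)) S.

Lemma tensor_applyB (Z Z' : 'I_d -> 'M[R]_(n, d)) T :
  tensor_apply Z T - tensor_apply Z' T = tensor_apply (fun i => Z i - Z' i) T.
Proof.
rewrite /tensor_apply -sumrB; apply: eq_bigr => i _; rewrite -sumrB.
apply: eq_bigr => j _; rewrite -scalerBr; congr (_ *: _).
by apply/colP => k; rewrite !mxE.
Qed.

Lemma tensor_applyDr (Z : 'I_d -> 'M[R]_(n, d)) T S :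
  tensor_apply Z (T + S) = tensor_apply Z T + tensor_apply Z S.
Proof.
rewrite /tensor_apply -big_split; apply: eq_bigr => i _; rewrite -big_split.
by apply: eq_bigr => j _; rewrite mxE scalerDl.
Qed.

Lemma tensor_pairB B B' T S :
  tensor_pair B T S - tensor_pair B' T S = tensor_pair (fun v => B v - B' v) T S.
Proof.
have h1 := tensor_applyB (fun i => B (delta_mx i 0, 0))
  (fun i => B' (delta_mx i 0, 0)) T.
have h2 := tensor_applyB (fun i => B (0, delta_mx i 0))
  (fun i => B' (0, delta_mx i 0)) S.
by rewrite /tensor_pair -h1 -h2; zmod.
Qed.

Lemma tensor_pairDr B T T' S S' :
  tensor_pair B (T + T') (S + S') = tensor_pair B T S + tensor_pair B T' S'.
Proof. by rewrite /tensor_pair !tensor_applyDr; zmod. Qed.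

Lemma tensor_apply_le (Z : 'I_d -> 'M[R]_(n, d)) T b :
  (forall i, `|Z i| <= b) -> `|tensor_apply Z T| <= d%:R ^+ 2 * b * `|T|.
Proof.
move=> Zb; apply: le_trans (ler_norm_sum _ _ _) _.
apply: (@le_trans _ _ (\sum_(i < d) \sum_(j < d) b * `|T|)).
  apply: ler_sum => i _; apply: le_trans (ler_norm_sum _ _ _) _.
  apply: ler_sum => j _; rewrite normrZ mulrC ler_pM ?mx_norm_ge_entry//.
  apply: mx_norm_le => [|k l]; first by exact: le_trans (Zb i).
  by rewrite mxE; apply: le_trans (Zb i); exact: mx_norm_ge_entry.
by rewrite !sumr_const card_ord -mulrnA -[leLHS]mulr_natl natrM expr2 !mulrA.
Qed.

Lemma norm_delta_mx (i : 'I_d) : `|delta_mx i 0 : 'cV[R]_d| <= 1.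
Proof.
apply: mx_norm_le => // j k; rewrite mxE ger0_norm ?ler0n//.
by rewrite lern1 leq_b1.
Qed.

Lemma tensor_pair_le B T S b : 0 <= b -> (forall v, `|B v| <= b * `|v|) ->
  `|tensor_pair B T S| <= d%:R ^+ 2 * b * (`|T| + `|S|).
Proof.
move=> b0 Bb; apply: le_trans (ler_normD _ _) _; rewrite mulrDr.
by apply: lerD; apply: tensor_apply_le => i; apply: le_trans (Bb _) _;
  rewrite prod_normE/= normr0 ler_piMr// ge_max norm_delta_mx ler01.
Qed.

Lemma tensor_apply_rank1 (f : 'cV[R]_d -> 'M[R]_(n, d)) (u x : 'cV[R]_d) :
  (forall (k : R) v w, f (k *: v + w) = k *: f v + f w) ->
  tensor_apply (fun i => f (delta_mx i 0)) (u *m x^T) = f u *m x.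
Proof.
move=> linf.
have f0 : f 0 = 0.
  have := linf 1 0 0; rewrite !scale1r addr0 => /eqP.
  by rewrite -subr_eq0 opprD addrA subrr sub0r oppr_eq0 => /eqP.
have fE : f u = \sum_(i < d) u i 0 *: f (delta_mx i 0).
  have {1}-> : u = \sum_(i < d) u i 0 *: delta_mx i 0.
    by rewrite [LHS]matrix_sum_delta; apply: eq_bigr => i _; rewrite big_ord1.
  by elim/big_rec2 : _ => // i _ y _ <-; rewrite linf.
rewrite fE /tensor_apply mulmx_suml; apply: eq_bigr => i _.
apply/colP => k; rewrite summxE mxE; apply: eq_bigr => j _.
by rewrite !mxE big_ord1 !mxE; ring.
Qed.

(** Evaluates the product terms of Chen's relations, which are rank one tensors. *)
Lemma tensor_pair_rank1 B (v w x : 'cV[R]_d) :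
  (forall (k : R) u u', B (k *: u + u') = k *: B u + B u') ->
  tensor_pair B (v *m x^T) (w *m x^T) = B (v, w) *m x.
Proof.
move=> linB; rewrite /tensor_pair.
rewrite (@tensor_apply_rank1 (fun u => B (u, 0))); last first.
  by move=> k u u'; rewrite -linB; congr (B (_, _)); rewrite /= scaler0 addr0.
rewrite (@tensor_apply_rank1 (fun u => B (0, u))); last first.
  by move=> k u u'; rewrite -linB; congr (B (_, _)); rewrite /= scaler0 addr0.
rewrite -mulmxDl; congr (_ *m _).
have := linB 1 (v, 0) (0, w); rewrite !scale1r => <-.
by congr (B (_, _)); rewrite /= ?addr0 ?add0r.
Qed.

End tensor.

(** * Pointwise estimates for the germ, with [q] in the role of [|t - s| ^ beta] and [rho] of the
    radius of a ball *)

Section germ_algebra.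
Context {R : realType} {E : normedModType R} {n d : nat}.
Local Notation U := ('cV[R]_d * 'cV[R]_d)%type.
Variables (G : E -> 'M[R]_(n, d)) (dG : E -> E -> 'M[R]_(n, d)) (c q rho : R).
Hypothesis HG : C3_bound G dG c.
Hypotheses (c1 : 1 <= c) (dc : d%:R <= c).
Hypotheses (q0 : 0 <= q) (rho1 : 1 <= rho) (rhoq : rho * q <= 1).

Let c0 : 0 <= c. Proof. exact: le_trans c1. Qed.
Let rho0 : 0 <= rho. Proof. exact: le_trans rho1. Qed.

Lemma C3_linearB x u v : dG x (u - v) = dG x u - dG x v.
Proof.
by have := C3_linear HG x (-1) v u; rewrite !scaleN1r addrC => ->; rewrite addrC.
Qed.

(** The estimates of this section produce polynomials in [c], [rho] and [q]. As [c] and [rho] are at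
    least 1, their monomials can be raised to a common one, after which a linear comparison of
    coefficients remains. *)
Lemma monomial_le i j k l m : (i <= j)%N -> (k <= l)%N ->
  c ^+ i * rho ^+ k * q ^+ m <= c ^+ j * rho ^+ l * q ^+ m.
Proof.
move=> ij kl; rewrite ler_wpM2r ?exprn_ge0// ler_pM ?exprn_ge0//.
  exact: ler_weXn2l.
exact: ler_weXn2l.
Qed.

Let mul_le (y z y' z' : R) : 0 <= y -> 0 <= z -> y <= y' -> z <= z' -> y * z <= y' * z'.
Proof. by move=> *; rewrite ler_pM. Qed.

Let sqr_le (x : E) (a : R) : `|x| <= a -> `|x| ^+ 2 <= a ^+ 2.
Proof. by move=> xa; rewrite lerXn2r// ?nnegrE //; exact: le_trans xa. Qed.

Lemma norm_mulmx_le (A : 'M[R]_(n, d)) (x : 'cV[R]_d) (a b : R) :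
  `|A| <= a -> `|x| <= b -> `|A *m x| <= c * a * b.
Proof.
move=> Aa xb; apply: le_trans (mx_norm_mul _ _) _.
by rewrite !mul_le// ?mulr_ge0.
Qed.

Lemma norm_tensor_le (B : U -> 'M[R]_(n, d)) (T S : 'M[R]_d) (b t : R) :
  0 <= b -> (forall w, `|B w| <= b * `|w|) -> `|T| <= t -> `|S| <= t ->
  `|tensor_pair B T S| <= 2 * c ^+ 2 * b * t.
Proof.
move=> b0 Bb Tt St; apply: le_trans (tensor_pair_le _ _ b0 Bb) _.
have -> : 2 * c ^+ 2 * b * t = c ^+ 2 * b * (t + t) by ring.
rewrite mul_le ?addr_ge0 ?mulr_ge0 ?exprn_ge0//; last exact: lerD.
by rewrite mul_le ?exprn_ge0// !expr2 mul_le.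
Qed.

Section one.
Variables (z dz : E) (L L' : U -> E) (v : U) (x : 'cV[R]_d) (T S : 'M[R]_d).
Hypothesis Lc : forall w, `|L w| <= c * `|w|.
Hypothesis L'c : forall w, `|L' w| <= c * `|w|.
Hypothesis dLc : forall w, `|L' w - L w| <= c * q * `|w|.
Hypothesis vc : `|v| <= c * q.
Hypothesis xc : `|x| <= c * q.
Hypothesis Tc : `|T| <= c * q ^+ 2.
Hypothesis Sc : `|S| <= c * q ^+ 2.
Hypothesis rc : `|dz - L v| <= c * rho * q ^+ 2.

Lemma germ_dz_le : `|dz| <= 2 * c ^+ 2 * q.
Proof.
rewrite -[dz](subrK (L v)); apply: le_trans (ler_normD _ _) _.
apply: le_trans (lerD rc (le_trans (Lc v) (ler_wpM2l c0 vc))) _.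
have := @monomial_le 1 2 0 0 1 isT isT.
have : c * q * (rho * q) <= c * q * 1 by rewrite ler_wpM2l// mulr_ge0.
lra.
Qed.

Lemma germ_B_le w : `|dG z (L w)| <= c ^+ 2 * `|w|.
Proof.
apply: le_trans (C3_bound1 HG _ _) _.
by apply: le_trans (ler_wpM2l c0 (Lc w)) _; rewrite mulrA expr2.
Qed.

(** The Taylor remainder gives [4 c^5 q^2] from [|dz| <= 2 c^2 q], and [dG] applied to the remainder
    [dz - L v] of the controlled path gives [c^2 rho q^2]. *)
Lemma germ_rest_le : `|G (z + dz) - G z - dG z (L v)| <= 5 * c ^+ 5 * rho * q ^+ 2.
Proof.
have -> : G (z + dz) - G z - dG z (L v) =
    (G (z + dz) - G (z + 0) - dG z (dz - 0)) + dG z (dz - L v).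
  by rewrite addr0 subr0 C3_linearB; zmod.
apply: le_trans (ler_normD _ _) _.
apply: le_trans (lerD (C3_taylor_diff HG _ _ _) (C3_bound1 HG _ _)) _.
rewrite subr0 normr0 addr0 -mulrA.
apply: le_trans (lerD (ler_wpM2l c0 (mul_le _ _ germ_dz_le germ_dz_le)) (ler_wpM2l c0 rc)) _ => //.
have := @monomial_le 5 5 0 1 2 isT isT; have := @monomial_le 2 5 1 1 2 isT isT.
lra.
Qed.

Lemma germ_dB_le w :
  `|dG (z + dz) (L' w) - dG z (L w)| <= 3 * c ^+ 4 * q * `|w|.
Proof.
have -> : dG (z + dz) (L' w) - dG z (L w) =
    (dG (z + dz) (L' w) - dG z (L' w)) + dG z (L' w - L w).
  by rewrite C3_linearB; zmod.
apply: le_trans (ler_normD _ _) _.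
apply: le_trans (lerD (C3_lip1 HG _ _ _) (C3_bound1 HG _ _)) _.
apply: le_trans (lerD (mul_le _ _ (ler_wpM2l c0 germ_dz_le) (L'c w))
  (ler_wpM2l c0 (dLc w))) _ => //; first by rewrite mulr_ge0.
have := ler_wpM2r (normr_ge0 w) (@monomial_le 2 4 0 0 1 isT isT).
lra.
Qed.

(** Both terms are products of a factor of order [q] and one of order [q ^+ 2]; the constant is 5
    from the first and 6 from the second. *)
Lemma germ_defect_le :
  `|(G (z + dz) - G z - dG z (L v)) *m x
    + tensor_pair (fun w => dG (z + dz) (L' w) - dG z (L w)) T S|
    <= 11 * c ^+ 7 * rho * q ^+ 3.
Proof.
apply: le_trans (ler_normD _ _) _.
apply: le_trans (lerD (norm_mulmx_le germ_rest_le xc)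
  (norm_tensor_le _ germ_dB_le Tc Sc)) _; first by rewrite !mulr_ge0 ?exprn_ge0.
have := @monomial_le 7 7 0 1 3 isT isT; lra.
Qed.

Lemma germ_tensor_le : `|tensor_pair (fun w => dG z (L w)) T S| <= 2 * c ^+ 5 * q ^+ 2.
Proof.
by apply: le_trans (norm_tensor_le _ germ_B_le Tc Sc) _; rewrite ?exprn_ge0//; lra.
Qed.

End one.

Section two.
Variables (delta : R) (z1 dz1 z2 dz2 : E) (L1 L1' L2 L2' : U -> E).
Variables (v : U) (x : 'cV[R]_d) (T S : 'M[R]_d).
Hypothesis delta0 : 0 <= delta.
Hypothesis L1c : forall w, `|L1 w| <= c * `|w|.
Hypothesis L1'c : forall w, `|L1' w| <= c * `|w|.
Hypothesis dL1c : forall w, `|L1' w - L1 w| <= c * q * `|w|.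
Hypothesis L2c : forall w, `|L2 w| <= c * `|w|.
Hypothesis L2'c : forall w, `|L2' w| <= c * `|w|.
Hypothesis dL2c : forall w, `|L2' w - L2 w| <= c * q * `|w|.
Hypothesis vc : `|v| <= c * q.
Hypothesis xc : `|x| <= c * q.
Hypothesis Tc : `|T| <= c * q ^+ 2.
Hypothesis Sc : `|S| <= c * q ^+ 2.
Hypothesis r1c : `|dz1 - L1 v| <= c * rho * q ^+ 2.
Hypothesis r2c : `|dz2 - L2 v| <= c * rho * q ^+ 2.
Hypothesis zd : `|z1 - z2| <= c * delta.
Hypothesis Ld : forall w, `|L1 w - L2 w| <= c * delta * `|w|.
Hypothesis L'd : forall w, `|L1' w - L2' w| <= c * delta * `|w|.
Hypothesis dLd : forall w, `|(L1' w - L1 w) - (L2' w - L2 w)| <= c * rho * delta * q * `|w|.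
Hypothesis rd : `|(dz1 - L1 v) - (dz2 - L2 v)| <= c * rho * delta * q ^+ 2.

Let dz1_le := germ_dz_le L1c vc r1c.
Let dz2_le := germ_dz_le L2c vc r2c.
Let cd0 : 0 <= c * delta. Proof. exact: mulr_ge0. Qed.

Lemma germ_diff_dz_le : `|dz1 - dz2| <= 2 * c ^+ 2 * delta * q.
Proof.
rewrite (_ : dz1 - dz2 = (L1 v - L2 v) + ((dz1 - L1 v) - (dz2 - L2 v))); last by zmod.
apply: le_trans (ler_normD _ _) _.
apply: le_trans (lerD (le_trans (Ld v) (ler_wpM2l cd0 vc)) rd) _.
have := ler_wpM2l delta0 (@monomial_le 1 2 0 0 1 isT isT).
have : c * delta * q * (rho * q) <= c * delta * q * 1.
  by rewrite ler_wpM2l// !mulr_ge0.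
lra.
Qed.

Let zE : z2 + (z1 - z2) = z1. Proof. by zmod. Qed.

Lemma germ_diff_dG_le :
  `|(G (z1 + dz1) - G z1) - (G (z2 + dz2) - G z2)| <= 4 * c ^+ 5 * delta * q.
Proof.
have h1 := C3_four0 HG z2 (z1 - z2) dz1; rewrite zE in h1.
have h2 := C3_lip0 HG (z2 + dz2) (dz1 - dz2).
have e2 : z2 + dz2 + (dz1 - dz2) = z2 + dz1 by zmod.
rewrite e2 in h2.
rewrite (_ : _ - _ = (G (z1 + dz1) - G z1 - (G (z2 + dz1) - G z2)) +
  (G (z2 + dz1) - G (z2 + dz2))); last by zmod.
apply: le_trans (ler_normD _ _) _.
apply: le_trans (lerD (le_trans h1 (mul_le _ _ (ler_wpM2l c0 zd) dz1_le))
  (le_trans h2 (ler_wpM2l c0 germ_diff_dz_le))) _ => //; first by rewrite mulr_ge0.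
have := ler_wpM2l delta0 (@monomial_le 3 5 0 0 1 isT isT).
have := ler_wpM2l delta0 (@monomial_le 4 5 0 0 1 isT isT).
lra.
Qed.

(** One quantity is changed at a time: the base point and the increment in the Taylor remainder, the
    base point of [dG], the remainder of the controlled path. They contribute 4, 8, 1 and 1. *)
Lemma germ_diff_rest_le :
  `|(G (z1 + dz1) - G z1 - dG z1 (L1 v)) - (G (z2 + dz2) - G z2 - dG z2 (L2 v))|
   <= 14 * c ^+ 6 * rho * delta * q ^+ 2.
Proof.
have h1 := C3_taylor_shift HG z2 (z1 - z2) dz1; rewrite zE in h1.
have h2 := C3_taylor_diff HG z2 dz1 dz2.
have h3 := C3_lip1 HG z2 (z1 - z2) (dz1 - L1 v); rewrite zE in h3.
have h4 := C3_bound1 HG z2 ((dz1 - L1 v) - (dz2 - L2 v)).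
rewrite (_ : _ - _ =
   (G (z1 + dz1) - G z1 - dG z1 dz1 - (G (z2 + dz1) - G z2 - dG z2 dz1))
   + (G (z2 + dz1) - G (z2 + dz2) - dG z2 (dz1 - dz2))
   + (dG z1 (dz1 - L1 v) - dG z2 (dz1 - L1 v))
   + dG z2 ((dz1 - L1 v) - (dz2 - L2 v))); last first.
  by rewrite !C3_linearB; zmod.
apply: le_trans (ler_normD _ _) _; apply: le_trans (lerD (ler_normD _ _) (lexx _)) _.
apply: le_trans (lerD (lerD (ler_normD _ _) (lexx _)) (lexx _)) _.
have {}h1 := le_trans h1
  (mul_le (mulr_ge0 c0 (normr_ge0 _)) (exprn_ge0 _ (normr_ge0 _))
    (ler_wpM2l c0 zd) (sqr_le dz1_le)).
have {}h2 := le_trans h2 (mul_le (mulr_ge0 c0 (normr_ge0 _))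
  (addr_ge0 (normr_ge0 _) (normr_ge0 _)) (ler_wpM2l c0 germ_diff_dz_le)
  (lerD dz1_le dz2_le)).
have {}h3 := le_trans h3 (mul_le (mulr_ge0 c0 (normr_ge0 _)) (normr_ge0 _)
  (ler_wpM2l c0 zd) r1c).
have {}h4 := le_trans h4 (ler_wpM2l c0 rd).
apply: le_trans (lerD (lerD (lerD h1 h2) h3) h4) _.
have := ler_wpM2l delta0 (@monomial_le 6 6 0 1 2 isT isT).
have := ler_wpM2l delta0 (@monomial_le 5 6 0 1 2 isT isT).
have := ler_wpM2l delta0 (@monomial_le 3 6 1 1 2 isT isT).
have := ler_wpM2l delta0 (@monomial_le 2 6 1 1 2 isT isT).
lra.
Qed.

Lemma germ_diff_B_le w : `|dG z1 (L1 w) - dG z2 (L2 w)| <= 2 * c ^+ 3 * delta * `|w|.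
Proof.
have h3 := C3_lip1 HG z2 (z1 - z2) (L1 w); rewrite zE in h3.
have h4 := C3_bound1 HG z2 (L1 w - L2 w).
rewrite (_ : _ - _ = (dG z1 (L1 w) - dG z2 (L1 w)) + dG z2 (L1 w - L2 w)); last first.
  by rewrite C3_linearB; zmod.
apply: le_trans (ler_normD _ _) _.
apply: le_trans (lerD (le_trans h3 (mul_le _ _ (ler_wpM2l c0 zd) (L1c w)))
  (le_trans h4 (ler_wpM2l c0 (Ld w)))) _ => //; first by rewrite mulr_ge0.
have := ler_wpM2r (normr_ge0 w) (ler_wpM2l delta0 (@monomial_le 2 3 0 0 0 isT isT)).
lra.
Qed.

(** The same telescoping, with five terms contributing 2, 2, 2, 1 and 1. *)
Lemma germ_diff_dB_le w :
  `|(dG (z1 + dz1) (L1' w) - dG z1 (L1 w)) - (dG (z2 + dz2) (L2' w) - dG z2 (L2 w))|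
   <= 8 * c ^+ 5 * rho * delta * q * `|w|.
Proof.
have h1 := C3_four1 HG z2 (z1 - z2) dz1 (L1' w); rewrite zE in h1.
have h2 := C3_lip1 HG (z2 + dz2) (dz1 - dz2) (L1' w).
have e2 : z2 + dz2 + (dz1 - dz2) = z2 + dz1 by zmod.
rewrite e2 in h2.
have h3 := C3_lip1 HG z2 dz2 (L1' w - L2' w).
have h4 := C3_lip1 HG z2 (z1 - z2) (L1' w - L1 w); rewrite zE in h4.
have h5 := C3_bound1 HG z2 ((L1' w - L1 w) - (L2' w - L2 w)).
rewrite (_ : _ - _ =
   (dG (z1 + dz1) (L1' w) - dG z1 (L1' w) - (dG (z2 + dz1) (L1' w) - dG z2 (L1' w)))
   + (dG (z2 + dz1) (L1' w) - dG (z2 + dz2) (L1' w))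
   + (dG (z2 + dz2) (L1' w - L2' w) - dG z2 (L1' w - L2' w))
   + (dG z1 (L1' w - L1 w) - dG z2 (L1' w - L1 w))
   + dG z2 ((L1' w - L1 w) - (L2' w - L2 w))); last first.
  by rewrite !C3_linearB; zmod.
apply: le_trans (ler_normD _ _) _; apply: le_trans (lerD (ler_normD _ _) (lexx _)) _.
apply: le_trans (lerD (lerD (ler_normD _ _) (lexx _)) (lexx _)) _.
apply: le_trans (lerD (lerD (lerD (ler_normD _ _) (lexx _)) (lexx _)) (lexx _)) _.
have {}h1 := le_trans h1 (mul_le (mulr_ge0 (mulr_ge0 c0 (normr_ge0 _)) (normr_ge0 _)) (normr_ge0 _)
  (mul_le (mulr_ge0 c0 (normr_ge0 _)) (normr_ge0 _) (ler_wpM2l c0 zd) dz1_le) (L1'c w)).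
have {}h2 := le_trans h2 (mul_le (mulr_ge0 c0 (normr_ge0 _)) (normr_ge0 _)
  (ler_wpM2l c0 germ_diff_dz_le) (L1'c w)).
have {}h3 := le_trans h3 (mul_le (mulr_ge0 c0 (normr_ge0 _)) (normr_ge0 _)
  (ler_wpM2l c0 dz2_le) (L'd w)).
have {}h4 := le_trans h4 (mul_le (mulr_ge0 c0 (normr_ge0 _)) (normr_ge0 _)
  (ler_wpM2l c0 zd) (dL1c w)).
have {}h5 := le_trans h5 (ler_wpM2l c0 (dLd w)).
apply: le_trans (lerD (lerD (lerD (lerD h1 h2) h3) h4) h5) _.
have w0 := normr_ge0 w.
have := ler_wpM2r w0 (ler_wpM2l delta0 (@monomial_le 5 5 0 1 1 isT isT)).
have := ler_wpM2r w0 (ler_wpM2l delta0 (@monomial_le 4 5 0 1 1 isT isT)).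
have := ler_wpM2r w0 (ler_wpM2l delta0 (@monomial_le 3 5 0 1 1 isT isT)).
have := ler_wpM2r w0 (ler_wpM2l delta0 (@monomial_le 2 5 1 1 1 isT isT)).
lra.
Qed.

(** Compared with [germ_defect_le] a factor [delta] is gained; 30 is the sum of 14 from the
    increments and 16 from the tensors. *)
Lemma germ_diff_defect_le :
  `|((G (z1 + dz1) - G z1 - dG z1 (L1 v)) *m x
    + tensor_pair (fun w => dG (z1 + dz1) (L1' w) - dG z1 (L1 w)) T S)
    - ((G (z2 + dz2) - G z2 - dG z2 (L2 v)) *m x
    + tensor_pair (fun w => dG (z2 + dz2) (L2' w) - dG z2 (L2 w)) T S)|
    <= 30 * c ^+ 8 * rho * delta * q ^+ 3.
Proof.
have e (A A' : 'M[R]_(n, d)) (B B' : 'cV[R]_n) :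
  A *m x + B - (A' *m x + B') = (A - A') *m x + (B - B').
  by rewrite mulmxBl; zmod.
rewrite e tensor_pairB.
apply: le_trans (ler_normD _ _) _.
apply: le_trans (lerD (norm_mulmx_le germ_diff_rest_le xc)
  (norm_tensor_le _ germ_diff_dB_le Tc Sc)) _; first by rewrite !mulr_ge0 ?exprn_ge0.
lra.
Qed.

Lemma germ_diff_tensor_le :
  `|tensor_pair (fun w => dG z1 (L1 w)) T S - tensor_pair (fun w => dG z2 (L2 w)) T S|
   <= 4 * c ^+ 6 * delta * q ^+ 2.
Proof.
rewrite tensor_pairB.
by apply: le_trans (norm_tensor_le _ germ_diff_B_le Tc Sc) _;
  rewrite ?mulr_ge0 ?exprn_ge0//; lra.
Qed.

End two.
End germ_algebra.

(** * One Picard step on a short window *)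

Definition powd (R : realType) (beta s t : R) : R := (t - s) `^ beta.

Definition holder_path (R : realType) (n : nat) (beta r b : R)
    (y : R -> 'cV[R]_n) : Prop :=
  exists C, forall s t, - r <= s -> s <= t -> t <= b ->
    `|y t - y s| <= C * powd beta s t.

(* One delay interval [0, r]: Y is the delayed driving path and Dr y s t the
   drift integral of the path y over [s, t]; the single constant c dominates
   all the others. *)
Record rough_setting (R : realType) (n d : nat) (beta r : R)
    (X Y : R -> 'cV[R]_d) (XX YX : R -> R -> 'M[R]_d)
    (G : 'cV[R]_n * 'cV[R]_n -> 'M[R]_(n, d))
    (dG : 'cV[R]_n * 'cV[R]_n -> 'cV[R]_n * 'cV[R]_n -> 'M[R]_(n, d))
    (Dr : (R -> 'cV[R]_n) -> R -> R -> 'cV[R]_n) (c : R) : Prop :=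
  RoughSetting {
  rs_beta_gt : 3^-1 < beta ;
  rs_beta_lt : beta < 2^-1 ;
  rs_r : 0 < r ;
  rs_c : 1 <= c ;
  rs_d : d%:R <= c ;
  rs_C3 : C3_bound G dG c ;
  rs_X : forall s t, 0 <= s -> s <= t -> t <= r ->
    `|X t - X s| <= c * powd beta s t ;
  rs_Y : forall s t, 0 <= s -> s <= t -> t <= r ->
    `|Y t - Y s| <= c * powd beta s t ;
  rs_XX : forall s t, 0 <= s -> s <= t -> t <= r ->
    `|XX s t| <= c * powd beta s t ^+ 2 ;
  rs_YX : forall s t, 0 <= s -> s <= t -> t <= r ->
    `|YX s t| <= c * powd beta s t ^+ 2 ;
  rs_chenX : forall s u t, 0 <= s -> s <= u -> u <= t -> t <= r ->
    XX s t = XX s u + XX u t + (X u - X s) *m (X t - X u)^T ;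
  rs_chenY : forall s u t, 0 <= s -> s <= u -> u <= t -> t <= r ->
    YX s t = YX s u + YX u t + (Y u - Y s) *m (X t - X u)^T ;
  rs_drift_add : forall y b, holder_path beta r b y ->
    forall s u t, 0 <= s -> s <= u -> u <= t -> t <= b ->
      Dr y s t = Dr y s u + Dr y u t ;
  rs_drift_bound : forall y b K, holder_path beta r b y ->
    (forall t, - r <= t -> t <= b -> `|y t| <= K) ->
    forall s t, 0 <= s -> s <= t -> t <= b -> `|Dr y s t| <= c * K * (t - s) ;
  rs_drift_diff : forall y1 y2 b e,
    holder_path beta r b y1 -> holder_path beta r b y2 ->
    (forall t, - r <= t -> t <= b -> `|y1 t - y2 t| <= e) ->
    forall s t, 0 <= s -> s <= t -> t <= b ->
      `|Dr y1 s t - Dr y2 s t| <= c * e * (t - s) }.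

Section setting.
Context {R : realType} {n d : nat} {beta r : R}.
Context {X Y : R -> 'cV[R]_d} {XX YX : R -> R -> 'M[R]_d}.
Context {G : 'cV[R]_n * 'cV[R]_n -> 'M[R]_(n, d)}.
Context {dG : 'cV[R]_n * 'cV[R]_n -> 'cV[R]_n * 'cV[R]_n -> 'M[R]_(n, d)}.
Context {Dr : (R -> 'cV[R]_n) -> R -> R -> 'cV[R]_n} {c : R}.
Implicit Types (s t u : R).
Hypothesis RS : rough_setting beta r X Y XX YX G dG Dr c.
Local Notation E := ('cV[R]_n * 'cV[R]_n)%type.
Local Notation U := ('cV[R]_d * 'cV[R]_d)%type.
Local Notation p := (powd beta).

Let c1 : 1 <= c := rs_c RS.
Let c0 : 0 <= c. Proof. exact: le_trans c1. Qed.
Let beta0 : 0 < beta.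
Proof. by apply: lt_trans (rs_beta_gt RS); rewrite invr_gt0. Qed.

Lemma powd_ge0 s t : 0 <= p s t. Proof. exact: powR_ge0. Qed.

Lemma powR_homo (x y : R) : 0 <= x -> x <= y -> x `^ beta <= y `^ beta.
Proof.
by move=> x0 xy; rewrite ge0_ler_powR ?nnegrE ?(ltW beta0)// (le_trans x0).
Qed.

Lemma powd_le s t s' t' : s <= t -> t - s <= t' - s' -> p s t <= p s' t'.
Proof.
move=> st h; rewrite ge0_ler_powR ?nnegrE ?(ltW beta0) ?subr_ge0//.
by rewrite -subr_ge0 (le_trans _ h)// subr_ge0.
Qed.

Lemma powd3 s t : p s t ^+ 3 = (t - s) `^ (3 * beta).
Proof. by rewrite mulrC powRrM powR_mulrn ?powR_ge0. Qed.

Lemma powd2 s t : p s t ^+ 2 = (t - s) `^ (2 * beta).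
Proof. by rewrite mulrC powRrM powR_mulrn ?powR_ge0. Qed.

Let th1 : 1 < 3 * beta.
Proof. have := rs_beta_gt RS; rewrite -(ltr_pM2l (x := 3))// divff//. Qed.

(** The Gubinelli derivative of the pair [(y, eta)] with respect to the pair [(X, Y)]; it is block
    diagonal because [y] is controlled by [X] and [eta] by [Y]. *)
Definition lin_pair (y' eta' : R -> 'M[R]_(n, d)) (s : R) (w : U) : E :=
  (y' s *m w.1, eta' s *m w.2).

Definition incr_pair (s t : R) : U := (X t - X s, Y t - Y s).

Definition germ (Z : R -> E) (L : R -> U -> E) (s t : R) : 'cV[R]_n :=
  G (Z s) *m (X t - X s) +
  tensor_pair (fun w => dG (Z s) (L s w)) (XX s t) (YX s t).

Lemma lin_pair_linear y' eta' s (k : R) w w' :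
  lin_pair y' eta' s (k *: w + w') = k *: lin_pair y' eta' s w + lin_pair y' eta' s w'.
Proof. by congr pair; rewrite /= mulmxDr scalemxAr. Qed.

(** By Chen's relations the tensors over [[s, t]] contain a rank one part, which becomes the linear
    term of the Taylor expansion of [G] between [s] and [u]. What is left is of third order. *)
Lemma germ_defectE Z y' eta' s u t : 0 <= s -> s <= u -> u <= t -> t <= r ->
  let L := lin_pair y' eta' in
  germ Z L s t - germ Z L s u - germ Z L u t =
  - ((G (Z s + (Z u - Z s)) - G (Z s) - dG (Z s) (L s (incr_pair s u))) *m (X t - X u)
     + tensor_pair (fun w => dG (Z s + (Z u - Z s)) (L u w) - dG (Z s) (L s w))
         (XX u t) (YX u t)).
Proof.
move=> s0 su ut tr L; have -> : Z s + (Z u - Z s) = Z u by zmod.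
rewrite /germ.
rewrite (rs_chenX RS s0 su ut tr) (rs_chenY RS s0 su ut tr) !tensor_pairDr.
rewrite tensor_pair_rank1; last first.
  move=> k w w'.
  by rewrite /L lin_pair_linear (C3_linear (rs_C3 RS)).
rewrite -/(incr_pair s u) -(tensor_pairB (fun w => dG (Z u) (L u w))) !mulmxBl.
have -> : X t - X s = (X t - X u) + (X u - X s) by zmod.
by rewrite mulmxDr; zmod.
Qed.

(** The constant [C'] is absent from the conclusion: an uncontrolled estimate of order [3 beta] is
    traded for one governed by the additivity defect alone. *)
Lemma three_halves_bound (N : R -> R -> 'cV[R]_n) a b C C' :
  0 <= C ->
  (forall s u t, a <= s -> s <= u -> u <= t -> t <= b ->
    `|N s t - N s u - N u t| <= C * p s t ^+ 3) ->
  (forall s t, a <= s -> s <= t -> t <= b -> `|N s t| <= C' * p s t ^+ 3) ->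
  forall s t, a <= s -> s <= t -> t <= b ->
    `|N s t| <= sewing_const (3 * beta) * C * p s t ^+ 3.
Proof.
move=> C0 dN N' s t sa st tb; rewrite powd3.
apply: (@halving_bound _ _ N a b (3 * beta) (3 * beta) C C') => //.
  by move=> *; rewrite -powd3; exact: dN.
by move=> *; rewrite -powd3; exact: N'.
Qed.

Lemma prod_norm_le (A B : normedModType R) (x : A * B) (m : R) :
  `|x.1| <= m -> `|x.2| <= m -> `|x| <= m.
Proof. by move=> h1 h2; rewrite prod_normE ge_max h1. Qed.

Lemma prod_norm_fst (A B : normedModType R) (x : A * B) : `|x.1| <= `|x|.
Proof. by rewrite prod_normE le_max lexx. Qed.

Lemma prod_norm_snd (A B : normedModType R) (x : A * B) : `|x.2| <= `|x|.
Proof. by rewrite prod_normE le_max lexx orbT. Qed.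

Definition delay_ok (eta : R -> 'cV[R]_n) (eta' : R -> 'M[R]_(n, d)) : Prop :=
  [/\ forall t, 0 <= t -> t <= r -> `|eta' t| <= c,
      forall s t, 0 <= s -> s <= t -> t <= r -> `|eta' t - eta' s| <= c * p s t &
      forall s t, 0 <= s -> s <= t -> t <= r ->
        `|eta t - eta s - eta' s *m (Y t - Y s)| <= c * p s t ^+ 2].

(* The radii are dictated by the invariance of the ball under one Picard step
   on a window of length at most h, with rho = h ^ - beta. *)
Definition ball_lip : R := 2 * c ^+ 5.
Definition in_ball (a b rho : R) (y : R -> 'cV[R]_n) (y' : R -> 'M[R]_(n, d)) : Prop :=
  [/\ forall t, a <= t -> t <= b -> `|y' t| <= c,
      forall s t, a <= s -> s <= t -> t <= b -> `|y' t - y' s| <= ball_lip * p s t &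
      forall s t, a <= s -> s <= t -> t <= b ->
        `|y t - y s - y' s *m (X t - X s)| <= rho * p s t ^+ 2].

(** Common bound for the pair [(y, eta)]: it has to dominate [c * ball_lip], which is [2 c^6], in
    [lift_dL], and [3 c^2] in [close_Z]. *)
Definition cc : R := 3 * c ^+ 6.
(** [K1] is the Davie constant of a Picard step in units of [rho]. [K2] adds up what drift, tensor
    and sewing contribute to the difference of two Picard steps. Above the threshold [Kst], half of
    [rho] dominates [K1 + 2 * cc ^+ 5], for the invariance of the ball, and also [K2], for the
    contraction. *)
Definition K1 : R := sewing_const (3 * beta) * (11 * cc ^+ 7).
Definition K2 : R := 3 * c ^+ 3 + 4 * cc ^+ 6 + sewing_const (3 * beta) * (30 * cc ^+ 8).
Definition Kst : R := 2 * (K2 + K1 + 2 * cc ^+ 5).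

Lemma c_le_cX k : (0 < k)%N -> c <= c ^+ k.
Proof. by case: k => // k _; rewrite exprS ler_peMr// exprn_ege1. Qed.

Lemma c_le_cc : c <= cc.
Proof.
apply: le_trans (c_le_cX (isT : 0 < 6)%N) _; rewrite /cc.
by rewrite ler_peMl ?exprn_ge0// ler1n.
Qed.

Lemma cc1 : 1 <= cc. Proof. exact: le_trans c_le_cc. Qed.

Lemma K1_ge0 : 0 <= K1.
Proof.
rewrite mulr_ge0//; first by apply: le_trans (sewing_const_ge1 th1).
by rewrite mulr_ge0// exprn_ge0// (le_trans _ cc1).
Qed.

Lemma K2_ge : 4 * cc ^+ 6 <= K2.
Proof.
rewrite /K2 -addrA addrCA lerDl addr_ge0//.
  by rewrite mulr_ge0// exprn_ge0.
rewrite mulr_ge0//; first by apply: le_trans (sewing_const_ge1 th1).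
by rewrite mulr_ge0// exprn_ge0// (le_trans _ cc1).
Qed.

Lemma Kst_ge1 : 1 <= Kst.
Proof.
have := K2_ge; have := K1_ge0; have := exprn_ege1 6 cc1; have := exprn_ege1 5 cc1.
rewrite /Kst; lra.
Qed.

(** * Estimates on a window [[a, b]] of length at most [h] *)

Section window.
Variables (a b h : R).
Hypotheses (a0 : 0 <= a) (ab : a <= b) (br : b <= r).
Hypotheses (bah : b - a <= h) (h0 : 0 < h) (h1 : h <= 1).
Ltac wlra := move: (a0) (ab) (br) (bah) (h0) (h1) (c0) => ? ? ? ? ? ? ?; lra.
Let rho := (h `^ beta)^-1.
Hypothesis rhoK : Kst <= rho.

Lemma rho1 : 1 <= rho. Proof. exact: le_trans Kst_ge1 rhoK. Qed.
Let rho0 : 0 <= rho. Proof. exact: le_trans rho1. Qed.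

(** One power of [p] absorbs one factor [rho]; every gain of smallness on a window goes through this
    inequality. *)
Lemma rho_powd s t : a <= s -> s <= t -> t <= b -> rho * p s t <= 1.
Proof.
move=> sa st tb; rewrite mulrC ler_pdivrMr ?powR_gt0// mul1r.
by apply: powR_homo; wlra.
Qed.

Lemma powd_le1 s t : a <= s -> s <= t -> t <= b -> p s t <= 1.
Proof.
move=> sa st tb; apply: le_trans (rho_powd sa st tb).
by rewrite ler_peMl ?powd_ge0// rho1.
Qed.

Lemma incr_pair_le s t : a <= s -> s <= t -> t <= b -> `|incr_pair s t| <= c * p s t.
Proof.
move=> sa st tb; apply: prod_norm_le; [apply: (rs_X RS)|apply: (rs_Y RS)] => //; wlra.
Qed.

Let mulmx_le (A : 'M[R]_(n, d)) (x : 'cV[R]_d) (k l : R) :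
  `|A| <= k -> `|x| <= l -> `|A *m x| <= c * k * l.
Proof. exact: norm_mulmx_le (rs_d RS) _ _ _ _. Qed.

Section lift.
Variables (y eta : R -> 'cV[R]_n) (y' eta' : R -> 'M[R]_(n, d)).
Hypotheses (by_ : in_ball a b rho y y') (eo : delay_ok eta eta').
Let Z t : E := (y t, eta t).
Let L := lin_pair y' eta'.

Lemma lift_L s w : a <= s -> s <= b -> `|L s w| <= c ^+ 2 * `|w|.
Proof.
move=> sa sb; rewrite expr2; case: by_ eo => h1' _ _ [h2' _ _].
by apply: prod_norm_le; apply: mulmx_le; rewrite ?prod_norm_fst ?prod_norm_snd//;
  [exact: h1'|apply: h2'; wlra].
Qed.

Lemma lift_Lcc s w : a <= s -> s <= b -> `|L s w| <= cc * `|w|.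
Proof.
move=> sa sb; apply: le_trans (lift_L w sa sb) _; rewrite ler_wpM2r//.
rewrite /cc; have := ler_weXn2l c1 (isT : 2 <= 6)%N; have := exprn_ge0 6 c0; wlra.
Qed.

Lemma lift_dL s t w : a <= s -> s <= t -> t <= b ->
  `|L t w - L s w| <= cc * p s t * `|w|.
Proof.
move=> sa st tb; case: by_ eo => _ h1' _ [_ h2' _].
have pw : 0 <= p s t * `|w| by rewrite mulr_ge0 ?powd_ge0.
apply: prod_norm_le; rewrite /= -mulmxBl.
  apply: le_trans (mulmx_le (h1' _ _ sa st tb) (prod_norm_fst w)) _.
  rewrite ler_wpM2r// mulrA ler_wpM2r ?powd_ge0// /ball_lip /cc.
  have := exprn_ge0 6 c0; wlra.
apply: le_trans (mulmx_le (h2' _ _ _ st _) (prod_norm_snd w)) _; try wlra.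
rewrite ler_wpM2r// mulrA ler_wpM2r ?powd_ge0// /cc.
have := ler_weXn2l c1 (isT : 2 <= 6)%N; have := exprn_ge0 6 c0; wlra.
Qed.

Lemma lift_rest s t : a <= s -> s <= t -> t <= b ->
  `|Z t - Z s - L s (incr_pair s t)| <= c * rho * p s t ^+ 2.
Proof.
move=> sa st tb; case: by_ eo => _ _ h1' [_ _ h2'].
have p2 : 0 <= p s t ^+ 2 by rewrite exprn_ge0// powd_ge0.
apply: prod_norm_le => /=.
  by apply: le_trans (h1' _ _ sa st tb) _; rewrite ler_wpM2r// ler_peMl.
apply: le_trans (h2' _ _ _ st _) _; try wlra.
by rewrite ler_wpM2r// ler_peMr// rho1.
Qed.

Lemma lift_dZ s t : a <= s -> s <= t -> t <= b -> `|Z t - Z s| <= 2 * c ^+ 4 * p s t.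
Proof.
move=> sa st tb.
have c21 : 1 <= c ^+ 2 by rewrite exprn_ege1.
have cc2 : c <= c ^+ 2 by exact: c_le_cX.
(* [germ_dz_le] is used with [c ^+ 2] rather than [cc], because this bound determines [ball_lip],
   from which [cc] is chosen. *)
have -> : 2 * c ^+ 4 * p s t = 2 * (c ^+ 2) ^+ 2 * p s t by ring.
apply: (@germ_dz_le _ _ _ (c ^+ 2) _ rho _ _ _ _ _ (L s) (incr_pair s t)) => //.
- exact: powd_ge0.
- exact: rho1.
- exact: rho_powd.
- by move=> w; apply: lift_L => //; wlra.
- by apply: le_trans (incr_pair_le sa st tb) _; rewrite ler_wpM2r ?powd_ge0.
- apply: le_trans (lift_rest sa st tb) _; rewrite ler_wpM2r ?exprn_ge0 ?powd_ge0//.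
  by rewrite ler_wpM2r.
Qed.

Lemma lift_dG s t : a <= s -> s <= t -> t <= b ->
  `|G (Z t) - G (Z s)| <= ball_lip * p s t.
Proof.
move=> sa st tb; have := C3_lip0 (rs_C3 RS) (Z s) (Z t - Z s).
rewrite (_ : Z s + (Z t - Z s) = Z t); last by zmod.
move=> h2; apply: le_trans h2 _; apply: le_trans (ler_wpM2l c0 (lift_dZ sa st tb)) _.
by rewrite /ball_lip; wlra.
Qed.

Let incr_cc s t : a <= s -> s <= t -> t <= b -> `|incr_pair s t| <= cc * p s t.
Proof.
move=> sa st tb; apply: le_trans (incr_pair_le sa st tb) _.
by rewrite ler_wpM2r ?powd_ge0// c_le_cc.
Qed.

Lemma lift_defect s u t : a <= s -> s <= u -> u <= t -> t <= b ->
  `|germ Z L s t - germ Z L s u - germ Z L u t| <= 11 * cc ^+ 7 * rho * p s t ^+ 3.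
Proof.
move=> sa su ut tb; rewrite germ_defectE//; [|wlra|wlra].
have psu : p s u <= p s t by apply: powd_le; wlra.
have put : p u t <= p s t by apply: powd_le; wlra.
have put2 : p u t ^+ 2 <= p s t ^+ 2.
  by rewrite lerXn2r// nnegrE powd_ge0.
have psu2 : p s u ^+ 2 <= p s t ^+ 2.
  by rewrite lerXn2r// nnegrE powd_ge0.
have ccX x : 0 <= x -> c * x <= cc * x by move=> x0; rewrite ler_wpM2r// c_le_cc.
have cc0 : 0 <= cc by apply: le_trans cc1.
rewrite normrN; apply: germ_defect_le.
- by apply: C3_bound_le (rs_C3 RS) _; exact: c_le_cc.
- exact: cc1.
- exact: le_trans (rs_d RS) c_le_cc.
- exact: powd_ge0.
- exact: rho1.
- by apply: rho_powd => //; wlra.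
- by move=> w; apply: lift_Lcc => //; wlra.
- by move=> w; apply: lift_Lcc => //; wlra.
- move=> w; apply: le_trans (lift_dL w sa su _) _; first by wlra.
  by rewrite ler_wpM2r// ler_wpM2l.
- apply: le_trans (incr_cc sa su _) _; first by wlra.
  by rewrite ler_wpM2l.
- apply: le_trans (rs_X RS _ ut _) _; [wlra|wlra|].
  by apply: le_trans (ler_wpM2l c0 put) _; exact/ccX/powd_ge0.
- apply: le_trans (rs_XX RS _ ut _) _; [wlra|wlra|].
  by apply: le_trans (ler_wpM2l c0 put2) _; apply/ccX/exprn_ge0/powd_ge0.
- apply: le_trans (rs_YX RS _ ut _) _; [wlra|wlra|].
  by apply: le_trans (ler_wpM2l c0 put2) _; apply/ccX/exprn_ge0/powd_ge0.
- apply: le_trans (lift_rest sa su _) _; first by wlra.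
  apply: (@le_trans _ _ (c * rho * p s t ^+ 2)).
    by rewrite ler_wpM2l// mulr_ge0.
  by rewrite ler_wpM2r ?exprn_ge0 ?powd_ge0// ler_wpM2r// c_le_cc.
Qed.

Lemma lift_tensor s t : a <= s -> s <= t -> t <= b ->
  `|tensor_pair (fun w => dG (Z s) (L s w)) (XX s t) (YX s t)|
    <= 2 * cc ^+ 5 * p s t ^+ 2.
Proof.
move=> sa st tb.
have ccX x : 0 <= x -> c * x <= cc * x by move=> x0; rewrite ler_wpM2r// c_le_cc.
apply: germ_tensor_le.
- by apply: C3_bound_le (rs_C3 RS) _; exact: c_le_cc.
- exact: cc1.
- exact: le_trans (rs_d RS) c_le_cc.
- by move=> w; apply: lift_Lcc => //; wlra.
- apply: le_trans (rs_XX RS _ st _) _; [wlra|wlra|].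
  by apply/ccX/exprn_ge0/powd_ge0.
- apply: le_trans (rs_YX RS _ st _) _; [wlra|wlra|].
  by apply/ccX/exprn_ge0/powd_ge0.
Qed.

(** At [s = u = t] the defect is minus the germ, and the bound for it is 0. *)
Lemma germ_diag s : a <= s -> s <= b -> germ Z L s s = 0.
Proof.
move=> sa sb; apply/eqP; rewrite -normr_le0.
have p0 : p s s = 0 by rewrite /powd subrr powR0// gt_eqF.
have := lift_defect sa (lexx s) (lexx s) sb.
by rewrite p0 expr0n mulr0 subrr sub0r normrN.
Qed.

End lift.
Lemma holder_path_cat (y : R -> 'cV[R]_n) C : holder_path beta r a y ->
  (forall s t, a <= s -> s <= t -> t <= b -> `|y t - y s| <= C * p s t) ->
  holder_path beta r b y.
Proof.
move=> [C1 h1'] h2'; exists (`|C1| + `|C|) => s t rs st tb.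
have {}h1' s' t' : - r <= s' -> s' <= t' -> t' <= a -> `|y t' - y s'| <= `|C1| * p s' t'.
  move=> *; apply: le_trans (h1' _ _ _ _ _) _ => //.
  by rewrite ler_wpM2r ?powd_ge0// ler_norm.
have {}h2' s' t' : a <= s' -> s' <= t' -> t' <= b -> `|y t' - y s'| <= `|C| * p s' t'.
  move=> *; apply: le_trans (h2' _ _ _ _ _) _ => //.
  by rewrite ler_wpM2r ?powd_ge0// ler_norm.
rewrite mulrDl.
case: (leP t a) => ta.
  by apply: le_trans (h1' _ _ rs st ta) _; rewrite lerDl mulr_ge0 ?powd_ge0.
case: (leP a s) => as_.
  by apply: le_trans (h2' _ _ as_ st tb) _; rewrite lerDr mulr_ge0 ?powd_ge0.
rewrite (_ : y t - y s = (y a - y s) + (y t - y a)); last by zmod.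
apply: le_trans (ler_normD _ _) _; apply: lerD.
  apply: le_trans (h1' _ _ rs (ltW as_) (lexx _)) _.
  by rewrite ler_wpM2l//; apply: powd_le; wlra.
apply: le_trans (h2' _ _ (lexx _) (ltW ta) tb) _.
by rewrite ler_wpM2l//; apply: powd_le; wlra.
Qed.

Lemma in_ball_dy y y' s t : in_ball a b rho y y' -> a <= s -> s <= t -> t <= b ->
  `|y t - y s| <= (c ^+ 3 + 1) * p s t.
Proof.
move=> [b1 _ b3] sa st tb.
rewrite (_ : y t - y s = y' s *m (X t - X s) + (y t - y s - y' s *m (X t - X s))); last by zmod.
apply: le_trans (ler_normD _ _) _; rewrite mulrDl; apply: lerD.
  by apply: le_trans (mulmx_le (b1 s sa _) (rs_X RS _ st _)) _; wlra.
apply: le_trans (b3 _ _ sa st tb) _.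
by rewrite expr2 mulrA ler_wpM2r ?powd_ge0// rho_powd.
Qed.

Lemma in_ball_holder y y' : holder_path beta r a y -> in_ball a b rho y y' ->
  holder_path beta r b y.
Proof. by move=> hy by_; apply: holder_path_cat hy (fun s t => @in_ball_dy y y' s t by_). Qed.

Lemma drift_diag y s : holder_path beta r b y -> 0 <= s -> s <= b -> Dr y s s = 0.
Proof.
move=> hy s0 sb; have := rs_drift_add RS hy s0 (lexx s) (lexx s) sb.
by rewrite -{1}[Dr y s s]addr0 => /addrI.
Qed.

(** A Picard step as a relation: it controls only the increments of [z], the history of [z] being
    prescribed separately. *)
Definition step_of (eta : R -> 'cV[R]_n) (eta' : R -> 'M[R]_(n, d))
    (y : R -> 'cV[R]_n) (y' : R -> 'M[R]_(n, d)) (z : R -> 'cV[R]_n) :=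
  forall s t, a <= s -> s <= t -> t <= b ->
    `|z t - z s - Dr y s t - germ (fun t => (y t, eta t)) (lin_pair y' eta') s t|
      <= K1 * rho * p s t ^+ 3.

Lemma step_exists eta eta' y y' : delay_ok eta eta' -> holder_path beta r b y ->
  in_ball a b rho y y' ->
  exists z, (forall t, t <= a -> z t = y t) /\ step_of eta eta' y y' z.
Proof.
move=> eo hy by_.
have cc0 : 0 <= cc by apply: le_trans cc1.
have [|||||I hI] := @sewing R n 1 (germ (fun t => (y t, eta t)) (lin_pair y' eta'))
  a b (3 * beta) (11 * cc ^+ 7 * rho).
- exact: ab.
- exact: th1.
- by rewrite !mulr_ge0 ?exprn_ge0.
- by move=> s /andP[sa sb]; exact: germ_diag.
- by move=> s u t sa su ut tb; rewrite -powd3; exact: lift_defect.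
pose z t := y a + Dr y a t + (I t - I a).
have za : z a = y a by rewrite /z drift_diag// subrr !addr0.
(* Before [a] the path is kept, since the drift looks back over the whole delay interval. *)
exists (fun t => if t <= a then y t else z t); split=> [t ->//|s t sa st tb].
have zE u : a <= u -> (if u <= a then y u else z u) = z u.
  case: (leP u a) => // ua au; have -> : u = a by apply/le_anti; rewrite ua au.
    by rewrite za.
rewrite !zE//; last exact: le_trans st.
have := hI s t sa st tb; rewrite -powd3 /K1 !mulrA.
rewrite /z (rs_drift_add RS hy a0 sa st tb).
set g := germ _ _ s t.
rewrite (_ : _ - g = I t - I s - g); last by zmod.
by [].
Qed.

(** As [2 * beta < 1], the length is of order [p ^+ 2] with the factor [h ^ (1 - 2 * beta)], written
    in units of [rho]. This is how a condition on [h ^ (1 - beta)] tames the drift. *)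
Lemma time_le s t : a <= s -> s <= t -> t <= b ->
  t - s <= h `^ (1 - beta) * rho * p s t ^+ 2.
Proof.
move=> sa st tb; rewrite powd2.
have ts0 : 0 <= t - s by rewrite subr_ge0.
have b2 := rs_beta_lt RS; have bg := rs_beta_gt RS.
have -> : h `^ (1 - beta) * rho = h `^ (1 - 2 * beta).
  rewrite /rho -powRN -powRD; last by rewrite (lt0r_neq0 h0) implybT.
  by congr (_ `^ _); ring.
have tsh : t - s <= h by wlra.
have b12 : 0 <= 1 - 2 * beta.
  by move: b2; lra.
rewrite -{1}[t - s]powRr1// -{1}(subrK (2 * beta) 1) powRD; last first.
  by rewrite subrK oner_eq0.
by rewrite ler_wpM2r ?powR_ge0// ge0_ler_powR ?nnegrE// ltW.
Qed.

(** Half of the radius is reserved for the drift, by the condition on [h ^ (1 - beta)]; the other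
    half covers the sewing error and the tensor term, by [Kst <= rho]. The bound on the derivative
    increments reproduces itself, because [lift_dG] does not use the previous one. *)
Lemma step_ball eta eta' y y' z K : delay_ok eta eta' -> holder_path beta r b y ->
  in_ball a b rho y y' -> step_of eta eta' y y' z ->
  (forall t, - r <= t -> t <= b -> `|y t| <= K) ->
  2 * c * K * h `^ (1 - beta) <= 1 ->
  in_ball a b rho z (fun t => G (y t, eta t)).
Proof.
move=> eo hy by_ sz yK hK; split.
- by move=> t _ _; exact: C3_bound0 (rs_C3 RS) _.
- by move=> s t; exact: (lift_dG by_ eo).
move=> s t sa st tb.
set L := lin_pair y' eta'; set Z := fun t => (y t, eta t).
rewrite (_ : _ - _ - _ = (z t - z s - Dr y s t - germ Z L s t) + Dr y s t
  + tensor_pair (fun w => dG (Z s) (L s w)) (XX s t) (YX s t)); last first.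
  by rewrite /germ /Z; zmod.
apply: le_trans (ler_normD _ _) _; apply: le_trans (lerD (ler_normD _ _) (lexx _)) _.
have s0 : 0 <= s by wlra.
apply: le_trans (lerD (lerD (sz s t sa st tb) (rs_drift_bound RS hy yK s0 st tb))
  (lift_tensor by_ eo sa st tb)) _.
have K0 : 0 <= K by apply: le_trans (normr_ge0 _) (yK s _ _); have := rs_r RS; wlra.
have tl := ler_wpM2l (mulr_ge0 c0 K0) (time_le sa st tb).
have p0 := powd_ge0 s t.
have rp2 : 0 <= rho * p s t ^+ 2 by rewrite mulr_ge0 ?exprn_ge0.
have h2 := ler_wpM2r rp2 hK.
have h3 : K1 * rho * p s t ^+ 3 <= K1 * p s t ^+ 2.
  rewrite exprS mulrA -(mulrA K1) -mulrA ler_wpM2l ?K1_ge0//.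
  by rewrite ler_piMl ?exprn_ge0// rho_powd.
have h4 : Kst * p s t ^+ 2 <= rho * p s t ^+ 2 by rewrite ler_wpM2r ?exprn_ge0.
have h5 : 0 <= K2 * p s t ^+ 2.
  rewrite mulr_ge0 ?exprn_ge0//; apply: le_trans K2_ge.
  by rewrite mulr_ge0// exprn_ge0// (le_trans _ cc1).
move: h4; rewrite {1}/Kst; lra.
Qed.


Definition delay_close (e : R) (eta1 eta2 : R -> 'cV[R]_n)
    (eta1' eta2' : R -> 'M[R]_(n, d)) : Prop :=
  [/\ forall t, 0 <= t -> t <= r -> `|eta1 t - eta2 t| <= e,
      forall t, 0 <= t -> t <= r -> `|eta1' t - eta2' t| <= e,
      forall s t, 0 <= s -> s <= t -> t <= r ->
        `|(eta1' t - eta1' s) - (eta2' t - eta2' s)| <= e * p s t &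
      forall s t, 0 <= s -> s <= t -> t <= r ->
        `|(eta1 t - eta1 s - eta1' s *m (Y t - Y s))
          - (eta2 t - eta2 s - eta2' s *m (Y t - Y s))| <= e * p s t ^+ 2].

(** Only increments are compared, in units of [rho]. Together with the distance of the data at [a]
    they also give the distance of the values, because [rho * p] is at most 1. *)
Definition path_close (delta : R) (y1 y2 : R -> 'cV[R]_n)
    (y1' y2' : R -> 'M[R]_(n, d)) : Prop :=
  (forall s t, a <= s -> s <= t -> t <= b ->
    `|(y1' t - y1' s) - (y2' t - y2' s)| <= delta * rho * p s t) /\
  (forall s t, a <= s -> s <= t -> t <= b ->
    `|(y1 t - y1 s - y1' s *m (X t - X s)) - (y2 t - y2 s - y2' s *m (X t - X s))|
      <= delta * rho * p s t ^+ 2).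

(** * Difference of two Picard steps, for data at distance [e] and paths at distance [delta] *)

Section lift_diff.
Variables (e delta : R) (y1 y2 eta1 eta2 : R -> 'cV[R]_n).
Variables (y1' y2' eta1' eta2' : R -> 'M[R]_(n, d)).
Hypotheses (e0 : 0 <= e) (delta0 : 0 <= delta).
Hypotheses (b1 : in_ball a b rho y1 y1') (b2 : in_ball a b rho y2 y2').
Hypotheses (o1 : delay_ok eta1 eta1') (o2 : delay_ok eta2 eta2').
Hypothesis oe : delay_close e eta1 eta2 eta1' eta2'.
Hypothesis he : forall t, - r <= t -> t <= a -> `|y1 t - y2 t| <= e.
Hypothesis de : `|y1' a - y2' a| <= e.
Hypothesis cl : path_close delta y1 y2 y1' y2'.
Let D := e + delta.
Let D0 : 0 <= D. Proof. exact: addr_ge0. Qed.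
Let Z1 t : E := (y1 t, eta1 t).
Let Z2 t : E := (y2 t, eta2 t).
Let L1 := lin_pair y1' eta1'.
Let L2 := lin_pair y2' eta2'.
Let ccX (x : R) : 0 <= x -> c * x <= cc * x.
Proof. by move=> x0; rewrite ler_wpM2r// c_le_cc. Qed.
Let cc0 : 0 <= cc. Proof. by apply: le_trans cc1. Qed.
Let eD : e <= D. Proof. by rewrite lerDl. Qed.
Let dD : delta <= D. Proof. by rewrite lerDr. Qed.

Lemma close_deriv s : a <= s -> s <= b -> `|y1' s - y2' s| <= D.
Proof.
move=> sa sb; case: cl => [h2 _]; have {}h2 := h2 a s (lexx a) sa sb.
rewrite (_ : y1' s - y2' s = (y1' a - y2' a) + (y1' s - y1' a - (y2' s - y2' a))); last by zmod.
apply: le_trans (ler_normD _ _) _; apply: lerD => //.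
by apply: le_trans h2 _; rewrite -mulrA ler_piMr// rho_powd.
Qed.

Lemma close_dy s t : a <= s -> s <= t -> t <= b ->
  `|(y1 t - y1 s) - (y2 t - y2 s)| <= (c ^+ 2 + 1) * D * p s t.
Proof.
move=> sa st tb; case: cl => [_ h2]; have {}h2 := h2 s t sa st tb.
rewrite (_ : _ - _ = (y1' s - y2' s) *m (X t - X s) +
  ((y1 t - y1 s - y1' s *m (X t - X s)) - (y2 t - y2 s - y2' s *m (X t - X s)))); last first.
  by rewrite mulmxBl; zmod.
have sb : s <= b := le_trans st tb.
apply: le_trans (ler_normD _ _) _.
have s0 : 0 <= s := le_trans a0 sa.
have tr : t <= r := le_trans tb br.
apply: le_trans (lerD (mulmx_le (close_deriv sa sb) (rs_X RS s0 st tr)) h2) _.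
have p0 := powd_ge0 s t.
have h3 : delta * rho * p s t ^+ 2 <= D * p s t.
  rewrite expr2 mulrA -(mulrA delta) ler_wpM2r//.
  by apply: le_trans dD; rewrite ler_piMr// rho_powd.
lra.
Qed.

Lemma close_sup t : - r <= t -> t <= b -> `|y1 t - y2 t| <= 3 * c ^+ 2 * D.
Proof.
move=> rt tb; have c21 : 1 <= c ^+ 2 by rewrite exprn_ege1.
have h3 : D <= c ^+ 2 * D by rewrite ler_peMl.
move: (eD) (D0) (e0) => ? ? ?.
case: (leP t a) => ta.
  by apply: le_trans (he rt ta) _; lra.
rewrite (_ : y1 t - y2 t = (y1 a - y2 a) + (y1 t - y1 a - (y2 t - y2 a))); last by zmod.
apply: le_trans (ler_normD _ _) _.
have ra : - r <= a by have := rs_r RS; wlra.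
apply: le_trans (lerD (he ra (lexx a)) (close_dy (lexx a) (ltW ta) tb)) _.
have : (c ^+ 2 + 1) * D * p a t <= (c ^+ 2 + 1) * D * 1.
  apply: ler_wpM2l; first by rewrite mulr_ge0// addr_ge0// exprn_ge0.
  exact: powd_le1 (lexx a) (ltW ta) tb.
lra.
Qed.

Lemma close_Z s : a <= s -> s <= b -> `|Z1 s - Z2 s| <= cc * D.
Proof.
move=> sa sb; case: oe => h2 _ _ _.
apply: prod_norm_le => /=.
  apply: le_trans (close_sup _ sb) _; first by have := rs_r RS; wlra.
  rewrite ler_wpM2r// /cc.
  have := ler_weXn2l c1 (isT : 2 <= 6)%N; lra.
apply: le_trans (h2 s _ _) _; try wlra.
by apply: le_trans eD _; rewrite ler_peMl// cc1.
Qed.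

Lemma close_L s w : a <= s -> s <= b -> `|L1 s w - L2 s w| <= cc * D * `|w|.
Proof.
move=> sa sb; case: oe => _ h2 _ _.
have ccD : c * D * `|w| <= cc * D * `|w| by rewrite ler_wpM2r//; exact: ccX.
apply: prod_norm_le; rewrite /= -mulmxBl; apply: le_trans ccD; apply: mulmx_le;
  rewrite ?prod_norm_fst ?prod_norm_snd//; first exact: close_deriv.
by apply: le_trans (h2 s _ _) eD; wlra.
Qed.

Lemma close_dL s t w : a <= s -> s <= t -> t <= b ->
  `|(L1 t w - L1 s w) - (L2 t w - L2 s w)| <= cc * rho * D * p s t * `|w|.
Proof.
move=> sa st tb; case: oe => _ _ h2 _; case: cl => h3 _.
have p0 := powd_ge0 s t.
have ccD : c * (D * rho * p s t) * `|w| <= cc * rho * D * p s t * `|w|.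
  rewrite (_ : cc * rho * D * p s t = cc * (D * rho * p s t)); last by ring.
  by rewrite ler_wpM2r//; apply: ccX; rewrite !mulr_ge0.
apply: prod_norm_le; rewrite /= -!mulmxBl; apply: le_trans ccD; apply: mulmx_le;
  rewrite ?prod_norm_fst ?prod_norm_snd//.
  apply: le_trans (h3 s t sa st tb) _.
  by rewrite -!mulrA ler_wpM2r// mulr_ge0.
apply: le_trans (h2 s t _ st _) _; [wlra|wlra|].
by rewrite ler_wpM2r//; apply: le_trans eD _; rewrite ler_peMr// rho1.
Qed.

Lemma close_rest s t : a <= s -> s <= t -> t <= b ->
  `|(Z1 t - Z1 s - L1 s (incr_pair s t)) - (Z2 t - Z2 s - L2 s (incr_pair s t))|
    <= cc * rho * D * p s t ^+ 2.
Proof.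
move=> sa st tb; case: oe => _ _ _ h2; case: cl => _ h3.
have p0 : 0 <= p s t ^+ 2 by rewrite exprn_ge0// powd_ge0.
have ccD : D * rho * p s t ^+ 2 <= cc * rho * D * p s t ^+ 2.
  rewrite ler_wpM2r// -mulrA [rho * D]mulrC; rewrite ler_peMl ?cc1//.
  by rewrite mulr_ge0.
apply: prod_norm_le; apply: le_trans ccD => /=.
  by apply: le_trans (h3 s t sa st tb) _; rewrite -!mulrA ler_wpM2r// mulr_ge0.
apply: le_trans (h2 s t _ st _) _; [wlra|wlra|].
by rewrite ler_wpM2r//; apply: le_trans eD _; rewrite ler_peMr// rho1.
Qed.

Let incr_cc s t : a <= s -> s <= t -> t <= b -> `|incr_pair s t| <= cc * p s t.
Proof.
move=> sa st tb; apply: le_trans (incr_pair_le sa st tb) _.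
by rewrite ler_wpM2r ?powd_ge0// c_le_cc.
Qed.

Let rest_cc s t (x : R) : a <= s -> s <= t -> t <= b ->
  x <= c * rho * p s t ^+ 2 -> x <= cc * rho * p s t ^+ 2.
Proof.
move=> sa st tb /le_trans; apply.
by rewrite ler_wpM2r ?exprn_ge0 ?powd_ge0// ler_wpM2r// c_le_cc.
Qed.

Lemma close_defect s u t : a <= s -> s <= u -> u <= t -> t <= b ->
  `|(germ Z1 L1 s t - germ Z1 L1 s u - germ Z1 L1 u t)
    - (germ Z2 L2 s t - germ Z2 L2 s u - germ Z2 L2 u t)|
  <= 30 * cc ^+ 8 * rho * D * p s t ^+ 3.
Proof.
move=> sa su ut tb.
have s0 : 0 <= s := le_trans a0 sa.
have tr : t <= r := le_trans tb br.
have ub : u <= b := le_trans ut tb.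
have ua : a <= u := le_trans sa su.
have u0 : 0 <= u := le_trans a0 ua.
have sb : s <= b := le_trans su ub.
have st : s <= t := le_trans su ut.
rewrite !germ_defectE// -opprD normrN.
have psu : p s u <= p s t by apply: powd_le; wlra.
have put : p u t <= p s t by apply: powd_le; wlra.
have put2 : p u t ^+ 2 <= p s t ^+ 2 by rewrite lerXn2r// nnegrE powd_ge0.
have psu2 : p s u ^+ 2 <= p s t ^+ 2 by rewrite lerXn2r// nnegrE powd_ge0.
have p0 := powd_ge0 s t.
apply: germ_diff_defect_le.
- by apply: C3_bound_le (rs_C3 RS) _; exact: c_le_cc.
- exact: cc1.
- exact: le_trans (rs_d RS) c_le_cc.
- exact: p0.
- exact: rho1.
- exact: rho_powd.
- exact: D0.
- by move=> w; apply: (lift_Lcc b1 o1).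
- by move=> w; apply: (lift_Lcc b1 o1).
- move=> w; apply: le_trans (lift_dL b1 o1 w sa su ub) _.
  by rewrite ler_wpM2r// ler_wpM2l.
- by move=> w; apply: (lift_Lcc b2 o2).
- by apply: le_trans (incr_cc sa su ub) _; rewrite ler_wpM2l.
- apply: le_trans (rs_X RS u0 ut tr) _.
  by apply: le_trans (ler_wpM2l c0 put) _; exact: ccX.
- apply: le_trans (rs_XX RS u0 ut tr) _.
  by apply: le_trans (ler_wpM2l c0 put2) _; apply/ccX/exprn_ge0.
- apply: le_trans (rs_YX RS u0 ut tr) _.
  by apply: le_trans (ler_wpM2l c0 put2) _; apply/ccX/exprn_ge0.
- apply: le_trans (rest_cc sa su ub (lift_rest b1 o1 sa su ub)) _.
  by rewrite ler_wpM2l// mulr_ge0.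
- apply: le_trans (rest_cc sa su ub (lift_rest b2 o2 sa su ub)) _.
  by rewrite ler_wpM2l// mulr_ge0.
- exact: close_Z.
- by move=> w; exact: close_L.
- by move=> w; exact: close_L.
- move=> w; apply: le_trans (close_dL w sa su ub) _.
  by rewrite ler_wpM2r// ler_wpM2l// !mulr_ge0.
- apply: le_trans (close_rest sa su ub) _.
  by rewrite ler_wpM2l// !mulr_ge0.
Qed.

Lemma close_tensor s t : a <= s -> s <= t -> t <= b ->
  `|tensor_pair (fun w => dG (Z1 s) (L1 s w)) (XX s t) (YX s t)
    - tensor_pair (fun w => dG (Z2 s) (L2 s w)) (XX s t) (YX s t)|
  <= 4 * cc ^+ 6 * D * p s t ^+ 2.
Proof.
move=> sa st tb.
have s0 : 0 <= s := le_trans a0 sa.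
have tr : t <= r := le_trans tb br.
have sb : s <= b := le_trans st tb.
have p2 : 0 <= p s t ^+ 2 by rewrite exprn_ge0// powd_ge0.
apply: germ_diff_tensor_le.
- by apply: C3_bound_le (rs_C3 RS) _; exact: c_le_cc.
- exact: cc1.
- exact: le_trans (rs_d RS) c_le_cc.
- exact: powd_ge0.
- exact: rho1.
- exact: D0.
- by move=> w; apply: (lift_Lcc b1 o1).
- by apply: le_trans (rs_XX RS s0 st tr) _; exact: ccX.
- by apply: le_trans (rs_YX RS s0 st tr) _; exact: ccX.
- exact: close_Z.
- by move=> w; exact: close_L.
Qed.

Lemma close_dG s t : a <= s -> s <= t -> t <= b ->
  `|(G (Z1 t) - G (Z1 s)) - (G (Z2 t) - G (Z2 s))| <= 4 * cc ^+ 5 * D * p s t.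
Proof.
move=> sa st tb.
have sb : s <= b := le_trans st tb.
have p0 := powd_ge0 s t.
have e1 : Z1 t = Z1 s + (Z1 t - Z1 s) by zmod.
have e2 : Z2 t = Z2 s + (Z2 t - Z2 s) by zmod.
rewrite {1}e1 {1}e2.
apply: (@germ_diff_dG_le _ _ _ _ _ dG cc (p s t) rho _ _ _ _ _ D (Z1 s) _ (Z2 s) _
  (L1 s) (L2 s) (incr_pair s t)).
- by apply: C3_bound_le (rs_C3 RS) _; exact: c_le_cc.
- exact: cc1.
- exact: p0.
- exact: rho1.
- exact: rho_powd.
- exact: D0.
- by move=> w; apply: (lift_Lcc b1 o1).
- exact: incr_cc.
- exact: rest_cc (lift_rest b1 o1 sa st tb).
- exact: close_Z.
- by move=> w; exact: close_L.
- exact: close_rest.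
Qed.

Variables (z1 z2 : R -> 'cV[R]_n).
Hypotheses (hy1 : holder_path beta r b y1) (hy2 : holder_path beta r b y2).
Hypotheses (s1 : step_of eta1 eta1' y1 y1' z1) (s2 : step_of eta2 eta2' y2 y2' z2).

(** The two Davie remainders are separately bounded without any factor [D]. The defect of their
    difference carries this factor, and [three_halves_bound] transfers it to the difference
    itself. *)
Lemma close_remainder s t : a <= s -> s <= t -> t <= b ->
  `|(z1 t - z1 s - Dr y1 s t - germ Z1 L1 s t)
    - (z2 t - z2 s - Dr y2 s t - germ Z2 L2 s t)|
  <= sewing_const (3 * beta) * (30 * cc ^+ 8 * rho * D) * p s t ^+ 3.
Proof.
apply: (@three_halves_bound (fun s t =>
    (z1 t - z1 s - Dr y1 s t - germ Z1 L1 s t)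
    - (z2 t - z2 s - Dr y2 s t - germ Z2 L2 s t)) a b _ (2 * (K1 * rho))).
- by rewrite !mulr_ge0// exprn_ge0.
- move=> {}s u {}t sa su ut tb.
  have s0 : 0 <= s := le_trans a0 sa.
  rewrite (rs_drift_add RS hy1 s0 su ut tb) (rs_drift_add RS hy2 s0 su ut tb).
  apply: le_trans (close_defect sa su ut tb); rewrite -normrN.
  by rewrite le_eqVlt; apply/orP; left; apply/eqP; congr (`|_|); zmod.
- move=> {}s {}t sa st tb; apply: le_trans (ler_normB _ _) _.
  by apply: le_trans (lerD (s1 sa st tb) (s2 sa st tb)) _; lra.
Qed.

(** After [rho * p <= 1] the contributions to the new increments carry [D] but no [rho]. Measured in
    units of [rho] they shrink, and [8 * cc ^+ 5 <= rho] and [2 * K2 <= rho] make the factor one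
    half. *)
Lemma step_diff : path_close ((e + delta) / 2) z1 z2
  (fun t => G (y1 t, eta1 t)) (fun t => G (y2 t, eta2 t)).
Proof.
have K5 : 8 * cc ^+ 5 <= rho.
  apply: le_trans rhoK; rewrite /Kst.
  have := K1_ge0; have := K2_ge; have := ler_weXn2l cc1 (isT : 5 <= 6)%N.
  have := exprn_ge0 5 cc0; lra.
have K20 : 2 * K2 <= rho.
  apply: le_trans rhoK; rewrite /Kst.
  have := K1_ge0; have := exprn_ge0 5 cc0; lra.
split=> s t sa st tb.
  apply: le_trans (close_dG sa st tb) _.
  have := ler_wpM2r (mulr_ge0 D0 (powd_ge0 s t)) K5; rewrite -/D; lra.
have s0 : 0 <= s := le_trans a0 sa.
have p0 := powd_ge0 s t.
have p2 : 0 <= p s t ^+ 2 by rewrite exprn_ge0.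
have cD0 : 0 <= c * (3 * c ^+ 2 * D) by rewrite !mulr_ge0// exprn_ge0.
rewrite (_ : _ - _ =
  ((z1 t - z1 s - Dr y1 s t - germ Z1 L1 s t)
    - (z2 t - z2 s - Dr y2 s t - germ Z2 L2 s t))
  + (Dr y1 s t - Dr y2 s t)
  + (tensor_pair (fun w => dG (Z1 s) (L1 s w)) (XX s t) (YX s t)
    - tensor_pair (fun w => dG (Z2 s) (L2 s w)) (XX s t) (YX s t))); last first.
  by rewrite /germ /Z1 /Z2; zmod.
apply: le_trans (ler_normD _ _) _; apply: le_trans (lerD (ler_normD _ _) (lexx _)) _.
apply: le_trans (lerD (lerD (close_remainder sa st tb)
  (rs_drift_diff RS hy1 hy2 close_sup s0 st tb)) (close_tensor sa st tb)) _.
have ts1 : c * (3 * c ^+ 2 * D) * (t - s) <= c * (3 * c ^+ 2 * D) * p s t ^+ 2.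
  rewrite ler_wpM2l// powd2.
  have bh : 2 * beta <= 1 by have := rs_beta_lt RS; lra.
  have ts0 : 0 <= t - s by rewrite subr_ge0.
  have ts01 : t - s <= 1 by wlra.
  have [->|/eqP tsn] := eqVneq (t - s) 0; first by rewrite powR_ge0.
  rewrite -{1}[t - s]powRr1//; apply: ger_powR => //.
  by rewrite ts01 andbT lt0r ts0 andbT; apply/eqP.
have h3 : rho * p s t ^+ 3 <= p s t ^+ 2.
  by rewrite exprS mulrA ler_piMl// rho_powd.
have KS0 : 0 <= sewing_const (3 * beta) * (30 * cc ^+ 8) * D.
  apply: mulr_ge0 => //; apply: mulr_ge0.
    by apply: le_trans (sewing_const_ge1 th1).
  by rewrite mulr_ge0// exprn_ge0.
have h4 := ler_wpM2l KS0 h3.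
have h5 := ler_wpM2r (mulr_ge0 D0 p2) K20.
move: h5; rewrite {1}/K2 -/D; lra.
Qed.

End lift_diff.

(** Picard iteration with pointwise limits: the derivative of the limit is [G] along it, and
    membership in the ball and Davie's estimate follow from those of the iterates up to an error
    [2^-1 ^+ k]. *)
Lemma local_existence eta eta' y0 K : delay_ok eta eta' -> holder_path beta r a y0 ->
  (forall t, - r <= t -> t <= a -> `|y0 t| <= K) ->
  c ^+ 3 + 1 <= K -> 4 * c * K * h `^ (1 - beta) <= 1 ->
  exists y, [/\ forall t, t <= a -> y t = y0 t,
    in_ball a b rho y (fun t => G (y t, eta t)) &
    step_of eta eta' y (fun t => G (y t, eta t)) y].
Proof.
move=> eo hy0 y0K cK hK.
have r0 := rs_r RS.
have p_ge0 := powd_ge0.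
(* The history and the derivative at [a] are fixed, so two iterates have data at distance 0 and
   [step_diff] halves their distance exactly. *)
pose inv (yy : (R -> 'cV[R]_n) * (R -> 'M[R]_(n, d))) :=
  [/\ forall t, t <= a -> yy.1 t = y0 t, in_ball a b rho yy.1 yy.2 &
      yy.2 a = G (y0 a, eta a)].
have inv_hol yy : inv yy -> holder_path beta r b yy.1.
  move=> [ye yb _]; apply: in_ball_holder yb.
  case: hy0 => C hC; exists C => s t rs st ta.
  by rewrite !ye//; [exact: hC|exact: le_trans ta].
(* The increment over a window is at most [c ^+ 3 + 1], hence at most [K]. The resulting [2 * K]
   explains the 4 in the condition on [h], where [step_ball] has a 2. *)
have inv_sup yy : inv yy -> forall t, - r <= t -> t <= b -> `|yy.1 t| <= 2 * K.
  move=> [ye yb _] t rt tb.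
  have K0 : 0 <= K by apply: le_trans cK; rewrite addr_ge0 ?exprn_ge0.
  case: (leP t a) => ta.
    by rewrite ye//; apply: le_trans (y0K t rt ta) _; lra.
  rewrite (_ : yy.1 t = yy.1 a + (yy.1 t - yy.1 a)); last by zmod.
  apply: le_trans (ler_normD _ _) _.
  have h1' : `|yy.1 a| <= K by rewrite ye//; apply: y0K => //; wlra.
  have h2' := in_ball_dy yb (lexx a) (ltW ta) tb.
  have h3' : (c ^+ 3 + 1) * p a t <= (c ^+ 3 + 1) * 1.
    apply: ler_wpM2l; first by rewrite addr_ge0 ?exprn_ge0.
    exact: powd_le1 (lexx a) (ltW ta) tb.
  lra.
have /choice [F hF] : forall yy : (R -> 'cV[R]_n) * (R -> 'M[R]_(n, d)), exists z,
    inv yy -> (forall t, t <= a -> z t = yy.1 t) /\ step_of eta eta' yy.1 yy.2 z.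
  move=> yy; case: (pselect (inv yy)) => [iy|ni]; last by exists y0.
  have [_ yb _] := iy; have [z hz] := step_exists eo (inv_hol _ iy) yb.
  by exists z.
pose nxt yy := (F yy, fun t => G (yy.1 t, eta t)).
(* The first order expansion at [a]: its derivative is constant and its remainder on the window is
   zero. *)
pose start : (R -> 'cV[R]_n) * (R -> 'M[R]_(n, d)) :=
  (fun t => if t <= a then y0 t else y0 a + G (y0 a, eta a) *m (X t - X a),
   fun t => G (y0 a, eta a)).
pose it k := iter k nxt start.
have inv_next yy : inv yy -> inv (nxt yy).
  move=> iy; have [ye yb ya] := iy; have [Fe Fs] := hF _ iy.
  split => [t ta||]; rewrite /nxt /=.
  - by rewrite Fe// ye.
  - apply: (step_ball eo (inv_hol _ iy) yb Fs (inv_sup _ iy)).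
    by apply: le_trans hK; lra.
  - by rewrite ye.
have inv_it k : inv (it k).
  elim: k => [|k IH]; last exact: inv_next.
  split => //=; first by move=> t ->.
  have stE t : a <= t -> (if t <= a then y0 t else y0 a + G (y0 a, eta a) *m (X t - X a))
      = y0 a + G (y0 a, eta a) *m (X t - X a).
    case: (leP t a) => // ta at_; have -> : t = a by apply/le_anti; rewrite ta at_.
    by rewrite subrr mulmx0 addr0.
  split=> [t _ _|s t _ _ _|s t sa st tb].
  - exact: C3_bound0 (rs_C3 RS) _.
  - by rewrite subrr normr0 mulr_ge0// /ball_lip mulr_ge0// exprn_ge0.
  - rewrite !stE//; last exact: le_trans st.
    rewrite (_ : _ - _ - _ = 0); last by rewrite !mulmxBr; zmod.
    by rewrite normr0 mulr_ge0 ?exprn_ge0.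
have it_inv0 k : (it k).2 a = G (y0 a, eta a) by have [] := inv_it k.
have cl0 : delay_close 0 eta eta eta' eta'.
  by split=> *; rewrite subrr normr0// mul0r.
(* An upper bound for the distance of any two elements of the ball, in units of [rho], for the
   derivatives and for the remainders. *)
pose d0 := 2 * ball_lip.
have bl1 : 1 <= ball_lip.
  by rewrite /ball_lip; have := exprn_ege1 5 c1; lra.
pose dk k : R := 2^-1 ^+ k * d0.
have dk0 k : 0 <= dk k.
  by rewrite /dk /d0 mulr_ge0 ?exprn_ge0 ?invr_ge0// mulr_ge0// (le_trans _ bl1).
have it_close k : path_close (dk k) (it k).1 (it k.+1).1 (it k).2 (it k.+1).2.
  elim: k => [|k IH].
    have [_ [_ b1 b2] _] := inv_it 0%N; have [_ [_ b3 b4] _] := inv_it 1%N.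
    split=> s t sa st tb; apply: le_trans (ler_normB _ _) _.
      apply: le_trans (lerD (b1 s t sa st tb) (b3 s t sa st tb)) _.
      rewrite /dk expr0 mul1r -mulrDl ler_wpM2r// /d0.
      have : 2 * ball_lip * 1 <= 2 * ball_lip * rho.
        by rewrite ler_wpM2l ?rho1//; rewrite mulr_ge0// (le_trans _ bl1).
      lra.
    apply: le_trans (lerD (b2 s t sa st tb) (b4 s t sa st tb)) _.
    rewrite /dk expr0 mul1r -mulrDl ler_wpM2r ?exprn_ge0// /d0.
    have := ler_wpM2r rho0 bl1; lra.
  have [e1 b1 _] := inv_it k; have [e2 b2 _] := inv_it k.+1.
  have [Fe1 s1] := hF _ (inv_it k); have [Fe2 s2] := hF _ (inv_it k.+1).
  have := @step_diff 0 (dk k) (it k).1 (it k.+1).1 eta eta (it k).2 (it k.+1).2 eta' eta'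
    (lexx 0) (dk0 k) b1 b2 eo eo cl0.
  rewrite add0r (_ : dk k / 2 = dk k.+1); last by rewrite /dk exprS; ring.
  move=> /(_ _ _ IH _ _ (inv_hol _ (inv_it k)) (inv_hol _ (inv_it k.+1)) s1 s2); apply.
    by move=> t _ ta; rewrite e1// e2// subrr normr0.
  by rewrite !it_inv0 subrr normr0.
have it_step k t : - r <= t -> t <= b ->
    `|(it k.+1).1 t - (it k).1 t| <= 3 * c ^+ 2 * d0 * 2^-1 ^+ k.
  move=> rt tb; have [e1 b1 _] := inv_it k; have [e2 b2 _] := inv_it k.+1.
  have := @close_sup 0 (dk k) (it k).1 (it k.+1).1 (it k).2 (it k.+1).2
    (lexx 0) (dk0 k).
  move=> H; rewrite distrC; apply: le_trans (H _ _ (it_close k) t rt tb) _.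
  - by move=> u _ ua; rewrite e1// e2// subrr normr0.
  - by rewrite !it_inv0 subrr normr0.
  - by rewrite add0r /dk; lra.
have half01 : 0 <= (2^-1 : R) < 1 by apply/andP; split; lra.
have /choice [L hL] : forall t, exists L, - r <= t -> t <= b -> forall k,
    `|L - (it k).1 t| <= 3 * c ^+ 2 * d0 * 2^-1 ^+ k / (1 - 2^-1).
  move=> t; case: (boolP (- r <= t <= b)) => [/andP[rt tb]|nt].
    have [L hL] := geometric_limit half01 (fun k => it_step k t rt tb).
    by exists L.
  by exists 0 => rt tb; exfalso; move: nt; rewrite rt tb.
pose y t := if t <= a then y0 t else L t.
pose M0 := 6 * c ^+ 2 * d0.
pose ek k : R := 2^-1 ^+ k * M0.
have ek0 k : 0 <= ek k.
  by rewrite /ek /M0 /d0 !mulr_ge0 ?exprn_ge0// (le_trans _ bl1).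
have ekS k : ek k.+1 = ek k / 2 by rewrite /ek exprS; ring.
have y_it k t : - r <= t -> t <= b -> `|y t - (it k).1 t| <= ek k.
  move=> rt tb; rewrite /y; case: (leP t a) => ta.
    by have [-> // _ _] := inv_it k; rewrite subrr normr0.
  apply: le_trans (hL t rt tb k) _; rewrite /ek /M0.
  rewrite (_ : (1 - 2^-1)^-1 = 2); first by lra.
  by field.
(* The derivative of the iterate [k.+1] is [G] along the iterate [k], whence the shift of the
   index. *)
have y'_it k t : - r <= t -> t <= b ->
    `|G (y t, eta t) - (it k.+1).2 t| <= c * ek k.
  move=> rt tb; rewrite /=.
  have := C3_lip0 (rs_C3 RS) ((it k).1 t, eta t) (y t - (it k).1 t, 0).
  rewrite (_ : _ + _ = (y t, eta t)); last first.
    by congr pair; rewrite /= ?addr0//; zmod.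
  move=> /le_trans; apply; rewrite ler_wpM2l//; apply: prod_norm_le => /=.
    exact: y_it.
  by rewrite normr0.
have ra s : a <= s -> - r <= s by move=> sa; wlra.
have eS k : ek k.+1 <= ek k by have := ek0 k; rewrite ekS; lra.
have y_ball : in_ball a b rho y (fun t => G (y t, eta t)).
  split=> [t _ _|s t sa st tb|s t sa st tb].
  - exact: C3_bound0 (rs_C3 RS) _.
  - apply: (@le_geometric_error _ _ _ (2 * c * M0) 2^-1 half01) => k.
    have [_ [_ b1 _] _] := inv_it k.+1.
    rewrite (_ : _ - _ = ((it k.+1).2 t - (it k.+1).2 s) +
      (G (y t, eta t) - (it k.+1).2 t) - (G (y s, eta s) - (it k.+1).2 s)); last by zmod.
    apply: le_trans (ler_normB _ _) _; apply: le_trans (lerD (ler_normD _ _) (lexx _)) _.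
    apply: le_trans (lerD (lerD (b1 s t sa st tb) (y'_it k t _ tb)) (y'_it k s _ _)) _.
    - by apply: ra; apply: le_trans st.
    - exact: ra.
    - exact: le_trans tb.
    - by rewrite /ek; lra.
  - apply: (@le_geometric_error _ _ _ (2 * M0 + c ^+ 3 * M0 * p s t) 2^-1 half01) => k.
    have [_ [_ _ b1] _] := inv_it k.+1.
    rewrite (_ : _ - _ = ((it k.+1).1 t - (it k.+1).1 s - (it k.+1).2 s *m (X t - X s)) +
      (y t - (it k.+1).1 t) - (y s - (it k.+1).1 s) -
      (G (y s, eta s) - (it k.+1).2 s) *m (X t - X s)); last first.
      by rewrite mulmxBl; zmod.
    apply: le_trans (ler_normB _ _) _; apply: le_trans (lerD (ler_normB _ _) (lexx _)) _.
    apply: le_trans (lerD (lerD (ler_normD _ _) (lexx _)) (lexx _)) _.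
    have rs : - r <= s by exact: ra.
    have rt : - r <= t by exact: le_trans st.
    have sb : s <= b by exact: le_trans tb.
    have s0 : 0 <= s by exact: le_trans sa.
    have tr : t <= r by exact: le_trans br.
    apply: le_trans (lerD (lerD (lerD (b1 s t sa st tb)
      (le_trans (y_it k.+1 t rt tb) (eS k))) (le_trans (y_it k.+1 s rs sb) (eS k)))
      (mulmx_le (y'_it k s rs sb) (rs_X RS s0 st tr))) _.
    by rewrite /ek; lra.
have y_hol : holder_path beta r b y.
  apply: in_ball_holder y_ball; case: hy0 => C hC; exists C => s t rs st ta.
  by rewrite /y ta (le_trans st ta); exact: hC.
exists y; split=> //; first by move=> t ta; rewrite /y ta.
move=> s t sa st tb.
have rs : - r <= s by exact: ra.
have rt : - r <= t by exact: le_trans st.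
have sb : s <= b by exact: le_trans tb.
have s0 : 0 <= s by exact: le_trans sa.
have tr : t <= r by exact: le_trans br.
apply: (@le_geometric_error _ _ _
  (M0 * (2 + c * (t - s) + c ^+ 3 * p s t + 4 * cc ^+ 6 * p s t ^+ 2)) 2^-1 half01) => k.
have [e1 b1 _] := inv_it k.+1.
have [Fe1 s1] := hF _ (inv_it k.+1).
have {}s1 := s1 s t sa st tb.
have hD := rs_drift_diff RS y_hol (inv_hol _ (inv_it k.+1)) (y_it k.+1) s0 st tb.
pose Z1 t : E := (y t, eta t).
pose Z2 t : E := ((it k.+1).1 t, eta t).
pose L1 := lin_pair (fun t => G (y t, eta t)) eta'.
pose L2 := lin_pair (it k.+1).2 eta'.
have ccc (x : R) : 0 <= x -> c * x <= cc * x by move=> x0; rewrite ler_wpM2r// c_le_cc.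
have ZZ : `|Z1 s - Z2 s| <= ek k.
  apply: prod_norm_le => /=; first by apply: le_trans (y_it k.+1 s rs sb) (eS k).
  by rewrite subrr normr0.
have hT : `|tensor_pair (fun w => dG (Z1 s) (L1 s w)) (XX s t) (YX s t)
    - tensor_pair (fun w => dG (Z2 s) (L2 s w)) (XX s t) (YX s t)|
    <= 4 * cc ^+ 6 * ek k * p s t ^+ 2.
  apply: (@germ_diff_tensor_le _ _ _ _ _ _ cc _ rho).
  - by apply: C3_bound_le (rs_C3 RS) _; exact: c_le_cc.
  - exact: cc1.
  - exact: le_trans (rs_d RS) c_le_cc.
  - exact: p_ge0.
  - exact: rho1.
  - exact: ek0.
  - by move=> w; apply: (lift_Lcc y_ball eo).
  - by apply: le_trans (rs_XX RS s0 st tr) _; apply/ccc/exprn_ge0.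
  - by apply: le_trans (rs_YX RS s0 st tr) _; apply/ccc/exprn_ge0.
  - by apply: le_trans ZZ _; rewrite ler_peMl// cc1.
  - move=> w; rewrite /L1 /L2 /lin_pair.
    have h3 : c * (c * ek k) * `|w| <= cc * ek k * `|w|.
      rewrite ler_wpM2r// mulrA ler_wpM2r// /cc.
      by have := ler_weXn2l c1 (isT : 2 <= 6)%N; have := exprn_ge0 6 c0; wlra.
    apply: prod_norm_le; rewrite /= -mulmxBl; apply: le_trans h3.
      by apply: mulmx_le; [exact: y'_it|exact: prod_norm_fst].
    by rewrite subrr mul0mx normr0 !mulr_ge0.
have hG : `|(G (Z1 s) - G (Z2 s)) *m (X t - X s)| <= c * (c * ek k) * (c * p s t).
  apply: mulmx_le (rs_X RS s0 st tr).
  have := C3_lip0 (rs_C3 RS) (Z2 s) (Z1 s - Z2 s).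
  rewrite (_ : Z2 s + (Z1 s - Z2 s) = Z1 s); last by zmod.
  by move=> /le_trans; apply; rewrite ler_wpM2l.
(* [F (it k.+1)] is the path of the iterate [k.+2]. The first bracket satisfies the estimate to be
   proved; all others are of order [ek k]. *)
rewrite (_ : _ - _ = (F (it k.+1) t - F (it k.+1) s - Dr (it k.+1).1 s t - germ Z2 L2 s t)
  + (y t - (it k.+2).1 t) - (y s - (it k.+2).1 s) - (Dr y s t - Dr (it k.+1).1 s t)
  - (G (Z1 s) - G (Z2 s)) *m (X t - X s)
  - (tensor_pair (fun w => dG (Z1 s) (L1 s w)) (XX s t) (YX s t)
    - tensor_pair (fun w => dG (Z2 s) (L2 s w)) (XX s t) (YX s t))); last first.
  by rewrite /germ mulmxBl /Z1 /Z2 /=; zmod.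
apply: le_trans (ler_normB _ _) _; apply: le_trans (lerD (ler_normB _ _) (lexx _)) _.
apply: le_trans (lerD (lerD (ler_normB _ _) (lexx _)) (lexx _)) _.
apply: le_trans (lerD (lerD (lerD (ler_normB _ _) (lexx _)) (lexx _)) (lexx _)) _.
apply: le_trans (lerD (lerD (lerD (lerD (ler_normD _ _) (lexx _)) (lexx _)) (lexx _)) (lexx _)) _.
have ts0 : 0 <= t - s by rewrite subr_ge0.
have eSS u : - r <= u -> u <= b -> `|y u - (it k.+2).1 u| <= ek k.
  by move=> ru ub; apply: le_trans (y_it k.+2 u ru ub) _; exact: le_trans (eS _) (eS _).
have hD' : c * ek k.+1 * (t - s) <= c * ek k * (t - s).
  by rewrite ler_wpM2r// ler_wpM2l.
apply: le_trans (lerD (lerD (lerD (lerD (lerD s1 (eSS t rt tb)) (eSS s rs sb))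
  (le_trans hD hD')) hG) hT) _.
by rewrite /ek; lra.
Qed.

End window.

End setting.

(** * Solutions on one delay interval *)

Section solutions.
Context {R : realType} {n d : nat} {beta r : R}.
Context {X Y : R -> 'cV[R]_d} {XX YX : R -> R -> 'M[R]_d}.
Context {G : 'cV[R]_n * 'cV[R]_n -> 'M[R]_(n, d)}.
Context {dG : 'cV[R]_n * 'cV[R]_n -> 'cV[R]_n * 'cV[R]_n -> 'M[R]_(n, d)}.
Context {Dr : (R -> 'cV[R]_n) -> R -> R -> 'cV[R]_n} {c : R}.
Hypothesis RS : rough_setting beta r X Y XX YX G dG Dr c.
Local Notation E := ('cV[R]_n * 'cV[R]_n)%type.
Local Notation p := (powd beta).
Local Notation in_ball := (@in_ball R n d beta X c).
Local Notation delay_ok := (@delay_ok R n d beta r Y c).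
Local Notation delay_close := (@delay_close R n d beta r Y).
Local Notation path_close := (@path_close R n d beta X).
Local Notation step_of := (@step_of R n d beta X XX YX G dG Dr c).
Local Notation Kst := (@Kst R beta c).
Local Notation cc := (@cc R c).
Implicit Types (s t u a b h e : R).

Let c1 : 1 <= c := rs_c RS.
Let c0 : 0 <= c. Proof. exact: le_trans c1. Qed.
Let r0 : 0 < r := rs_r RS.
Let beta0 : 0 < beta.
Proof. by apply: lt_trans (rs_beta_gt RS); rewrite invr_gt0. Qed.
Ltac slra := move: (c1) (c0) (r0) => ? ? ?; lra.

Definition deriv_path eta y : R -> 'M[R]_(n, d) := fun t => G (y t, eta t).

Definition remainder_path eta y s t : 'cV[R]_n :=
  y t - y s - deriv_path eta y s *m (X t - X s).

Definition germ_path eta eta' y : R -> R -> 'cV[R]_n :=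
  @germ R n d X XX YX G dG (fun t => (y t, eta t)) (lin_pair (deriv_path eta y) eta').

Definition davie_path eta eta' y s t : 'cV[R]_n :=
  y t - y s - Dr y s t - germ_path eta eta' y s t.

Lemma rate_of_radius (q : R) : 1 <= q ->
  exists h, [/\ 0 < h, h <= 1 & (h `^ beta)^-1 = q].
Proof.
move=> q1; have q0 : 0 < q by apply: lt_le_trans q1.
exists (q `^ (- beta^-1)); split; first exact: powR_gt0.
  rewrite -(powRr0 q); apply: ler_powR => //.
  by rewrite oppr_le0 invr_ge0 ltW.
rewrite -powRrM mulNr mulVf ?(lt0r_neq0 beta0)// powRN powRr1 ?ltW//.
by rewrite invrK.
Qed.

Lemma delay_dy eta eta' s t : delay_ok eta eta' -> 0 <= s -> s <= t -> t <= r ->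
  `|eta t - eta s| <= (c ^+ 3 + c * p s t) * p s t.
Proof.
case=> h1 _ h3 s0 st tr.
rewrite (_ : eta t - eta s = eta' s *m (Y t - Y s) + (eta t - eta s - eta' s *m (Y t - Y s))); last by zmod.
apply: le_trans (ler_normD _ _) _.
apply: le_trans (lerD (norm_mulmx_le (rs_d RS) (h1 s s0 (le_trans st tr))
  (rs_Y RS s0 st tr)) (h3 s t s0 st tr)) _.
by lra.
Qed.

Lemma deriv_dy eta y s t (k l : R) :
  `|y t - y s| <= k * p s t -> `|eta t - eta s| <= l * p s t -> k <= l ->
  `|deriv_path eta y t - deriv_path eta y s| <= c * l * p s t.
Proof.
move=> yk el kl; have := C3_lip0 (rs_C3 RS) (y s, eta s) (y t - y s, eta t - eta s).
rewrite (_ : _ + _ = (y t, eta t)); last by congr pair => /=; zmod.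
move=> /le_trans; apply; rewrite -mulrA ler_wpM2l//; apply: prod_norm_le => //=.
by apply: le_trans yk _; rewrite ler_wpM2r// powd_ge0.
Qed.

Section window.
Variables (a b h : R).
Hypotheses (a0 : 0 <= a) (ab : a <= b) (br : b <= r).
Hypotheses (bah : b - a <= h) (h0 : 0 < h) (h1 : h <= 1).
Let rho := (h `^ beta)^-1.
Hypothesis rhoK : Kst <= rho.

(** For the derivative [G (y, eta)] a bound on the remainder is enough: the sup bound is that of
    [G], and the Lipschitz bound follows from the increments of [y] and [eta]. *)
Lemma remainder_in_ball eta eta' y : delay_ok eta eta' ->
  (forall s t, a <= s -> s <= t -> t <= b ->
    `|remainder_path eta y s t| <= rho * p s t ^+ 2) ->
  in_ball a b rho y (deriv_path eta y).
Proof.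
move=> eo hR; split=> //; first by move=> t _ _; exact: C3_bound0 (rs_C3 RS) _.
move=> s t sa st tb.
have s0 : 0 <= s := le_trans a0 sa.
have tr : t <= r := le_trans tb br.
have p0 := powd_ge0 (beta := beta) s t.
have pp1 : p s t <= 1 by exact: (powd_le1 RS a0 ab br bah h0 h1 rhoK).
have c31 : c <= c ^+ 3 by exact: (c_le_cX RS).
have h2 := delay_dy eo s0 st tr.
have h3 : `|y t - y s| <= (c ^+ 3 + 1) * p s t.
  rewrite (_ : y t - y s = deriv_path eta y s *m (X t - X s) + remainder_path eta y s t); last first.
    by rewrite /remainder_path; zmod.
  apply: le_trans (ler_normD _ _) _.
  apply: le_trans (lerD (norm_mulmx_le (rs_d RS) (C3_bound0 (rs_C3 RS) _)
    (rs_X RS s0 st tr)) (hR s t sa st tb)) _.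
  rewrite mulrDl; apply: lerD; first by lra.
  by rewrite expr2 mulrA ler_wpM2r//; apply: (rho_powd RS a0 ab br bah h0 h1).
apply: le_trans (deriv_dy (l := 2 * c ^+ 3) h3 _ _) _.
- apply: le_trans h2 _; rewrite ler_wpM2r//.
  have : c * p s t <= c * 1 by rewrite ler_wpM2l.
  by lra.
- by have := exprn_ege1 3 c1; lra.
- rewrite ler_wpM2r// /ball_lip.
  have : c ^+ 4 <= c ^+ 5 by apply: ler_weXn2l.
  by lra.
Qed.

(** A solution is its own Picard image, with the standard constant in place of the arbitrary [C]:
    the defect of its Davie remainder is that of the germ, which the ball controls. *)
Lemma solution_step eta eta' y C : delay_ok eta eta' -> holder_path beta r b y ->
  in_ball a b rho y (deriv_path eta y) ->
  (forall s t, a <= s -> s <= t -> t <= b ->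
    `|davie_path eta eta' y s t| <= C * p s t ^+ 3) ->
  step_of a b h eta eta' y (deriv_path eta y) y.
Proof.
move=> eo hy yb hC s t sa st tb.
have cc0 : 0 <= cc by apply: le_trans (cc1 RS).
have rho0 : 0 <= rho by rewrite invr_ge0 powR_ge0.
rewrite /K1 -/rho -[X in X * _]mulrA.
apply: (three_halves_bound RS _ _ hC) => //.
  by rewrite !mulr_ge0// exprn_ge0.
move=> {sa st tb s t}s u t sa su ut tb.
have s0 : 0 <= s := le_trans a0 sa.
rewrite /davie_path (rs_drift_add RS hy s0 su ut tb).
apply: le_trans (lift_defect RS a0 ab br bah h0 h1 rhoK yb eo sa su ut tb).
rewrite -normrN le_eqVlt; apply/orP; left; apply/eqP; congr (`|_|).
by rewrite /germ_path; zmod.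
Qed.

(** * Comparison of two solutions on one window *)

Section stability.
Variables (e C : R) (y1 y2 eta1 eta2 : R -> 'cV[R]_n) (eta1' eta2' : R -> 'M[R]_(n, d)).
Hypotheses (e0 : 0 <= e).
Hypotheses (o1 : delay_ok eta1 eta1') (o2 : delay_ok eta2 eta2').
Hypothesis oe : delay_close e eta1 eta2 eta1' eta2'.
Hypotheses (hy1 : holder_path beta r b y1) (hy2 : holder_path beta r b y2).
Hypotheses (b1 : in_ball a b rho y1 (deriv_path eta1 y1)).
Hypotheses (b2 : in_ball a b rho y2 (deriv_path eta2 y2)).
Hypothesis d1 : forall s t, a <= s -> s <= t -> t <= b ->
    `|davie_path eta1 eta1' y1 s t| <= C * p s t ^+ 3.
Hypothesis d2 : forall s t, a <= s -> s <= t -> t <= b ->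
    `|davie_path eta2 eta2' y2 s t| <= C * p s t ^+ 3.
Hypothesis he : forall t, - r <= t -> t <= a -> `|y1 t - y2 t| <= e.

Let ce : e <= c * e. Proof. by rewrite ler_peMl. Qed.
Let ce0 : 0 <= c * e. Proof. exact: mulr_ge0. Qed.

Let oce : delay_close (c * e) eta1 eta2 eta1' eta2'.
Proof.
case: oe => h2 h3 h4 h5; split.
- by move=> t t0 tr; apply: le_trans (h2 t t0 tr) _.
- by move=> t t0 tr; apply: le_trans (h3 t t0 tr) _.
- move=> s t s0 st tr; apply: le_trans (h4 s t s0 st tr) _.
  by rewrite ler_wpM2r// powd_ge0.
- move=> s t s0 st tr; apply: le_trans (h5 s t s0 st tr) _.
  by rewrite ler_wpM2r// exprn_ge0// powd_ge0.
Qed.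

Let he' t : - r <= t -> t <= a -> `|y1 t - y2 t| <= c * e.
Proof. by move=> rt ta; apply: le_trans (he rt ta) ce. Qed.

Let ra : - r <= a. Proof. by move: (a0); slra. Qed.

Let de : `|deriv_path eta1 y1 a - deriv_path eta2 y2 a| <= c * e.
Proof.
have := C3_lip0 (rs_C3 RS) (y2 a, eta2 a) (y1 a - y2 a, eta1 a - eta2 a).
rewrite (_ : _ + _ = (y1 a, eta1 a)); last by congr pair => /=; zmod.
move=> /le_trans; apply; rewrite ler_wpM2l//; apply: prod_norm_le => /=.
  by apply: he.
by case: oe => h2 _ _ _; apply: h2 => //; exact: le_trans br.
Qed.

(** Both solutions are their own Picard images, so [step_diff] may be iterated: a distance [delta]
    improves to [(c * e + delta) / 2]. Starting from the size of the ball, this converges to the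
    fixed point [c * e]. The data are at distance [c * e] rather than [e] because of the derivatives
    at [a]. *)
Lemma window_stability : path_close a b h (c * e) y1 y2
  (deriv_path eta1 y1) (deriv_path eta2 y2).
Proof.
pose d0 := 2 * @ball_lip R c.
have bl1 : 1 <= @ball_lip R c.
  by rewrite /ball_lip; have := exprn_ege1 5 c1; lra.
have rho1' : 1 <= rho := rho1 RS rhoK.
have rho0 : 0 <= rho by apply: le_trans rho1'.
have dk0 k : 0 <= c * e + 2^-1 ^+ k * d0.
  rewrite addr_ge0// mulr_ge0 ?exprn_ge0 ?invr_ge0// /d0 mulr_ge0//.
  exact: le_trans bl1.
have cl k : path_close a b h (c * e + 2^-1 ^+ k * d0) y1 y2
    (deriv_path eta1 y1) (deriv_path eta2 y2).
  elim: k => [|k IH].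
    case: b1 => _ b11 b12; case: b2 => _ b21 b22; rewrite expr0 mul1r.
    have h1' : d0 <= (c * e + d0) * rho.
      rewrite -[leLHS]mulr1; apply: ler_pM => //; last by rewrite lerDr.
      by rewrite /d0 mulr_ge0// (le_trans _ bl1).
    have h2' : 2 * rho <= (c * e + d0) * rho.
      by rewrite ler_wpM2r//; move: (ce0) => ?; rewrite /d0; lra.
    split=> s t sa st tb; apply: le_trans (ler_normB _ _) _.
      apply: le_trans (lerD (b11 s t sa st tb) (b21 s t sa st tb)) _.
      apply: le_trans (ler_wpM2r (powd_ge0 s t) h1'); rewrite /d0; lra.
    apply: le_trans (lerD (b12 s t sa st tb) (b22 s t sa st tb)) _.
    apply: le_trans (ler_wpM2r (exprn_ge0 2 (powd_ge0 s t)) h2'); lra.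
  have := step_diff RS a0 ab br bah h0 h1 rhoK ce0 (dk0 k) b1 b2 o1 o2 oce he' de IH
    hy1 hy2 (solution_step o1 hy1 b1 d1) (solution_step o2 hy2 b2 d2).
  rewrite (_ : (c * e + (c * e + _)) / 2 = c * e + 2^-1 ^+ k.+1 * d0); last first.
    by rewrite exprS; field.
  by [].
have half01 : 0 <= (2^-1 : R) < 1 by apply/andP; split; lra.
split=> s t sa st tb.
  apply: (@le_geometric_error _ _ _ (d0 * rho * p s t) 2^-1 half01) => k.
  by have [h2 _] := cl k; apply: le_trans (h2 s t sa st tb) _; rewrite -/rho; lra.
apply: (@le_geometric_error _ _ _ (d0 * rho * p s t ^+ 2) 2^-1 half01) => k.
by have [_ h2] := cl k; apply: le_trans (h2 s t sa st tb) _; rewrite -/rho; lra.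
Qed.

Lemma window_sup t : - r <= t -> t <= b -> `|y1 t - y2 t| <= 6 * c ^+ 3 * e.
Proof.
move=> rt tb.
have := close_sup RS a0 ab br bah h0 h1 rhoK ce0 ce0 he' de window_stability rt tb.
by move=> /le_trans; apply; lra.
Qed.

Lemma window_deriv t : a <= t -> t <= b ->
  `|deriv_path eta1 y1 t - deriv_path eta2 y2 t| <= 2 * c * e.
Proof.
move=> at_ tb.
have := close_deriv RS a0 ab br bah h0 h1 ce0 de window_stability at_ tb.
by move=> /le_trans; apply; lra.
Qed.

End stability.
End window.
(* Davie's formulation of the integrated equation: free of the rough integral
   and, being local in time, stable under concatenation. *)
Definition solves eta eta' a b y : Prop :=
  holder_path beta r b y /\
  exists h C, 0 < h /\ forall s t, a <= s -> s <= t -> t <= b -> t - s <= h ->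
    `|remainder_path eta y s t| <= C * p s t ^+ 2 /\
    `|davie_path eta eta' y s t| <= C * p s t ^+ 3.

(** Shrinking a window enlarges the radius of its ball, so a remainder bound with any constant [q]
    becomes membership in a ball. *)
Lemma small_rate h (q : R) : 0 < h ->
  exists k, [/\ 0 < k, k <= 1, k <= h, Kst <= (k `^ beta)^-1 & q <= (k `^ beta)^-1].
Proof.
move=> h0; pose m := Num.max (Num.max Kst q) (h `^ beta)^-1.
have Km : Kst <= m by rewrite !le_max lexx.
have qm : q <= m by rewrite !le_max lexx orbT.
have hm : (h `^ beta)^-1 <= m by rewrite !le_max lexx !orbT.
have m1 : 1 <= m by apply: le_trans Km; exact: (Kst_ge1 RS).
have [k [k0 k1 km]] := rate_of_radius m1.
exists k; rewrite km; split=> //; rewrite leNgt; apply/negP => hk.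
have : h `^ beta < k `^ beta by rewrite gt0_ltr_powR ?nnegrE// ltW.
by rewrite ltNge; apply/negP/negPn; rewrite -lef_pV2 ?posrE ?powR_gt0// km.
Qed.

(** The index of [P] counts windows. Their number depends on [(b - a) / h] only, which keeps
    constants accumulated along the way uniform. *)
Lemma window_induction (P : nat -> R -> Prop) a b h : 0 < h -> a <= b -> P 0%N a ->
  (forall k x x', a <= x -> x <= x' -> x' <= b -> x' - x <= h -> P k x -> P k.+1 x') ->
  P (Num.bound ((b - a) / h)) b.
Proof.
move=> h0 ab P0 Pstep; set N := Num.bound _.
have Pk k : P k (Num.min b (a + k%:R * h)).
  elim: k => [|k IH]; first by rewrite mul0r addr0 min_r.
  have kh : 0 <= k%:R * h by rewrite mulr_ge0// ltW.
  have mm : Num.min b (a + k%:R * h) <= Num.min b (a + k.+1%:R * h).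
    rewrite le_min !ge_min lexx/= -natr1 mulrDl mul1r; apply/orP; right; lra.
  apply: Pstep IH => //.
  - by rewrite le_min ab lerDl.
  - by rewrite ge_min lexx.
  - rewrite lerBlDr; case: (leP b (a + k%:R * h)) => bk.
      by rewrite ge_min; apply/orP; left; lra.
    by rewrite ge_min; apply/orP; right; rewrite -natr1 mulrDl mul1r; lra.
have := Pk N; rewrite min_l//.
rewrite -lerBlDl -ler_pdivrMr//; apply/ltW/archi_boundP.
by rewrite divr_ge0 ?subr_ge0// ltW.
Qed.

Lemma holder_path_le (y : R -> 'cV[R]_n) b b' : b' <= b -> holder_path beta r b y -> holder_path beta r b' y.
Proof.
by move=> bb [C hC]; exists C => s t rs st tb; apply: hC => //; exact: le_trans bb.
Qed.

Lemma drift_eq y1 y2 b s t : holder_path beta r b y1 -> holder_path beta r b y2 ->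
  (forall t, - r <= t -> t <= b -> y1 t = y2 t) ->
  0 <= s -> s <= t -> t <= b -> Dr y1 s t = Dr y2 s t.
Proof.
move=> hy1 hy2 yy s0 st tb; apply/eqP; rewrite -subr_eq0 -normr_le0.
have := @rs_drift_diff _ _ _ _ _ _ _ _ _ _ _ _ _ RS y1 y2 b 0 hy1 hy2 _ s t s0 st tb.
rewrite mulr0 mul0r; apply => u ru ub.
by rewrite yy// subrr normr0.
Qed.

Lemma davie_eq eta eta' y1 y2 b s t :
  holder_path beta r b y1 -> holder_path beta r b y2 ->
  (forall t, - r <= t -> t <= b -> y1 t = y2 t) ->
  0 <= s -> s <= t -> t <= b -> davie_path eta eta' y1 s t = davie_path eta eta' y2 s t.
Proof.
move=> hy1 hy2 yy s0 st tb.
have rs : - r <= s by slra.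
have sb : s <= b by exact: le_trans tb.
have rt : - r <= t by exact: le_trans st.
rewrite /davie_path (drift_eq hy1 hy2 yy s0 st tb) (yy s rs sb) (yy t rt tb).
congr (_ - _); rewrite /germ_path /germ /lin_pair /deriv_path (yy s)//.
Qed.

Lemma remainder_eq eta y1 y2 s t : y1 s = y2 s -> y1 t = y2 t ->
  remainder_path eta y1 s t = remainder_path eta y2 s t.
Proof. by move=> es et; rewrite /remainder_path /deriv_path es et. Qed.

(* Doubling the length of the interval multiplies the constant by at most a
   fixed affine map. *)
Lemma local_defect_bound (N : R -> R -> 'cV[R]_n) a b h C C' : 0 < h -> 0 <= C' ->
  (forall s u t, a <= s -> s <= u -> u <= t -> t <= b ->
    `|N s t - N s u - N u t| <= C' * p s t ^+ 3) ->
  (forall s t, a <= s -> s <= t -> t <= b -> t - s <= h ->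
    `|N s t| <= C * p s t ^+ 3) ->
  exists C2, forall s t, a <= s -> s <= t -> t <= b -> `|N s t| <= C2 * p s t ^+ 3.
Proof.
move=> h0 C'0 dN hN.
have step k : exists C2, forall s t, a <= s -> s <= t -> t <= b -> t - s <= 2 ^+ k * h ->
    `|N s t| <= C2 * p s t ^+ 3.
  elim: k => [|k [C2 IH]]; first by exists C => s t; rewrite expr0 mul1r; exact: hN.
  exists (2 * `|C2| + C') => s t sa st tb tsk.
  pose u := (s + t) / 2.
  have su : s <= u by rewrite /u; lra.
  have ut : u <= t by rewrite /u; lra.
  have tsk2 : t - s <= 2 * (2 ^+ k * h) by move: tsk; rewrite exprS; lra.
  have psu : p s u ^+ 3 <= p s t ^+ 3.
    by rewrite lerXn2r ?nnegrE ?powd_ge0//; apply: (powd_le RS) => //; lra.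
  have put : p u t ^+ 3 <= p s t ^+ 3.
    by rewrite lerXn2r ?nnegrE ?powd_ge0//; apply: (powd_le RS) => //; lra.
  have h1 : `|N s u| <= `|C2| * p s t ^+ 3.
    apply: le_trans (IH s u sa su _ _) _; rewrite ?(le_trans ut)//.
      by rewrite /u; lra.
    apply: le_trans (ler_wpM2r _ (ler_norm C2)) _; rewrite ?exprn_ge0 ?powd_ge0//.
    by rewrite ler_wpM2l.
  have h2 : `|N u t| <= `|C2| * p s t ^+ 3.
    apply: le_trans (IH u t (le_trans sa su) ut tb _) _; first by rewrite /u; lra.
    apply: le_trans (ler_wpM2r _ (ler_norm C2)) _; rewrite ?exprn_ge0 ?powd_ge0//.
    by rewrite ler_wpM2l.
  have h3 := dN s u t sa su ut tb.
  rewrite (_ : N s t = (N s t - N s u - N u t) + N s u + N u t); last by zmod.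
  apply: le_trans (ler_normD _ _) _; apply: le_trans (lerD (ler_normD _ _) (lexx _)) _.
  by apply: le_trans (lerD (lerD h3 h1) h2) _; lra.
have [k hk] : exists k, (b - a) / h <= 2 ^+ k.
  exists (Num.bound `|(b - a) / h|).
  apply: le_trans (ler_norm _) _; apply: le_trans (ltW (archi_boundP (normr_ge0 _))) _.
  by rewrite -natrX ler_nat ltnW// ltn_expl.
have [C2 hC2] := step k; exists C2 => s t sa st tb; apply: hC2 => //.
by move: hk; rewrite ler_pdivrMr// => hk; lra.
Qed.

(** [solves] gives Davie's estimate on small intervals only; the defect of the germ, controlled in
    the ball, extends it to the window. *)
Lemma davie_window eta eta' y a b h h' C : 0 <= a -> a <= b -> b <= r -> b - a <= h ->
  0 < h -> h <= 1 -> Kst <= (h `^ beta)^-1 ->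
  delay_ok eta eta' -> holder_path beta r b y ->
  in_ball a b (h `^ beta)^-1 y (deriv_path eta y) -> 0 < h' ->
  (forall s t, a <= s -> s <= t -> t <= b -> t - s <= h' ->
    `|davie_path eta eta' y s t| <= C * p s t ^+ 3) ->
  exists C2, forall s t, a <= s -> s <= t -> t <= b ->
    `|davie_path eta eta' y s t| <= C2 * p s t ^+ 3.
Proof.
move=> a0 ab br bah h0 h1 rhoK eo hy yb h'0 hC.
apply: (local_defect_bound (C' := 11 * cc ^+ 7 * (h `^ beta)^-1) h'0 _ _ hC).
  by rewrite !mulr_ge0 ?exprn_ge0 ?invr_ge0 ?powR_ge0// (le_trans _ (cc1 RS)).
move=> s u t sa su ut tb.
have s0 : 0 <= s := le_trans a0 sa.
rewrite /davie_path (rs_drift_add RS hy s0 su ut tb).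
apply: le_trans (lift_defect RS a0 ab br bah h0 h1 rhoK yb eo sa su ut tb).
rewrite -normrN le_eqVlt; apply/orP; left; apply/eqP; congr (`|_|).
by rewrite /germ_path; zmod.
Qed.

Lemma delay_close0 eta eta' : delay_close 0 eta eta eta' eta'.
Proof. by split=> *; rewrite subrr normr0// mul0r. Qed.

(** On windows so short that both remainder constants fit into the radius, stability with [e = 0]
    applies; equality then propagates from window to window. *)
Lemma local_uniqueness eta eta' a b y1 y2 : delay_ok eta eta' ->
  0 <= a -> a <= b -> b <= r ->
  solves eta eta' a b y1 -> solves eta eta' a b y2 ->
  (forall t, - r <= t -> t <= a -> y1 t = y2 t) ->
  forall t, - r <= t -> t <= b -> y1 t = y2 t.
Proof.
move=> eo a0 ab br [hy1 [k1 [C1 [k10 s1]]]] [hy2 [k2 [C2 [k20 s2]]]] yy.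
pose C := Num.max C1 C2.
have k0 : 0 < Num.min k1 k2 by rewrite lt_min k10.
have [h [h0 h1 hk rK rC]] := small_rate C k0.
pose P (k : nat) x := forall t, - r <= t -> t <= x -> y1 t = y2 t.
apply: (@window_induction P a b h h0 ab yy).
move=> k x x' ax xx xb xxh Px t rt tx.
have x0 : 0 <= x := le_trans a0 ax.
have xr : x' <= r := le_trans xb br.
have hk1 : h <= k1 by apply: le_trans hk _; rewrite ge_min lexx.
have hk2 : h <= k2 by apply: le_trans hk _; rewrite ge_min lexx orbT.
have CC1 : C1 <= (h `^ beta)^-1 by apply: le_trans rC; rewrite le_max lexx.
have CC2 : C2 <= (h `^ beta)^-1 by apply: le_trans rC; rewrite le_max lexx orbT.
have b1 : in_ball x x' (h `^ beta)^-1 y1 (deriv_path eta y1).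
  apply: (remainder_in_ball x0 xx xr xxh h0 h1 rK eo) => s u xs su ux.
  have us : u - s <= k1 by lra.
  have [h2 _] := s1 s u (le_trans ax xs) su (le_trans ux xb) us.
  by apply: le_trans h2 _; rewrite ler_wpM2r// exprn_ge0// powd_ge0.
have b2 : in_ball x x' (h `^ beta)^-1 y2 (deriv_path eta y2).
  apply: (remainder_in_ball x0 xx xr xxh h0 h1 rK eo) => s u xs su ux.
  have us : u - s <= k2 by lra.
  have [h2 _] := s2 s u (le_trans ax xs) su (le_trans ux xb) us.
  by apply: le_trans h2 _; rewrite ler_wpM2r// exprn_ge0// powd_ge0.
have hx1 := holder_path_le xb hy1; have hx2 := holder_path_le xb hy2.
apply/eqP; rewrite -subr_eq0 -normr_le0.
have := @window_sup x x' h x0 xx xr xxh h0 h1 rK 0 C y1 y2 eta eta eta' eta' (lexx 0)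
  eo eo (delay_close0 eta eta') hx1 hx2 b1 b2.
rewrite mulr0; apply => //.
- move=> s u xs su ux; have us : u - s <= k1 by lra.
  have [_ h2] := s1 s u (le_trans ax xs) su (le_trans ux xb) us.
  by apply: le_trans h2 _; rewrite ler_wpM2r ?exprn_ge0 ?powd_ge0// le_max lexx.
- move=> s u xs su ux; have us : u - s <= k2 by lra.
  have [_ h2] := s2 s u (le_trans ax xs) su (le_trans ux xb) us.
  by apply: le_trans h2 _; rewrite ler_wpM2r ?exprn_ge0 ?powd_ge0// le_max lexx orbT.
- by move=> u ru ux; rewrite Px// subrr normr0.
Qed.

Lemma solves_ext eta eta' a b y1 y2 : 0 <= a -> holder_path beta r b y2 ->
  (forall t, - r <= t -> t <= b -> y1 t = y2 t) ->
  solves eta eta' a b y1 -> solves eta eta' a b y2.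
Proof.
move=> a0 hy2 yy [hy1 [h [C [h0 hC]]]]; split; first exact: hy2.
exists h, C; split; first exact: h0.
move=> s t sa st tb tsh.
have s0 : 0 <= s := le_trans a0 sa.
have rs : - r <= s by slra.
have rt : - r <= t := le_trans rs st.
rewrite -(davie_eq eta eta' hy1 hy2 yy s0 st tb).
rewrite -(remainder_eq eta (yy s rs (le_trans st tb)) (yy t rt tb)).
exact: hC.
Qed.

(** An interval across [b] is split there. The remainder is additive up to the product of an
    increment of the derivative and one of [X], and the Davie remainder up to the defect of the
    germ. *)
Lemma solves_glue eta eta' b b' y : delay_ok eta eta' -> 0 <= b -> b <= b' -> b' <= r ->
  solves eta eta' 0 b y -> solves eta eta' b b' y -> solves eta eta' 0 b' y.
Proof.
move=> eo b0 bb br [_ [h1 [C1 [h10 s1]]]] [hy [h2 [C2 [h20 s2]]]]; split=> //.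
have [Cy hCy] := hy.
pose l := Num.max `|Cy| (c ^+ 3 + c).
(* The two sides of [b], and the cross term of the remainder. *)
pose CR := `|C1| + `|C2| + c * (c * l) * c.
have l0 : 0 <= l by rewrite le_max normr_ge0.
have hR s t : 0 <= s -> s <= t -> t <= b' -> t - s <= h1 -> t - s <= h2 -> t - s <= 1 ->
    `|remainder_path eta y s t| <= CR * p s t ^+ 2.
  move=> s0 st tb th1 th2 th3.
  have p0 := powd_ge0 (beta := beta) s t.
  have p2 : 0 <= p s t ^+ 2 by rewrite exprn_ge0.
  have Cl : 0 <= c * (c * l) * c by rewrite !mulr_ge0.
  have le1 x : `|C1| * x ^+ 2 <= CR * x ^+ 2.
    by rewrite ler_wpM2r ?exprn_even_ge0// /CR -addrA lerDl addr_ge0.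
  have le2 x : `|C2| * x ^+ 2 <= CR * x ^+ 2.
    by rewrite ler_wpM2r ?exprn_even_ge0// /CR addrAC lerDr addr_ge0.
  have n1 s' t' : C1 * p s' t' ^+ 2 <= `|C1| * p s' t' ^+ 2.
    by rewrite ler_wpM2r ?exprn_even_ge0// ler_norm.
  have n2 s' t' : C2 * p s' t' ^+ 2 <= `|C2| * p s' t' ^+ 2.
    by rewrite ler_wpM2r ?exprn_even_ge0// ler_norm.
  case: (leP t b) => tb'.
    have [k1 _] := s1 s t s0 st tb' th1.
    exact: le_trans k1 (le_trans (n1 _ _) (le1 _)).
  case: (leP b s) => bs.
    have [k2 _] := s2 s t bs st tb th2.
    exact: le_trans k2 (le_trans (n2 _ _) (le2 _)).
  have sb := ltW bs; have bt := ltW tb'.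
  have bs1 : b - s <= h1 by lra.
  have bt2 : t - b <= h2 by lra.
  have [k1 _] := s1 s b s0 sb (lexx b) bs1.
  have [k2 _] := s2 b t (lexx b) bt tb bt2.
  have psb : p s b <= p s t by apply: (powd_le RS) => //; lra.
  have pbt : p b t <= p s t by apply: (powd_le RS) => //; lra.
  have br' : b <= r by exact: le_trans br.
  have tr : t <= r by exact: le_trans br.
  have p1 : p s b <= 1.
    have : (b - s) `^ beta <= 1 `^ beta by apply: (powR_homo RS); lra.
    by rewrite powR1.
  have rs : - r <= s by slra.
  have k3 : `|deriv_path eta y b - deriv_path eta y s| <= c * l * p s b.
    have q0 := powd_ge0 (beta := beta) s b.
    apply: (deriv_dy (k := l)) => //.
      apply: le_trans (hCy s b rs sb bb) _; rewrite ler_wpM2r//.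
      by apply: le_trans (ler_norm _) _; rewrite le_max lexx.
    apply: le_trans (delay_dy eo s0 sb br') _; rewrite ler_wpM2r//.
    rewrite le_max; apply/orP; right; rewrite lerD2l.
    by rewrite ler_piMr.
  have k4 := norm_mulmx_le (rs_d RS) k3 (rs_X RS b0 bt tr).
  rewrite (_ : remainder_path eta y s t = remainder_path eta y s b + remainder_path eta y b t
    + (deriv_path eta y b - deriv_path eta y s) *m (X t - X b)); last first.
    rewrite /remainder_path (_ : X t - X s = (X t - X b) + (X b - X s)); last by zmod.
    by rewrite mulmxDr mulmxBl; zmod.
  apply: le_trans (ler_normD _ _) _; apply: le_trans (lerD (ler_normD _ _) (lexx _)) _.
  rewrite /CR !mulrDl; apply: lerD; first apply: lerD.
  - apply: le_trans k1 _; apply: le_trans (n1 _ _) _.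
    by rewrite ler_wpM2l// lerXn2r ?nnegrE ?powd_ge0.
  - apply: le_trans k2 _; apply: le_trans (n2 _ _) _.
    by rewrite ler_wpM2l// lerXn2r ?nnegrE ?powd_ge0.
  - apply: le_trans k4 _.
    have : c * (c * l) * c * (p s b * p b t) <= c * (c * l) * c * (p s t * p s t).
      by rewrite ler_wpM2l// ler_pM ?powd_ge0.
    by lra.
have hm : 0 < Num.min (Num.min h1 h2) 1 by rewrite !lt_min h10 h20 ltr01.
(* With [CR] below the radius, any interval of length at most [h] lies in a ball, so [lift_defect]
   is available across [b]. *)
have [h [h0 hh1 hmin rK rC]] := small_rate CR hm.
have hle1 : h <= h1 by apply: le_trans hmin _; rewrite !ge_min lexx.
have hle2 : h <= h2 by apply: le_trans hmin _; rewrite !ge_min lexx orbT.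
exists h, (Num.max CR (`|C1| + `|C2| + 11 * cc ^+ 7 * (h `^ beta)^-1)); split=> //.
set D := Num.max _ _.
have D1 : CR <= D by rewrite le_max lexx.
have D2 : `|C1| + `|C2| + 11 * cc ^+ 7 * (h `^ beta)^-1 <= D by rewrite le_max lexx orbT.
have K0 : 0 <= 11 * cc ^+ 7 * (h `^ beta)^-1.
  by rewrite !mulr_ge0 ?exprn_ge0 ?invr_ge0 ?powR_ge0// (le_trans _ (cc1 RS)).
have D3 : `|C1| <= D by apply: le_trans D2; rewrite -addrA lerDl addr_ge0.
have D4 : `|C2| <= D by apply: le_trans D2; rewrite addrAC lerDr addr_ge0.
move=> s t s0 st tb tsh.
have ts1 : t - s <= h1 by lra.
have ts2 : t - s <= h2 by lra.
have tr : t <= r := le_trans tb br.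
have p3 s' t' : 0 <= p s' t' ^+ 3 by rewrite exprn_ge0// powd_ge0.
split.
  apply: le_trans (hR s t s0 st tb ts1 ts2 _) _; first by lra.
  by rewrite ler_wpM2r// exprn_ge0// powd_ge0.
case: (leP t b) => tb'.
  have [_ k1] := s1 s t s0 st tb' ts1; apply: le_trans k1 _.
  by rewrite ler_wpM2r//; apply: le_trans (ler_norm _) _.
case: (leP b s) => bs.
  have [_ k2] := s2 s t bs st tb ts2; apply: le_trans k2 _.
  by rewrite ler_wpM2r//; apply: le_trans (ler_norm _) _.
have sb := ltW bs; have bt := ltW tb'.
have bs1 : b - s <= h1 by lra.
have bt2 : t - b <= h2 by lra.
have [_ k1] := s1 s b s0 sb (lexx b) bs1.
have [_ k2] := s2 b t (lexx b) bt tb bt2.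
have yb : in_ball s t (h `^ beta)^-1 y (deriv_path eta y).
  apply: (remainder_in_ball s0 st tr tsh h0 hh1 rK eo) => u v su uv vt.
  have uv_st : v - u <= t - s by rewrite lerB.
  apply: le_trans (hR u v (le_trans s0 su) uv (le_trans vt tb) _ _ _) _;
    [exact: le_trans ts1|exact: le_trans ts2|exact: le_trans (le_trans tsh hh1)|].
  by rewrite ler_wpM2r// exprn_ge0// powd_ge0.
have k3 := lift_defect RS s0 st tr tsh h0 hh1 rK yb eo (lexx s) sb bt (lexx t).
have psb : p s b ^+ 3 <= p s t ^+ 3.
  by rewrite lerXn2r ?nnegrE ?powd_ge0//; apply: (powd_le RS) => //; rewrite lerB.
have pbt : p b t ^+ 3 <= p s t ^+ 3.
  by rewrite lerXn2r ?nnegrE ?powd_ge0//; apply: (powd_le RS) => //; rewrite lerB.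
rewrite (_ : davie_path eta eta' y s t = davie_path eta eta' y s b + davie_path eta eta' y b t
   - (germ_path eta eta' y s t - germ_path eta eta' y s b - germ_path eta eta' y b t)); last first.
  by rewrite /davie_path (rs_drift_add RS hy s0 sb bt tb); zmod.
apply: le_trans (ler_normB _ _) _; apply: le_trans (lerD (ler_normD _ _) (lexx _)) _.
apply: le_trans (ler_wpM2r (p3 _ _) D2); rewrite 2!mulrDl; apply: lerD; last by rewrite /germ_path; apply: k3.
apply: lerD.
  apply: le_trans k1 _; apply: le_trans (ler_wpM2r (p3 _ _) (ler_norm _)) _.
  by rewrite ler_wpM2l.
apply: le_trans k2 _; apply: le_trans (ler_wpM2r (p3 _ _) (ler_norm _)) _.
by rewrite ler_wpM2l.
Qed.

Lemma delay_close_le e e' eta1 eta2 eta1' eta2' : e <= e' ->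
  delay_close e eta1 eta2 eta1' eta2' -> delay_close e' eta1 eta2 eta1' eta2'.
Proof.
move=> ee [h2 h3 h4 h5]; split.
- by move=> t t0 tr; apply: le_trans (h2 t t0 tr) _.
- by move=> t t0 tr; apply: le_trans (h3 t t0 tr) _.
- move=> s t s0 st tr; apply: le_trans (h4 s t s0 st tr) _.
  by rewrite ler_wpM2r// powd_ge0.
- move=> s t s0 st tr; apply: le_trans (h5 s t s0 st tr) _.
  by rewrite ler_wpM2r// exprn_ge0// powd_ge0.
Qed.

(** Each window multiplies the distance by at most [6 * c ^+ 3], and the number of windows depends
    on [h] only. Thus [C] is uniform over all data whose solutions satisfy the remainder bound at
    the scale [h]. *)
Lemma global_stability h : 0 < h -> h <= 1 -> Kst <= (h `^ beta)^-1 ->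
  exists C, 0 <= C /\ forall e eta1 eta1' eta2 eta2' y1 y2, 0 <= e ->
    delay_ok eta1 eta1' -> delay_ok eta2 eta2' ->
    delay_close e eta1 eta2 eta1' eta2' ->
    solves eta1 eta1' 0 r y1 -> solves eta2 eta2' 0 r y2 ->
    (forall s t, 0 <= s -> s <= t -> t <= r -> t - s <= h ->
      `|remainder_path eta1 y1 s t| <= (h `^ beta)^-1 * p s t ^+ 2) ->
    (forall s t, 0 <= s -> s <= t -> t <= r -> t - s <= h ->
      `|remainder_path eta2 y2 s t| <= (h `^ beta)^-1 * p s t ^+ 2) ->
    (forall t, - r <= t -> t <= 0 -> `|y1 t - y2 t| <= e) ->
  [/\ forall t, - r <= t -> t <= r -> `|y1 t - y2 t| <= C * e,
      forall t, 0 <= t -> t <= r ->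
        `|deriv_path eta1 y1 t - deriv_path eta2 y2 t| <= C * e,
      forall s t, 0 <= s -> s <= t -> t <= r ->
        `|(deriv_path eta1 y1 t - deriv_path eta1 y1 s)
          - (deriv_path eta2 y2 t - deriv_path eta2 y2 s)| <= C * e * p s t &
      forall s t, 0 <= s -> s <= t -> t <= r ->
        `|remainder_path eta1 y1 s t - remainder_path eta2 y2 s t|
          <= C * e * p s t ^+ 2].
Proof.
move=> h0 h1 rK; set rho := (h `^ beta)^-1.
have rho1' : 1 <= rho := rho1 RS rK.
have rho0 : 0 <= rho by apply: le_trans rho1'.
pose N := Num.bound ((r - 0) / h).
pose S := (6 * c ^+ 3) ^+ N.
have c31 : 1 <= 6 * c ^+ 3 by have := exprn_ege1 3 c1; lra.
have S0 : 0 <= S by rewrite exprn_ge0// mulr_ge0 ?exprn_ge0.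
have S1 : 1 <= S by exact: exprn_ege1.
(* [T1] serves the derivatives and the remainders of nearby pairs; [T2] and [T3] serve the
   remainders of distant pairs, where each missing power of [p] is paid for by a factor [rho]. *)
pose T1 := 4 * c * rho; pose T2 := 2 * rho ^+ 2; pose T3 := 2 * c ^+ 3 * rho.
have T10 : 0 <= T1 by rewrite !mulr_ge0.
have T20 : 0 <= T2 by rewrite mulr_ge0 ?exprn_ge0.
have T30 : 0 <= T3 by rewrite !mulr_ge0 ?exprn_ge0.
pose C := S * (1 + T1 + T2 + T3).
exists C; split; first by rewrite mulr_ge0// !addr_ge0.
move=> e eta1 eta1' eta2 eta2' y1 y2 e0 o1 o2 oe [hy1 [k1 [C1 [k10 s1]]]]
  [hy2 [k2 [C2 [k20 s2]]]] R1 R2 he.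
have ball1 x x' : 0 <= x -> x <= x' -> x' <= r -> x' - x <= h ->
    in_ball x x' rho y1 (deriv_path eta1 y1).
  move=> x0 xx xr xh; apply: (remainder_in_ball x0 xx xr xh h0 h1 rK o1) => s u xs su ux.
  apply: R1 => //; [exact: le_trans xs|exact: le_trans xr|].
  by apply: le_trans xh; rewrite lerB.
have ball2 x x' : 0 <= x -> x <= x' -> x' <= r -> x' - x <= h ->
    in_ball x x' rho y2 (deriv_path eta2 y2).
  move=> x0 xx xr xh; apply: (remainder_in_ball x0 xx xr xh h0 h1 rK o2) => s u xs su ux.
  apply: R2 => //; [exact: le_trans xs|exact: le_trans xr|].
  by apply: le_trans xh; rewrite lerB.
have dav x x' : 0 <= x -> x <= x' -> x' <= r -> x' - x <= h -> exists D,
    (forall s t, x <= s -> s <= t -> t <= x' ->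
      `|davie_path eta1 eta1' y1 s t| <= D * p s t ^+ 3) /\
    (forall s t, x <= s -> s <= t -> t <= x' ->
      `|davie_path eta2 eta2' y2 s t| <= D * p s t ^+ 3).
  move=> x0 xx xr xh.
  have l1 s t : x <= s -> s <= t -> t <= x' -> t - s <= k1 ->
      `|davie_path eta1 eta1' y1 s t| <= C1 * p s t ^+ 3.
    move=> xs st tx tk.
    by have [_ H] := s1 s t (le_trans x0 xs) st (le_trans tx xr) tk.
  have l2 s t : x <= s -> s <= t -> t <= x' -> t - s <= k2 ->
      `|davie_path eta2 eta2' y2 s t| <= C2 * p s t ^+ 3.
    move=> xs st tx tk.
    by have [_ H] := s2 s t (le_trans x0 xs) st (le_trans tx xr) tk.
  have [D1 hD1] := davie_window x0 xx xr xh h0 h1 rK o1 (holder_path_le xr hy1)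
    (ball1 x x' x0 xx xr xh) k10 l1.
  have [D2 hD2] := davie_window x0 xx xr xh h0 h1 rK o2 (holder_path_le xr hy2)
    (ball2 x x' x0 xx xr xh) k20 l2.
  exists (Num.max D1 D2); split=> s t xs st tx.
    apply: le_trans (hD1 s t xs st tx) _.
    by rewrite ler_wpM2r ?exprn_ge0 ?powd_ge0// le_max lexx.
  apply: le_trans (hD2 s t xs st tx) _.
  by rewrite ler_wpM2r ?exprn_ge0 ?powd_ge0// le_max lexx orbT.
have sup_le : forall t, - r <= t -> t <= r -> `|y1 t - y2 t| <= S * e.
  pose P (k : nat) x := forall t, - r <= t -> t <= x -> `|y1 t - y2 t| <= (6 * c ^+ 3) ^+ k * e.
  apply: (@window_induction P 0 r h h0 (ltW r0)); first by move=> t rt t0; rewrite expr0 mul1r; exact: he.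
  move=> k x x' x0 xx xr xh Px t rt tx.
  have [D [hD1 hD2]] := dav x x' x0 xx xr xh.
  have ek0 : 0 <= (6 * c ^+ 3) ^+ k * e.
    by rewrite mulr_ge0// exprn_ge0// mulr_ge0// exprn_ge0.
  have eek : e <= (6 * c ^+ 3) ^+ k * e by rewrite ler_peMl// exprn_ege1.
  have := window_sup x0 xx xr xh h0 h1 rK ek0 o1 o2 (delay_close_le eek oe)
    (holder_path_le xr hy1) (holder_path_le xr hy2) (ball1 x x' x0 xx xr xh)
    (ball2 x x' x0 xx xr xh) hD1 hD2 Px rt tx.
  by rewrite mulrA -exprS.
have Se0 : 0 <= S * e by rewrite mulr_ge0.
have eSe : e <= S * e by rewrite ler_peMl.
have oSe := delay_close_le eSe oe.
have hist x : x <= r -> forall t, - r <= t -> t <= x -> `|y1 t - y2 t| <= S * e.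
  by move=> xr t rt tx; apply: sup_le => //; exact: le_trans xr.
have der t : 0 <= t -> t <= r -> `|deriv_path eta1 y1 t - deriv_path eta2 y2 t| <= 2 * c * (S * e).
  (* The degenerate window [[t, t]] suffices, as the derivative is a function of the values at
     [t]. *)
  move=> t0 tr; have th : t - t <= h by rewrite subrr ltW.
  have [D [hD1 hD2]] := dav t t t0 (lexx t) tr th.
  exact: (window_deriv t0 (lexx t) tr th h0 h1 rK Se0 o1 o2 oSe
    (holder_path_le tr hy1) (holder_path_le tr hy2) (ball1 t t t0 (lexx t) tr th)
    (ball2 t t t0 (lexx t) tr th) hD1 hD2 (hist t tr) (lexx t) (lexx t)).
have clo s t : 0 <= s -> s <= t -> t <= r -> t - s <= h ->
    path_close s t h (c * (S * e)) y1 y2 (deriv_path eta1 y1) (deriv_path eta2 y2).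
  move=> s0 st tr th.
  have [D [hD1 hD2]] := dav s t s0 st tr th.
  exact: (window_stability s0 st tr th h0 h1 rK Se0 o1 o2 oSe
    (holder_path_le tr hy1) (holder_path_le tr hy2) (ball1 s t s0 st tr th)
    (ball2 s t s0 st tr th) hD1 hD2 (hist s (le_trans st tr))).
have CE (x : R) : x <= 1 + T1 + T2 + T3 -> x * (S * e) <= C * e.
  by move=> xC; have := ler_wpM2r Se0 xC; rewrite /C; lra.
(* Between times more than [h] apart, supremum bounds are turned into Hölder bounds by this
   inequality. *)
have far s t : h < t - s -> 1 <= rho * p s t.
  move=> hts; rewrite mulrC ler_pdivlMr ?powR_gt0// mul1r.
  by apply: (powR_homo RS); exact: ltW.
split.
- move=> t rt tr; apply: le_trans (sup_le t rt tr) _.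
  by rewrite -[leLHS]mul1r; apply: CE; lra.
- move=> t t0 tr; apply: le_trans (der t t0 tr) _; apply: CE.
  have : 4 * c * 1 <= T1 by rewrite ler_wpM2l// mulr_ge0.
  lra.
- move=> s t s0 st tr; have p0 := powd_ge0 (beta := beta) s t.
  apply: (@le_trans _ _ (T1 * (S * e) * p s t)); last first.
    by rewrite ler_wpM2r//; apply: CE; lra.
  case: (leP (t - s) h) => ts.
    have [H _] := clo s t s0 st tr ts; apply: le_trans (H s t (lexx s) st (lexx t)) _.
    rewrite -/rho /T1 ler_wpM2r//.
    have : 0 <= c * (S * e) * rho by rewrite !mulr_ge0.
    lra.
  apply: le_trans (_ : _ <= 2 * c * (S * e) + 2 * c * (S * e)) _.
    rewrite (_ : _ - _ = (deriv_path eta1 y1 t - deriv_path eta2 y2 t) -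
      (deriv_path eta1 y1 s - deriv_path eta2 y2 s)); last by zmod.
    apply: le_trans (ler_normB _ _) _; apply: lerD; apply: der => //.
      exact: le_trans st.
    exact: le_trans tr.
  have cS : 0 <= 4 * c * (S * e) by rewrite !mulr_ge0.
  have := ler_wpM2l cS (far s t ts); rewrite /T1; lra.
- move=> s t s0 st tr; have p0 := powd_ge0 (beta := beta) s t.
  have p2 : 0 <= p s t ^+ 2 by rewrite exprn_ge0.
  have sr := le_trans st tr.
  have t0 := le_trans s0 st.
  apply: (@le_trans _ _ ((T1 + T2 + T3) * (S * e) * p s t ^+ 2)); last first.
    by rewrite ler_wpM2r//; apply: CE; lra.
  case: (leP (t - s) h) => ts.
    have [_ H] := clo s t s0 st tr ts; apply: le_trans (H s t (lexx s) st (lexx t)) _.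
    rewrite -/rho ler_wpM2r//.
    have : 0 <= (T2 + T3) * (S * e) by rewrite mulr_ge0// addr_ge0.
    have : 0 <= c * (S * e) * rho by rewrite !mulr_ge0.
    rewrite /T1; lra.
  rewrite (_ : _ - _ = (y1 t - y2 t) - (y1 s - y2 s)
    - (deriv_path eta1 y1 s - deriv_path eta2 y2 s) *m (X t - X s)); last first.
    by rewrite /remainder_path mulmxBl; zmod.
  have rs : - r <= s by slra.
  have rt : - r <= t by slra.
  apply: le_trans (ler_normB _ _) _; apply: le_trans (lerD (ler_normB _ _) (lexx _)) _.
  apply: le_trans (lerD (lerD (sup_le t rt tr) (sup_le s rs sr))
    (norm_mulmx_le (rs_d RS) (der s s0 sr) (rs_X RS s0 st tr))) _.
  have rp := far s t ts.
  have rp2 : 1 <= (rho * p s t) ^+ 2 by rewrite exprn_ege1.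
  have q1 : 2 * (S * e) * 1 <= 2 * (S * e) * (rho * p s t) ^+ 2 by rewrite ler_wpM2l// mulr_ge0.
  have cS : 0 <= 2 * c ^+ 3 * (S * e) * p s t.
    by apply: mulr_ge0 => //; apply: mulr_ge0 => //; rewrite mulr_ge0// exprn_ge0.
  have q2 := ler_wpM2l cS rp.
  have : 0 <= T1 * (S * e) * p s t ^+ 2 by rewrite !mulr_ge0.
  rewrite /T2 /T3; lra.
Qed.

End solutions.

(** * Global existence and a window common to all bounded data *)

Section existence.
Context {R : realType} {n d : nat} {beta r : R}.
Context {X Y : R -> 'cV[R]_d} {XX YX : R -> R -> 'M[R]_d}.
Context {G : 'cV[R]_n * 'cV[R]_n -> 'M[R]_(n, d)}.
Context {dG : 'cV[R]_n * 'cV[R]_n -> 'cV[R]_n * 'cV[R]_n -> 'M[R]_(n, d)}.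
Context {Dr : (R -> 'cV[R]_n) -> R -> R -> 'cV[R]_n} {c : R}.
Hypothesis RS : rough_setting beta r X Y XX YX G dG Dr c.
Local Notation p := (powd beta).
Local Notation in_ball := (@in_ball R n d beta X c).
Local Notation delay_ok := (@delay_ok R n d beta r Y c).
Local Notation Kst := (@Kst R beta c).
Local Notation solves := (@solves R n d beta r X XX YX G dG Dr).
Local Notation deriv_path := (@deriv_path R n d G).
Local Notation remainder_path := (@remainder_path R n d X G).
Local Notation davie_path := (@davie_path R n d X XX YX G dG Dr).
Implicit Types (s t u a b h K : R).

Let c1 : 1 <= c := rs_c RS.
Let c0 : 0 <= c. Proof. exact: le_trans c1. Qed.
Let r0 : 0 < r := rs_r RS.
Let beta0 : 0 < beta.
Proof. by apply: lt_trans (rs_beta_gt RS); rewrite invr_gt0. Qed.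
Let bg : 3^-1 < beta := rs_beta_gt RS.
Let bl : beta < 2^-1 := rs_beta_lt RS.
Ltac slra := move: (c1) (c0) (r0) (bg) (bl) => ? ? ? ? ?; lra.
Let Kst1 : 1 <= Kst := Kst_ge1 RS.

(** The summand [4 * c] is for the smallness of the drift. The summand [Kst ^+ 2] makes the radius
    exceed [Kst]: as [2 * beta >= 1 - beta], the square of [h ^ beta] is at most [h ^ (1 - beta)],
    which equals [(kappa * K)^-1]. *)
Let kappa : R := 4 * c + Kst ^+ 2.
Let kappa1 : 1 <= kappa.
Proof. by have := exprn_ge0 2 (le_trans ler01 Kst1); rewrite /kappa; slra. Qed.

(* On a window of this length the increments of a solution bounded by K are at
   most a multiple of [h ^ beta = kappa * K * h], so the bound grows at most
   exponentially in time although the drift is unbounded. *)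
Definition window_length K : R := (kappa * K)^-1 `^ (1 - beta)^-1.

Lemma window_lengthP K : 1 <= K -> let h := window_length K in
  [/\ 0 < h, h <= 1, Kst <= (h `^ beta)^-1, 4 * c * K * h `^ (1 - beta) <= 1 &
      h `^ beta = h * (kappa * K)].
Proof.
move=> K1 h.
have kK1 : 1 <= kappa * K by rewrite mulr_ege1.
have kK0 : 0 < kappa * K by apply: lt_le_trans kK1.
have b1 : 0 < 1 - beta by slra.
have h0 : 0 < h by rewrite powR_gt0// invr_gt0.
have hb : h `^ (1 - beta) = (kappa * K)^-1.
  by rewrite /h /window_length -powRrM mulVf ?powRr1 ?lt0r_neq0// invr_ge0 ltW.
have h1 : h <= 1.
  rewrite -(powRr0 (kappa * K)^-1); apply: ger_powR; last by rewrite invr_ge0 ltW.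
  by rewrite invr_gt0 kK0 invf_le1.
have hbE : h `^ beta = h * (kappa * K).
  have : h `^ (1 - beta) * h `^ beta = h.
    by rewrite -powRD ?subrK ?powRr1 ?ltW// (lt0r_neq0 h0) implybT.
  rewrite hb => hh; rewrite -[in RHS]hh; field.
  by rewrite (lt0r_neq0 (lt_le_trans ltr01 K1)) (lt0r_neq0 (lt_le_trans ltr01 kappa1)).
split=> //; last first.
  rewrite hb ler_pdivrMr// mul1r.
  have K0 : 0 <= K by apply: le_trans K1.
  have := ler_wpM2l K0 (exprn_ge0 2 (le_trans ler01 Kst1)); rewrite /kappa; lra.
have hp0 : 0 < h `^ beta by rewrite powR_gt0.
rewrite -[leLHS]invrK lef_pV2 ?posrE ?invr_gt0//; last by apply: lt_le_trans Kst1.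
have Kst0 : 0 < Kst by apply: lt_le_trans Kst1.
have Ki0 : 0 <= Kst^-1 by rewrite invr_ge0 ltW.
rewrite -(ler_pXn2r (ltn0Sn 1)) ?nnegrE ?powR_ge0//.
have -> : (h `^ beta) ^+ 2 = h `^ (2 * beta).
  by rewrite mulrC powRrM powR_mulrn ?powR_ge0.
apply: (@le_trans _ _ (h `^ (1 - beta))).
  by apply: ger_powR; [rewrite h0|slra].
rewrite hb exprVn lef_pV2 ?posrE ?exprn_gt0//.
apply: (@le_trans _ _ kappa); first by rewrite /kappa; slra.
by rewrite ler_peMr// (le_trans _ kappa1).
Qed.

Lemma window_length_le K K' : 1 <= K -> K <= K' -> window_length K' <= window_length K.
Proof.
move=> K1 KK; have K0 : 0 < K by apply: lt_le_trans K1.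
have kap0 : 0 < kappa by apply: lt_le_trans kappa1.
have K'0 : 0 < K' by apply: lt_le_trans KK.
have k1 : 0 <= (kappa * K')^-1 by rewrite invr_ge0 mulr_ge0// ltW.
have k2 : 0 <= (kappa * K)^-1 by rewrite invr_ge0 mulr_ge0// ltW.
rewrite /window_length ge0_ler_powR ?nnegrE//; first by rewrite invr_ge0; slra.
by rewrite lef_pV2 ?posrE ?mulr_gt0// ler_pM2l.
Qed.

Lemma window_extend eta eta' b b' h K y0 : delay_ok eta eta' ->
  0 <= b -> b <= b' -> b' <= r -> b' - b <= h ->
  0 < h -> h <= 1 -> Kst <= (h `^ beta)^-1 ->
  c ^+ 3 + 1 <= K -> 4 * c * K * h `^ (1 - beta) <= 1 ->
  holder_path beta r b y0 -> (forall t, - r <= t -> t <= b -> `|y0 t| <= K) ->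
  exists y, [/\ forall t, t <= b -> y t = y0 t, solves eta eta' b b' y,
    forall s t, b <= s -> s <= t -> t <= b' ->
      `|remainder_path eta y s t| <= (h `^ beta)^-1 * p s t ^+ 2 &
    forall t, b <= t -> t <= b' -> `|y t| <= K + (c ^+ 3 + 1) * h `^ beta].
Proof.
move=> eo b0 bb br bbh h0 h1 rK cK hK hy0 yK.
have [y [yy yb ys]] := local_existence RS b0 bb br bbh h0 h1 rK eo hy0 yK cK hK.
have hyb : holder_path beta r b y.
  case: hy0 => C hC; exists C => s t rs st tb.
  by rewrite !yy ?hC// (le_trans st).
have rem s t : b <= s -> s <= t -> t <= b' ->
    `|remainder_path eta y s t| <= (h `^ beta)^-1 * p s t ^+ 2.
  by case: yb => _ _ h3; exact: h3.
have rho0 : 0 <= (h `^ beta)^-1 by rewrite invr_ge0 powR_ge0.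
have KK : 0 <= @K1 R beta c by exact: K1_ge0 RS.
exists y; split=> //.
  split; first exact: (in_ball_holder RS b0 bb br bbh h0 h1 hyb yb).
  exists h, ((@K1 R beta c + 1) * (h `^ beta)^-1); split=> // s t bs st tb' _.
  have p0 := powd_ge0 (beta := beta) s t; split.
    apply: le_trans (rem s t bs st tb') _; rewrite ler_wpM2r ?exprn_ge0//.
    by rewrite ler_peMl// lerDr.
  apply: le_trans (ys s t bs st tb') _.
  by rewrite ler_wpM2r ?exprn_ge0// ler_wpM2r// lerDl.
move=> t bt tb'; rewrite -(subrK (y b) (y t)) addrC.
apply: le_trans (ler_normD _ _) _; apply: lerD.
  by rewrite yy// yK//; slra.
apply: le_trans (in_ball_dy RS b0 bb br bbh h0 h1 yb (lexx b) bt tb') _.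
rewrite ler_wpM2l ?addr_ge0 ?exprn_ge0//; apply: (powR_homo RS); lra.
Qed.

(** A window of length [h] raises the bound [K] by at most [(c ^+ 3 + 1) * h ^ beta], which is
    [lambda * h * K]. *)
Let lambda : R := (c ^+ 3 + 1) * kappa.
Let lambda0 : 0 <= lambda.
Proof.
apply: mulr_ge0; last by apply: le_trans kappa1.
by rewrite addr_ge0// exprn_ge0.
Qed.

Definition growth K b : R := K * expR (lambda * b).

Lemma growth_step K h : 0 <= K ->
  K + (c ^+ 3 + 1) * (h * (kappa * K)) <= growth K h.
Proof.
move=> K0; have := ler_wpM2l K0 (expR_ge1Dx (lambda * h)).
apply: le_trans; rewrite mulrDr mulr1 lerD2l /lambda le_eqVlt.
by apply/orP; left; apply/eqP; ring.
Qed.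

Lemma growthD K b b' : growth (growth K b) b' = growth K (b + b').
Proof. by rewrite /growth -mulrA -expRD -mulrDr. Qed.

Lemma growth_homo K b b' : 0 <= K -> b <= b' -> growth K b <= growth K b'.
Proof. by move=> K00 bb; rewrite ler_wpM2l// ler_expR ler_wpM2l. Qed.

Lemma growth0 K : growth K 0 = K.
Proof. by rewrite /growth mulr0 expR0 mulr1. Qed.

Lemma growth_ge K b : 0 <= K -> 0 <= b -> K <= growth K b.
Proof. by move=> K0 b0; rewrite -[leLHS]growth0; exact: growth_homo. Qed.

Lemma germ_path_diag eta eta' y s : delay_ok eta eta' -> 0 <= s -> s <= r ->
  @germ_path R n d X XX YX G dG eta eta' y s s = 0.
Proof.
move=> eo s0 sr; have [h [h0 h1 hK]] := rate_of_radius RS Kst1.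
have rK : Kst <= (h `^ beta)^-1 by rewrite hK.
have ssh : s - s <= h by rewrite subrr ltW.
apply: (germ_diag RS s0 (lexx s) sr ssh h0 h1 rK (y := y)) => //.
apply: (remainder_in_ball RS s0 (lexx s) sr ssh h0 h1 rK eo) => u t su ut ts.
have -> : u = t by lra.
by rewrite /remainder_path /=/remainder_path !subrr mulmx0 subrr normr0 mulr_ge0 ?exprn_ge0 ?powd_ge0 ?invr_ge0 ?powR_ge0.
Qed.

Lemma solves_start eta eta' xi : delay_ok eta eta' -> holder_path beta r 0 xi ->
  solves eta eta' 0 0 xi.
Proof.
move=> eo hx; split=> //; exists 1, 1; split=> // s t s0 st t0 _.
have ts : t = s by lra.
have s00 : s <= 0 by rewrite -ts.
have sr : s <= r by slra.
have z : p s s = 0 by rewrite /powd subrr powR0// gt_eqF.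
rewrite ts z !expr0n !mulr0 /remainder_path /davie_path.
by rewrite (drift_diag RS hx)// germ_path_diag// !subrr mulmx0 !subrr normr0.
Qed.

(** The windows shorten as the bound grows, but not below [hmin], because the bound is known in
    advance to stay below [growth K (r + 1)]; so finitely many reach [r]. *)
Lemma bounded_solution eta eta' xi K : delay_ok eta eta' -> holder_path beta r 0 xi ->
  c ^+ 3 + 1 <= K -> (forall t, - r <= t -> t <= 0 -> `|xi t| <= K) ->
  exists y, [/\ forall t, t <= 0 -> y t = xi t, solves eta eta' 0 r y &
    forall t, - r <= t -> t <= r -> `|y t| <= growth K (r + 1)].
Proof.
move=> eo hx cK xK.
match goal with |- ?g => set goal : Prop := g end.
have c30 : 0 <= c ^+ 3 by exact: exprn_ge0.
have K1 : 1 <= K by lra.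
have K0 : 0 <= K by lra.
have gr1 b : 0 <= b -> 1 <= growth K b by move=> b0; apply: le_trans (growth_ge K0 b0).
(* The bound obtained on the last window is that of its full length, which may overshoot [r] by at
   most 1; hence [r + 1]. *)
pose hmin := window_length (growth K (r + 1)).
have [hmin0 _ _ _ _] := window_lengthP (gr1 (r + 1) ltac:(slra)).
have [k kr] : exists k : nat, r < k%:R * hmin.
  exists (Num.bound (r / hmin)); rewrite -ltr_pdivrMr//.
  by apply: archi_boundP; rewrite divr_ge0// ltW.
(* Either [r] has been reached, or [k] windows have covered at least [k * hmin]; the chosen [k]
   excludes the second case. *)
suff : goal \/ exists b y, [/\ 0 <= b, b <= r, k%:R * hmin <= b &
    [/\ forall t, t <= 0 -> y t = xi t, solves eta eta' 0 b y &
    forall t, - r <= t -> t <= b -> `|y t| <= growth K b]].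
  by case=> // -[b [y [? ? ? _]]]; lra.
elim: k {kr} => [|k [IH|[b [y [b0 br kb [yx sy yK]]]]]].
- right; exists 0, xi; rewrite mul0r growth0; split=> //; first exact: ltW.
  by split=> //; exact: solves_start.
- by left.
have g1 := gr1 b b0.
have [h [hm [h0 h1 rK hK hE]]] : exists h, hmin <= h /\ [/\ 0 < h, h <= 1,
    Kst <= (h `^ beta)^-1, 4 * c * growth K b * h `^ (1 - beta) <= 1 &
    h `^ beta = h * (kappa * growth K b)].
  exists (window_length (growth K b)); split; last exact: window_lengthP.
  by apply: window_length_le => //; apply: growth_homo => //; lra.
have step b' : b <= b' -> b' <= r -> b' - b <= h ->
    exists z, [/\ forall t, t <= 0 -> z t = xi t, solves eta eta' 0 b' z &
      forall t, - r <= t -> t <= b' -> `|z t| <= growth K (b + h)].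
  move=> bb br' bbh.
  have cg : c ^+ 3 + 1 <= growth K b by apply: le_trans (growth_ge K0 b0).
  have hy : holder_path beta r b y by case: sy.
  have [z [zy sz _ zK]] := window_extend eo b0 bb br' bbh h0 h1 rK cg hK hy yK.
  have hyz : forall t, - r <= t -> t <= b -> y t = z t by move=> t _ tb; rewrite zy.
  have hzb : holder_path beta r b z by case: sz => hz _; exact: holder_path_le hz.
  exists z; split.
  - by move=> t t0; rewrite zy ?yx// (le_trans t0).
  - exact: (solves_glue RS eo b0 bb br' (solves_ext RS (lexx 0) hzb hyz sy) sz).
  move=> t rt tb'; case: (leP t b) => tb.
    rewrite zy//; apply: le_trans (yK t rt tb) _; apply: growth_homo => //.
    by rewrite lerDl ltW.
  apply: le_trans (zK t (ltW tb) tb') _; rewrite -growthD hE.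
  by apply: growth_step; lra.
have [bhr|bhr] := boolP (b + h <= r).
  have bbh : b <= b + h by rewrite lerDl ltW.
  have hh : b + h - b <= h by rewrite addrAC subrr add0r.
  have [z [zx sz zK]] := step (b + h) bbh bhr hh.
  right; exists (b + h), z; split=> //; first exact: le_trans bbh.
  by rewrite -natr1 mulrDl mul1r lerD.
have rbh : r - b <= h by rewrite lerBlDl ltW// ltNge.
have [z [zx sz zK]] := step r br (lexx r) rbh.
left; exists z; split=> // t rt tr; apply: le_trans (zK t rt tr) _.
by apply: growth_homo => //; exact: lerD.
Qed.

Lemma solves_sub eta eta' a b a' b' y : a <= a' -> b' <= b ->
  solves eta eta' a b y -> solves eta eta' a' b' y.
Proof.
move=> aa bb [hy [h [C [h0 hC]]]]; split; first exact: holder_path_le hy.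
exists h, C; split=> // s t sa st tb; apply: hC => //.
  exact: le_trans sa.
exact: le_trans bb.
Qed.

(** The windows of [bounded_solution] yield no remainder bound at one fixed scale. With the final
    bound known, the solution is rebuilt from an arbitrary time [s] on the window belonging to that
    bound; by uniqueness nothing has changed, and the remainder bound holds at a scale depending on
    [K] but not on the data. *)
Lemma global_existence K : c ^+ 3 + 1 <= K ->
  exists h, [/\ 0 < h, h <= 1, Kst <= (h `^ beta)^-1 &
  forall eta eta' xi, delay_ok eta eta' -> holder_path beta r 0 xi ->
  (forall t, - r <= t -> t <= 0 -> `|xi t| <= K) ->
  exists y, [/\ forall t, t <= 0 -> y t = xi t, solves eta eta' 0 r y &
    forall s t, 0 <= s -> s <= t -> t <= r -> t - s <= h ->
      `|remainder_path eta y s t| <= (h `^ beta)^-1 * p s t ^+ 2]].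
Proof.
move=> cK; have c30 : 0 <= c ^+ 3 by exact: exprn_ge0.
have K0 : 0 <= K by lra.
have r1 : 0 <= r + 1 by slra.
have Kg : K <= growth K (r + 1) by exact: growth_ge.
have g1 : 1 <= growth K (r + 1) by apply: le_trans Kg; lra.
have [h0 h1 rK hK _] := window_lengthP g1.
exists (window_length (growth K (r + 1))); split=> // eta eta' xi eo hx xK.
have [y [yx sy yK]] := bounded_solution eo hx cK xK.
exists y; split=> // s t s0 st tr tsh.
have cg : c ^+ 3 + 1 <= growth K (r + 1) by apply: le_trans Kg.
have hs : holder_path beta r s y by case: sy => hy _; apply: holder_path_le hy; lra.
have [|z [zy sz rz _]] := window_extend eo s0 st tr tsh h0 h1 rK cg hK hs.
  by move=> u ru us; apply: yK => //; lra.
have zyt := local_uniqueness RS eo s0 st tr sz (solves_sub s0 tr sy)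
  (fun u _ us => zy u us).
rewrite -(remainder_eq eta (zy s (lexx s)) (zyt t _ (lexx t))); first exact: rz.
by apply: le_trans (le_trans s0 st); rewrite oppr_le0 ltW.
Qed.

End existence.

(** * The drift *)

Section integrals.
Context {R : realType}.
Notation mu := (@lebesgue_measure R).
Implicit Types (f g : R -> R) (s t u a b K : R).

Lemma continuous_integrable_itv f a b : continuous f ->
  mu.-integrable `[a, b] (EFin \o f).
Proof.
move=> cf; apply: (@continuous_compact_integrable R f); first exact: segment_compact.
exact: continuous_subspaceT.
Qed.

Lemma Rintegral_itv_add f s u t : continuous f -> s <= u -> u <= t ->
  \int[mu]_(x in `[s, t]) f x = \int[mu]_(x in `[s, u]) f x + \int[mu]_(x in `[u, t]) f x.
Proof.
move=> cf su ut.
have := @Rintegral_itvB R f (BLeft s) (BRight t) u (continuous_integrable_itv _ _ cf).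
rewrite !bnd_simp => /(_ su ut) /eqP; rewrite subr_eq => /eqP ->.
rewrite addrC Rintegral_itv_obnd_cbnd//.
apply: (@integrableS _ _ _ mu `[u, t]) => //.
  exact: subset_itv_oc_cc.
exact: continuous_integrable_itv.
Qed.

Lemma Rintegral_itv_le f s t K : continuous f -> s <= t ->
  (forall u, s <= u -> u <= t -> `|f u| <= K) ->
  `|\int[mu]_(x in `[s, t]) f x| <= K * (t - s).
Proof.
move=> cf st fK; apply: le_trans (le_normr_Rintegral _ _) _ => //.
  exact: continuous_integrable_itv.
have -> : K * (t - s) = \int[mu]_(x in `[s, t]) K.
  rewrite Rintegral_cst//= lebesgue_measure_itv/= lte_fin.
  by move: st; rewrite le_eqVlt => /predU1P[->|->//]; rewrite ltxx subrr.
apply: le_Rintegral => //.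
- apply: (continuous_integrable_itv (f := fun x => `|f x|)) => x.
  by apply: continuous_comp; [exact: cf|exact: norm_continuous].
- by apply: (continuous_integrable_itv (f := fun=> K)) => x; exact: cvg_cst.
- by move=> x /=; rewrite in_itv/= => /andP[]; exact: fK.
Qed.

(** Substitution along the translation by [c]. *)
Lemma Rintegral_itv_shift f s t c : continuous f -> s <= t ->
  \int[mu]_(x in `[s + c, t + c]) f x = \int[mu]_(x in `[s, t]) f (x + c).
Proof.
move=> cf st; congr fine.
pose F x : R := x + c.
have dF (x : R) : is_derive x (1 : R) F (1 : R).
  have := is_deriveD (is_derive_id x (1 : R)) (is_derive_cst c x (1 : R)).
  by rewrite addr0.
have F1 : derive1 F = cst 1.
  by apply/funext => x; rewrite derive1E derive_val.
rewrite (@integration_by_substitution_increasing R F f s t) ?F1//.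
- by apply: eq_integral => x _; rewrite fctE/= mulr1.
- by move=> x y _ _; rewrite ltrD2r.
- by move=> x _; exact: cst_continuous.
- by apply: is_cvg_cst.
- by apply: is_cvg_cst.
- split.
  + by move=> x _; exact: (@ex_derive _ _ _ _ _ _ _ (dF x)).
  + have cF : continuous F by move=> x; apply: cvgD; [exact: cvg_id|exact: cvg_cst].
    exact/cvg_at_right_filter/cF.
  + have cF : continuous F by move=> x; apply: cvgD; [exact: cvg_id|exact: cvg_cst].
    exact/cvg_at_left_filter/cF.
- exact: continuous_subspaceT.
Qed.

End integrals.

Section charge_integral.
Context {R : realType} (nu : {charge set (measurableTypeR R) -> \bar R}).
Implicit Types (f g : R -> R) (a b K : R) (D : set (measurableTypeR R)).

Lemma charge_integral_jordan : exists mp mn : {finite_measure set (measurableTypeR R) -> \bar R},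
  forall D f, charge_integral nu D f = \int[mp]_(x in D) f x - \int[mn]_(x in D) f x.
Proof.
rewrite /charge_integral; case: cid => P hP; case: cid => N hPN.
by exists (jordan_pos hPN), (jordan_neg hPN).
Qed.

Lemma eq_charge_integral D f g : {in D, f =1 g} ->
  charge_integral nu D f = charge_integral nu D g.
Proof.
have [mp [mn E]] := charge_integral_jordan.
by move=> fg; rewrite !E; congr (_ - _); exact: eq_Rintegral.
Qed.

Lemma finite_measure_integrable (m : {finite_measure set (measurableTypeR R) -> \bar R}) a b f :
  continuous f -> m.-integrable `[a, b] (EFin \o f).
Proof.
move=> cf; apply: measurable_bounded_integrable => //.
- by rewrite -ge0_fin_numE ?measure_ge0 ?fin_num_measure.
- apply: (@measurable_funS _ _ (measurableTypeR R) (measurableTypeR R) setT) => //; exact: continuous_measurable_fun.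
have /compact_bounded[M [_ hM]] := continuous_compact (continuous_subspaceT cf)
  (@segment_compact R a b).
by exists M; split; rewrite ?num_real // => ? ? ? ?; exact: hM.
Qed.

Lemma charge_integralB a b f g : continuous f -> continuous g ->
  charge_integral nu `[a, b] (fun x => f x - g x) =
  charge_integral nu `[a, b] f - charge_integral nu `[a, b] g.
Proof.
move=> cf cg; have [mp [mn E]] := charge_integral_jordan.
rewrite !E !RintegralB//; try exact: finite_measure_integrable.
by ring.
Qed.

Lemma charge_integral_le a b : exists2 M, 0 <= M & forall f K, continuous f ->
  (forall x, a <= x -> x <= b -> `|f x| <= K) ->
  `|charge_integral nu `[a, b] f| <= M * K.
Proof.
have [mp [mn E]] := charge_integral_jordan.
have m0 (m : {finite_measure set (measurableTypeR R) -> \bar R}) :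
  0 <= fine (m `[a, b]%classic) by rewrite fine_ge0.
have mle (m : {finite_measure set (measurableTypeR R) -> \bar R}) f K :
    continuous f -> (forall x, a <= x -> x <= b -> `|f x| <= K) ->
    `|\int[m]_(x in `[a, b]) f x| <= fine (m `[a, b]%classic) * K.
  move=> cf fK; apply: le_trans (le_normr_Rintegral _ _) _ => //.
    exact: finite_measure_integrable.
  rewrite mulrC -Rintegral_cst//; apply: le_Rintegral => //.
  - apply: (@finite_measure_integrable m a b (fun x => `|f x|)) => x.
    by apply: continuous_comp; [exact: cf|exact: norm_continuous].
  - by apply: (@finite_measure_integrable m a b (fun=> K)) => x; exact: cvg_cst.
  - by move=> x /=; rewrite in_itv/= => /andP[]; exact: fK.
exists (fine (mp `[a, b]%classic) + fine (mn `[a, b]%classic)); first exact: addr_ge0.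
move=> f K cf fK; rewrite E mulrDl; apply: le_trans (ler_normB _ _) _.
by apply: lerD; exact: mle.
Qed.

End charge_integral.

Section drift.
Context {R : realType} {n : nat} (r : R).
Context (A : {linear ('cV[R]_n * 'cV[R]_n)%type -> 'cV[R]_n}).
Context (pi : 'I_n -> 'I_n -> {charge set (measurableTypeR R) -> \bar R}).
Implicit Types (s t u a b K e : R) (y : R -> 'cV[R]_n).

Lemma holder_continuous (V : normedModType R) (f : R -> V) beta (C : R) : 0 < beta ->
  (forall s t, s <= t -> `|f t - f s| <= C * (t - s) `^ beta) -> continuous f.
Proof.
move=> beta0 fC x; apply/cvgrPdist_le => /= e e0.
pose k := `|C| + 1.
have k0 : 0 < k by rewrite ltr_wpDl.
have fk u v : `|f u - f v| <= k * `|u - v| `^ beta.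
  wlog vu : u v / v <= u => [H|].
    have [/H//|/ltW/H] := leP v u.
    by rewrite distrC [`|v - u|]distrC.
  rewrite ger0_norm ?subr_ge0//; apply: le_trans (fC _ _ vu) _.
  rewrite ler_wpM2r ?powR_ge0//; apply: le_trans (ler_norm _) _.
  by rewrite lerDl.
have d0 : 0 < (e / k) `^ beta^-1 by rewrite powR_gt0// divr_gt0.
near=> t; apply: le_trans (fk _ _) _.
rewrite mulrC -ler_pdivlMr//.
have : `|x - t| <= (e / k) `^ beta^-1.
  by near: t; exact: (@cvgr_dist_le R R^o R (nbhs x) _ id x cvg_id).
move=> h; apply: (@le_trans _ _ (((e / k) `^ beta^-1) `^ beta)).
  by rewrite ge0_ler_powR ?nnegrE ?(ltW beta0) ?(ltW d0).
by rewrite -powRrM mulVf ?gt_eqF// powRr1// divr_ge0// ltW.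
Unshelve. all: by end_near. Qed.

Lemma vec_entry_continuous y i (c : R) : continuous y ->
  continuous (fun x => y (x + c) i 0).
Proof.
move=> cy x; apply: (@continuous_comp _ _ _ (fun x => y (x + c)) (fun M : 'cV[R]_n => M i 0)).
  apply: (@continuous_comp _ _ _ (fun x : R => x + c) y); last exact: cy.
  by apply: (@cvgD R R^o); [exact: cvg_id|exact: cvg_cst].
exact: coord_continuous.
Qed.

(** Two paths and two times at once: equal paths give continuity in time, equal times give the
    Lipschitz dependence on the path. *)
Lemma delay_average_diff : exists2 M, 0 <= M & forall y1 y2 t1 t2 K,
  continuous y1 -> continuous y2 ->
  (forall th, - r <= th -> th <= 0 -> `|y1 (th + t1) - y2 (th + t2)| <= K) ->
  0 <= r -> `|delay_average r pi y1 t1 - delay_average r pi y2 t2| <= M * K.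
Proof.
have [M M0 hM] : exists2 M : 'I_n -> 'I_n -> R, forall i j, 0 <= M i j &
    forall i j f K, continuous f -> (forall x, - r <= x -> x <= 0 -> `|f x| <= K) ->
    `|charge_integral (pi i j) `[- r, 0] f| <= M i j * K.
  exists (fun i j => sval (cid2 (charge_integral_le (pi i j) (- r) 0))) => i j.
    by case: cid2.
  by case: cid2 => /= M' M'0 h f K; exact: h.
exists (\sum_j \sum_i M i j).
  by apply: sumr_ge0 => j _; apply: sumr_ge0 => i _; exact: M0.
move=> y1 y2 t1 t2 K c1 c2 yK r0.
have K0 : 0 <= K.
  by apply: le_trans (normr_ge0 _) (yK 0 _ (lexx 0)); rewrite oppr_le0.
apply: mx_norm_le => [|j k]; first by rewrite mulr_ge0// sumr_ge0// => j _; exact: sumr_ge0.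
rewrite !mxE -sumrB; apply: le_trans (ler_norm_sum _ _ _) _.
apply: (@le_trans _ _ (\sum_i M i j * K)); last first.
  rewrite -mulr_suml ler_wpM2r// [leRHS](bigD1 j)//= lerDl.
  by apply: sumr_ge0 => l _; exact: sumr_ge0.
apply: ler_sum => i _.
rewrite -charge_integralB; try exact: vec_entry_continuous.
apply: hM => [x|x rx x0].
  by apply: cvgB; exact: vec_entry_continuous.
apply: le_trans (yK x rx x0).
by have := mx_norm_ge_entry (y1 (x + t1) - y2 (x + t2)) i 0; rewrite !mxE.
Qed.

Lemma linear_le : exists2 M, 0 <= M & forall x, `|A x| <= M * `|x|.
Proof.
pose M := \sum_i (`|A (delta_mx i 0, 0)| + `|A (0, delta_mx i 0)|).
exists M; first by apply: sumr_ge0 => i _; rewrite addr_ge0.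
move=> x.
have xE : x = \sum_i (x.1 i 0 *: (delta_mx i 0, 0) + x.2 i 0 *: (0, delta_mx i 0)).
  have vE (v : 'cV[R]_n) : v = \sum_i v i 0 *: delta_mx i 0.
    by rewrite [LHS]matrix_sum_delta; apply: eq_bigr => i _; rewrite big_ord1.
  rewrite [LHS]surjective_pairing [RHS]surjective_pairing; congr pair.
    rewrite (raddf_sum (@fst _ _)) [LHS]vE; apply: eq_bigr => i _ /=.
    by rewrite scaler0 addr0.
  rewrite (raddf_sum (@snd _ _)) [LHS]vE; apply: eq_bigr => i _ /=.
  by rewrite scaler0 add0r.
have AE (k l : R) (p q : 'cV[R]_n * 'cV[R]_n) :
    A (k *: p + l *: q) = k *: A p + l *: A q.
  by rewrite linearP linearZZ.
rewrite {1}xE raddf_sum mulr_suml; apply: le_trans (ler_norm_sum _ _ _) _.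
apply: ler_sum => i _; apply: (@le_trans _ _
  `|x.1 i 0 *: A (delta_mx i 0, 0) + x.2 i 0 *: A (0, delta_mx i 0)|).
  by rewrite -AE.
apply: le_trans (ler_normD _ _) _; rewrite !normrZ mulrDl.
apply: lerD; rewrite mulrC ler_wpM2l//; apply: le_trans (mx_norm_ge_entry _ _ _) _.
  exact: prod_norm_fst.
exact: prod_norm_snd.
Qed.

Section globally_holder.
Variables (beta C : R).
Hypotheses (beta0 : 0 < beta) (r0 : 0 <= r).

Definition globally_holder (y : R -> 'cV[R]_n) :=
  forall s t, s <= t -> `|y t - y s| <= C * (t - s) `^ beta.

(** Extension by constants makes the path Hölder, hence continuous, on the whole line, which
    provides integrability; the drift over subintervals of [[0, b]] sees only the values on
    [[-r, b]]. *)
Lemma holder_path_clamp y b : 0 <= b ->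
  (forall s t, - r <= s -> s <= t -> t <= b -> `|y t - y s| <= C * powd beta s t) ->
  0 <= C -> globally_holder (y \o clamp (- r) b).
Proof.
move=> b0 hy C0 s t st /=; have rb : - r <= b by move: (r0); lra.
have bnd x := clamp_itv x rb.
have /andP[ge _] := bnd s; have /andP[_ le] := bnd t.
apply: le_trans (hy _ _ ge (clamp_homo rb st) le) _.
rewrite ler_wpM2l// ge0_ler_powR ?nnegrE ?(ltW beta0)//.
- by rewrite subr_ge0 clamp_homo.
- by rewrite subr_ge0.
- exact: clamp_lip.
Qed.

Definition drift_rate y u := A (y u, delay_average r pi y u).

Lemma drift_rate_continuous y : globally_holder y ->
  forall k, continuous (fun u => drift_rate y u k 0).
Proof.
move=> hy k; have [MA MA0 hA] := linear_le.
have [M M0 hM] := delay_average_diff.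
have cy := holder_continuous beta0 hy.
have C0 : 0 <= C.
  have := hy 0 1 ler01; rewrite subr0 powR1 mulr1; exact: le_trans.
apply: (holder_continuous (C := MA * ((M + 1) * C)) beta0) => s t st.
have := mx_norm_ge_entry (drift_rate y t - drift_rate y s) k 0; rewrite !mxE => /le_trans; apply.
rewrite /drift_rate -linearB; apply: le_trans (hA _) _; rewrite -mulrA ler_wpM2l//.
apply: prod_norm_le => /=.
  apply: le_trans (hy s t st) _; rewrite -mulrA ler_peMl//; last by rewrite lerDr.
  by rewrite mulr_ge0// powR_ge0.
apply: le_trans (hM y y t s (C * (t - s) `^ beta) cy cy _ r0) _.
  move=> th _ _; have -> : t - s = (th + t) - (th + s) by ring.
  by apply: hy; rewrite lerD2l.
by rewrite !mulrA ler_wpM2r ?powR_ge0// ler_wpM2r// lerDl.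
Qed.

Lemma drift_integral_clamp y b s t : 0 <= s -> s <= t -> t <= b ->
  drift_integral r A pi y s t = drift_integral r A pi (y \o clamp (- r) b) s t.
Proof.
move=> s0 st tb; apply/matrixP => k j; rewrite [LHS]mxE [RHS]mxE.
apply: eq_Rintegral => u; rewrite inE/= in_itv/= => /andP[su ut].
rewrite clamp_id; [|move: (r0); lra|lra].
have -> // : delay_average r pi y u = delay_average r pi (y \o clamp (- r) b) u.
apply/matrixP => l m; rewrite !mxE; apply: eq_bigr => i _.
apply: eq_charge_integral => th; rewrite inE/= in_itv/= => /andP[rth th0].
by rewrite clamp_id//; lra.
Qed.

End globally_holder.

Lemma holder_pathP beta b y : 0 < beta -> 0 <= r -> 0 <= b -> holder_path beta r b y ->
  exists C, globally_holder beta C (y \o clamp (- r) b).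
Proof.
move=> beta0 r0 b0 [C hC]; exists `|C|; apply: holder_path_clamp => // s t rs st tb.
by apply: le_trans (hC s t rs st tb) _; rewrite ler_wpM2r ?powR_ge0// ler_norm.
Qed.

Lemma drift_integral_bounds beta : 0 < beta -> 0 <= r -> exists2 M, 0 <= M &
  [/\ forall y b, holder_path beta r b y ->
    forall s u t, 0 <= s -> s <= u -> u <= t -> t <= b ->
      drift_integral r A pi y s t = drift_integral r A pi y s u + drift_integral r A pi y u t,
  forall y b K, holder_path beta r b y ->
    (forall t, - r <= t -> t <= b -> `|y t| <= K) ->
    forall s t, 0 <= s -> s <= t -> t <= b ->
      `|drift_integral r A pi y s t| <= M * K * (t - s) &
  forall y1 y2 b e,
    holder_path beta r b y1 -> holder_path beta r b y2 ->
    (forall t, - r <= t -> t <= b -> `|y1 t - y2 t| <= e) ->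
    forall s t, 0 <= s -> s <= t -> t <= b ->
      `|drift_integral r A pi y1 s t - drift_integral r A pi y2 s t| <= M * e * (t - s)].
Proof.
move=> beta0 r0; have [MA MA0 hA] := linear_le.
have [M M0 hM] := delay_average_diff.
have diff y1 y2 b e : holder_path beta r b y1 -> holder_path beta r b y2 ->
    (forall t, - r <= t -> t <= b -> `|y1 t - y2 t| <= e) ->
    forall s t, 0 <= s -> s <= t -> t <= b ->
      `|drift_integral r A pi y1 s t - drift_integral r A pi y2 s t|
        <= MA * (M + 1) * e * (t - s).
  move=> hy1 hy2 ye s t s0 st tb.
  have b0 : 0 <= b by lra.
  have rb : - r <= b by lra.
  have [C1 hC1] := holder_pathP beta0 r0 b0 hy1.
  have [C2 hC2] := holder_pathP beta0 r0 b0 hy2.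
  have e0 : 0 <= e by apply: le_trans (normr_ge0 _) (ye _ rb (lexx b)).
  rewrite (drift_integral_clamp r0 y1 s0 st tb) (drift_integral_clamp r0 y2 s0 st tb).
  set z1 := y1 \o _ in hC1 *; set z2 := y2 \o _ in hC2 *.
  have ze u : `|z1 u - z2 u| <= e by have /andP[] := clamp_itv u rb; exact: ye.
  have cz1 := holder_continuous beta0 hC1; have cz2 := holder_continuous beta0 hC2.
  apply: mx_norm_le => [|k j].
    by rewrite mulr_ge0 ?subr_ge0// mulr_ge0// mulr_ge0// addr_ge0.
  rewrite [X in `|X|]mxE [X in `|_ + X|]mxE [X in `|X + _|]mxE [X in `|_ - X|]mxE.
  have c1 := drift_rate_continuous beta0 r0 hC1 (k := k).
  have c2 := drift_rate_continuous beta0 r0 hC2 (k := k).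
  rewrite -RintegralB//; try exact: continuous_integrable_itv.
  apply: Rintegral_itv_le => // [x|u su ut].
    by apply: cvgB; [exact: c1|exact: c2].
  have := mx_norm_ge_entry (drift_rate z1 u - drift_rate z2 u) k 0.
  rewrite !mxE => /le_trans; apply.
  rewrite /drift_rate -linearB; apply: le_trans (hA _) _; rewrite -mulrA ler_wpM2l//.
  apply: prod_norm_le => /=.
    by apply: le_trans (ze u) _; rewrite ler_peMl// lerDr.
  apply: le_trans (hM z1 z2 u u e cz1 cz2 _ r0) _; first by move=> th _ _; exact: ze.
  by rewrite ler_wpM2r// lerDl.
exists (MA * (M + 1)); first by rewrite mulr_ge0// addr_ge0.
split=> //.
  move=> y b hy s u t s0 su ut tb.
  have b0 : 0 <= b by lra.
  have ub : u <= b by lra.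
  have u0 : 0 <= u by lra.
  have [C hC] := holder_pathP beta0 r0 b0 hy.
  rewrite (drift_integral_clamp r0 _ s0 (le_trans su ut) tb).
  rewrite (drift_integral_clamp r0 _ s0 su ub) (drift_integral_clamp r0 _ u0 ut tb).
  apply/matrixP => k j; rewrite [LHS]mxE [RHS]mxE [X in X + _]mxE [X in _ + X]mxE.
  by apply: Rintegral_itv_add => //; exact: drift_rate_continuous hC k.
move=> y b K hy yK s t s0 st tb.
(* The bound for one path is the difference estimate against the zero path, whose drift vanishes. *)
have h0 : holder_path beta r b (fun=> 0 : 'cV[R]_n).
  by exists 0 => *; rewrite subrr normr0 mul0r.
have z0 : drift_integral r A pi (fun=> 0) s t = 0.
  have b0 : 0 <= b by lra.
  have a0 u : delay_average r pi (fun=> 0) u = 0.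
    apply/matrixP => k j; rewrite !mxE; apply: big1 => i _.
    have [L L0 hL] := charge_integral_le (pi i k) (- r) 0.
    have h1 : continuous (fun _ : R => 0 : R) by move=> x; exact: cvg_cst.
    have h2 x : - r <= x -> x <= 0 -> `|0 : R| <= 0 by rewrite normr0.
    have := hL _ 0 h1 h2; rewrite mulr0 normr_le0 => /eqP h3.
    rewrite -[RHS]h3; apply: eq_charge_integral => x _; exact: mxE.
  apply/matrixP => k j; rewrite [LHS]mxE [RHS]mxE.
  rewrite (eq_Rintegral _ (g := fun=> 0)) ?Rintegral_cst ?mul0r//.
  by move=> u _; rewrite a0 linear0 mxE.
have := diff y (fun=> 0) b K hy h0 _ s t s0 st tb.
by rewrite z0 subr0; apply => u ru ub; rewrite subr0; exact: yK.
Qed.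

Lemma drift_integral_shift beta b o y s t : 0 < beta -> 0 <= r ->
  holder_path beta r b (fun u => y (o + u)) -> 0 <= s -> s <= t -> t <= b ->
  drift_integral r A pi y (o + s) (o + t) = drift_integral r A pi (fun u => y (o + u)) s t.
Proof.
move=> beta0 r0 hy s0 st tb; have b0 : 0 <= b by lra.
have [C hC] := holder_pathP beta0 r0 b0 hy.
rewrite (drift_integral_clamp r0 _ s0 st tb).
set z := _ \o _ in hC *; apply/matrixP => k j; rewrite [LHS]mxE [RHS]mxE.
have cz := drift_rate_continuous beta0 r0 hC (k := k).
pose f u := drift_rate z (u - o) k 0.
have cf : continuous f.
  move=> x; apply: (@continuous_comp _ _ _ (fun x : R => x - o)
    (fun u => drift_rate z u k 0)); last exact: cz.
  by apply: (@cvgB R R^o); [exact: cvg_id|exact: cvg_cst].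
transitivity (\int[lebesgue_measure]_(u in `[s + o, t + o]) f u); last first.
  rewrite (Rintegral_itv_shift o cf st); congr (Rintegral _ _ _).
  by apply/funext => u; rewrite /f addrK.
rewrite (addrC o s) (addrC o t); apply: eq_Rintegral => u; rewrite inE/= in_itv/= => /andP[su ut].
rewrite /f /drift_rate /z /=.
have -> : y u = y (o + clamp (- r) b (u - o)).
  by rewrite clamp_id; [congr y; ring|lra|lra].
have -> // : delay_average r pi y u =
  delay_average r pi ((fun u => y (o + u)) \o clamp (- r) b) (u - o).
apply/matrixP => l m; rewrite [LHS]mxE [RHS]mxE; apply: eq_bigr => i _.
apply: eq_charge_integral => th; rewrite inE/= in_itv/= => /andP[rth th0].
by rewrite clamp_id; [congr (y _ _ _); ring|lra|lra].
Qed.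

End drift.

(** * The rough integral and Davie's estimate *)

Lemma small_power (R : realType) (C al e : R) : 0 <= C -> 0 < al -> 0 < e ->
  exists2 delta : R, 0 < delta & forall x, 0 <= x -> x <= delta -> C * x `^ al <= e.
Proof.
move=> C0 al0 e0; have C1 : 0 < C + 1 by rewrite ltr_wpDl.
exists ((e / (C + 1)) `^ al^-1); first by rewrite powR_gt0// divr_gt0.
move=> x x0 xd.
have ec : 0 <= e / (C + 1) by rewrite divr_ge0// ltW.
apply: (@le_trans _ _ ((C + 1) * (e / (C + 1)))); last first.
  by rewrite mulrCA divff ?mulr1// gt_eqF.
apply: ler_pM => //; [exact: powR_ge0|by rewrite lerDl|].
have -> : e / (C + 1) = ((e / (C + 1)) `^ al^-1) `^ al.
  by rewrite -powRrM mulVf ?powRr1// gt_eqF.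
by rewrite ge0_ler_powR ?nnegrE ?powR_ge0// ltW.
Qed.

(* Intervals [x, y] of the partition with x <= J k < y, of which there is at
   most one for each k, only need to contribute errors tending to 0. *)
Lemma partition_limit_junctions (R : realType) (V : normedModType R)
    (F : R -> R -> V) (I : R -> V) (a b beta h C : R) (J : nat -> R) (N : nat) :
  3^-1 < beta -> a <= b -> 0 < h ->
  (forall x y, a <= x -> x < y -> y <= b -> y - x < h ->
    (forall k, (k < N)%N -> ~~ (x <= J k < y)) ->
    `|I y - I x - F x y| <= C * (y - x) `^ (3 * beta)) ->
  (forall x y, a <= x -> x < y -> y <= b -> y - x < h ->
    `|I y - I x - F x y| <= C * (y - x) `^ beta) ->
  is_partition_limit F a b (I b - I a).
Proof.
move=> bg ab h0 smooth jump; apply: is_partition_limit_intro => eps e0.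
have beta0 : 0 < beta by apply: lt_trans bg; rewrite invr_gt0.
have b3 : 0 < 3 * beta - 1 by move: bg; lra.
have ba1 : 0 < b - a + 1 by lra.
pose e1 := eps / (2 * (b - a + 1)).
have e10 : 0 < e1 by rewrite divr_gt0// mulr_gt0.
(* The successor covers the case [N = 0]. *)
pose w := eps / (2 * N.+1%:R).
have w0 : 0 < w by rewrite divr_gt0// mulr_gt0.
have C0 : 0 <= `|C| by [].
have [d1 d10 h1] := small_power C0 b3 e10.
have [d2 d20 h2] := small_power C0 beta0 w0.
(* A multiple of the length plus a weighted count of junctions. Counting in half-open intervals
   makes the control additive and meets each junction once. *)
exists (fun x y : R => e1 * (y - x) + \sum_(k < N) (x <= J k < y)%R%:R * w).
  split.
  - move=> x; rewrite subrr mulr0 add0r; apply: big1 => k _.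
    by rewrite leNgt andNb mul0r.
  - move=> x y z xy yz; rewrite addrACA -mulrDr -big_split/=.
    congr (e1 * _ + _); first ring.
    apply: eq_bigr => k _; rewrite -mulrDl -natrD; congr (_%:R * w).
    case: (leP x (J k)) => xJ /=.
      case: (leP y (J k)) => yJ; rewrite ?(ltNge (J k) y) ?yJ//=.
      by rewrite (lt_le_trans yJ yz).
    by rewrite leNgt (lt_trans xJ xy).
  have h3 : e1 * (b - a) < eps / 2.
    have : e1 * (b - a + 1) = eps / 2 by rewrite /e1; field; rewrite gt_eqF.
    by move: e10; lra.
  have h4 : \sum_(k < N) (a <= J k < b)%R%:R * w <= eps / 2.
    apply: (@le_trans _ _ (\sum_(k < N) w)).
      by apply: ler_sum => k _; rewrite ler_piMl ?(ltW w0)// lern1 leq_b1.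
    have : N.+1%:R * w = eps / 2 by rewrite /w; field; rewrite nat1r pnatr_eq0.
    rewrite sumr_const card_ord -natr1 mulrDl mul1r mulr_natl; move: w0; lra.
  lra.
exists (Num.min h (Num.min d1 d2)); first by rewrite !lt_min h0 d10.
move=> x y ax xy yb; rewrite !lt_min => /and3P[yh y1 y2].
have yx0 : 0 <= y - x by rewrite subr_ge0 ltW.
have S0 : 0 <= \sum_(k < N) (x <= J k < y)%R%:R * w.
  by apply: sumr_ge0 => k _; rewrite mulr_ge0// ltW.
have [/existsP[k kJ]|noJ] := boolP [exists k : 'I_N, x <= J k < y].
  apply: le_trans (jump x y ax xy yb yh) _.
  apply: le_trans (ler_wpM2r (powR_ge0 _ _) (ler_norm C)) _.
  apply: le_trans (h2 _ yx0 (ltW y2)) _.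
  rewrite (bigD1 k)//= kJ mul1r addrA [X in _ <= X + _]addrC -addrA lerDl.
  apply: addr_ge0; first by rewrite mulr_ge0// ltW.
  by apply: sumr_ge0 => l _; rewrite mulr_ge0// ltW.
apply: le_trans (smooth x y ax xy yb yh _) _.
  move=> k kN; apply: contra noJ => kJ; apply/existsP; by exists (Ordinal kN).
apply: le_trans (ler_wpM2r (powR_ge0 _ _) (ler_norm C)) _.
have -> : (y - x) `^ (3 * beta) = (y - x) `^ (3 * beta - 1) * (y - x).
  rewrite -{3}[y - x]powRr1// -powRD ?subrK//.
  by rewrite gt_eqF//; apply: lt_trans b3 _; lra.
have := ler_wpM2r yx0 (h1 _ yx0 (ltW y1)); rewrite -mulrA; lra.
Qed.

Section davie_limit.
Context {R : realType} {n d : nat} {beta r : R}.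
Context {X Y : R -> 'cV[R]_d} {XX YX : R -> R -> 'M[R]_d}.
Context {G : 'cV[R]_n * 'cV[R]_n -> 'M[R]_(n, d)}.
Context {dG : 'cV[R]_n * 'cV[R]_n -> 'cV[R]_n * 'cV[R]_n -> 'M[R]_(n, d)}.
Context {Dr : (R -> 'cV[R]_n) -> R -> R -> 'cV[R]_n} {c : R}.
Hypothesis RS : rough_setting beta r X Y XX YX G dG Dr c.
Local Notation p := (powd beta).
Local Notation Kst := (@Kst R beta c).
Local Notation cc := (@cc R c).
Local Notation deriv_path := (@deriv_path R n d G).
Local Notation germ_path := (@germ_path R n d X XX YX G dG).
Implicit Types (s t u a b h o : R).

Lemma powd_shift o s t : p (o + s) (o + t) = p s t.
Proof. by congr (_ `^ _); ring. Qed.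

(** [F] is the germ except on intervals starting at the left end, where it is merely of order [p].
    So the increment of the sewn path is also a limit of the sums of [F]; by uniqueness of the limit
    it equals [I], and the sewing estimate becomes Davie's estimate. *)
Lemma davie_of_limit eta eta' y s t h o C (F : R -> R -> 'cV[R]_n) I :
  0 <= s -> s < t -> t <= r -> t - s <= h -> 0 < h -> h <= 1 ->
  Kst <= (h `^ beta)^-1 ->
  @delay_ok R n d beta r Y c eta eta' ->
  @in_ball R n d beta X c s t (h `^ beta)^-1 y (deriv_path eta y) ->
  (forall u v, s < u -> u < v -> v <= t -> F (o + u) (o + v) = germ_path eta eta' y u v) ->
  (forall v, s < v -> v <= t -> `|F (o + s) (o + v)| <= C * p s v) ->
  is_partition_limit F (o + s) (o + t) I ->
  `|I - germ_path eta eta' y s t|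
    <= sewing_const (3 * beta) * (11 * cc ^+ 7 * (h `^ beta)^-1) * p s t ^+ 3.
Proof.
move=> s0 st tr tsh h0 h1 rK eo yb Fg Fs FI.
have c1 : 1 <= c := rs_c RS; have c0 : 0 <= c by apply: le_trans c1.
have bg : 3^-1 < beta := rs_beta_gt RS.
have cc1' : 1 <= cc by exact: (cc1 RS).
have cc0 : 0 <= cc by apply: le_trans cc1'.
have th1 : 1 < 3 * beta by move: bg; lra.
have SS0 : 0 <= sewing_const (3 * beta) by apply: le_trans (sewing_const_ge1 th1).
have rho0 : 0 <= (h `^ beta)^-1 by rewrite invr_ge0 powR_ge0.
set K := 11 * cc ^+ 7 * (h `^ beta)^-1; set S := sewing_const _ * K.
have K0 : 0 <= K by rewrite !mulr_ge0 ?exprn_ge0.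
have S0 : 0 <= S by rewrite mulr_ge0.
have [||J hJ] := @sewing R n 1 (germ_path eta eta' y) s t (3 * beta) K (ltW st) th1 K0.
- by move=> u /andP[su ut]; exact: (germ_diag RS s0 (ltW st) tr tsh h0 h1 rK yb eo).
- move=> u v w su uv vw wt; rewrite -powd3.
  exact: (lift_defect RS s0 (ltW st) tr tsh h0 h1 rK yb eo).
have p1 u v : s <= u -> u <= v -> v <= t -> p u v <= 1.
  by move=> su uv vt; exact: (powd_le1 RS s0 (ltW st) tr tsh h0 h1 rK).
pose Cg := c * c * c + 2 * cc ^+ 5.
have Cg0 : 0 <= Cg by rewrite addr_ge0 ?mulr_ge0 ?exprn_ge0.
have gb u v : s <= u -> u <= v -> v <= t -> `|germ_path eta eta' y u v| <= Cg * p u v.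
  move=> su uv vt; have p0 := powd_ge0 (beta := beta) u v.
  rewrite /germ_path /germ; apply: le_trans (ler_normD _ _) _; rewrite mulrDl; apply: lerD.
    apply: le_trans (norm_mulmx_le (rs_d RS) (C3_bound0 (rs_C3 RS) _) (rs_X RS _ uv _)) _.
    - exact: le_trans su.
    - exact: le_trans vt tr.
    by rewrite !mulrA.
  apply: le_trans (lift_tensor RS s0 (ltW st) tr tsh h0 h1 yb eo su uv vt) _.
  by rewrite ler_wpM2l ?mulr_ge0 ?exprn_ge0// expr2 ler_piMl// p1.
have oK x : o + x - o = x by rewrite addrAC subrr add0r.
have lim : is_partition_limit F (o + s) (o + t) (J t - J s).
  (* A single junction, the left end [o + s]. *)
  have := @partition_limit_junctions R _ F (fun x => J (x - o)) (o + s) (o + t) beta 1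
    (S + Cg + `|C|) (fun=> o + s) 1 bg.
  rewrite !oK; apply => //; first by rewrite lerD2l ltW.
    move=> x x' sx xx xt _ /(_ 0 isT) sx'.
    have {}sx : o + s < x.
      rewrite lt_neqAle sx andbT; apply/eqP => E; move: sx'.
      by rewrite E lexx xx.
    have -> : F x x' = germ_path eta eta' y (x - o) (x' - o).
      by rewrite -Fg; [congr F; ring|lra|lra|lra].
    have := hJ (x - o) (x' - o) ltac:(lra) ltac:(lra) ltac:(lra).
    rewrite (_ : x' - o - (x - o) = x' - x); last by ring.
    move=> /le_trans; apply; rewrite ler_wpM2r ?powR_ge0//.
    by rewrite -addrA lerDl addr_ge0.
  move=> x x' sx xx xt _.
  have [u [su xu]] : exists u, s <= u /\ x = o + u.
    by exists (x - o); split; [lra|ring].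
  have [v [vt xv]] : exists v, v <= t /\ x' = o + v.
    by exists (x' - o); split; [lra|ring].
  have uv : u < v by lra.
  rewrite xu xv !oK (_ : o + v - (o + u) = v - u); last by ring.
  have p0 := powd_ge0 (beta := beta) u v.
  have p31 : p u v ^+ 3 <= p u v.
    by rewrite exprS ler_piMr// exprn_ile1// p1// ltW.
  have hJ' : `|J v - J u - germ_path eta eta' y u v| <= S * p u v.
    apply: le_trans (hJ u v su (ltW uv) vt) _.
    by rewrite -powd3 ler_wpM2l.
  have gb' := gb u v su (ltW uv) vt.
  rewrite -[(v - u) `^ beta]/(p u v) [(S + Cg + _) * _]mulrDl [(S + Cg) * _]mulrDl.
  move: su; rewrite le_eqVlt => /predU1P[su|su]; last first.
    rewrite Fg//; apply: le_trans hJ' _.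
    by rewrite -addrA lerDl addr_ge0// mulr_ge0.
  rewrite (_ : _ - F _ _ = (J v - J u - germ_path eta eta' y u v)
    + (germ_path eta eta' y u v - F (o + u) (o + v))); last by zmod.
  apply: le_trans (ler_normD _ _) _; rewrite -[leRHS]addrA; apply: lerD => //.
  apply: le_trans (ler_normB _ _) _; apply: lerD => //.
  rewrite -su in uv p0 *; apply: le_trans (Fs v uv vt) _.
  by rewrite ler_wpM2r// ler_norm.
have ost : o + s < o + t by rewrite ltrD2l.
rewrite (partition_limit_unique ost FI lim) powd3.
exact: hJ (lexx s) (ltW st) (lexx t).
Qed.

End davie_limit.

(** * Norms of controlled paths *)

Section norms.
Context {R : realType} {V : normedModType R}.
Implicit Types (F : R -> R -> V) (f : R -> V) (J : set R) (C a b alpha e s t : R).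

Lemma holder_leP alpha J F C : (holder alpha J F <= C%:E)%E <->
  forall s t, J s -> J t -> s != t -> `|F s t| <= C * `|t - s| `^ alpha.
Proof.
have pos s t : s != t -> 0 < `|t - s| `^ alpha.
  by move=> st; rewrite powR_gt0// normr_gt0 subr_eq0 eq_sym.
split=> [h s t Js Jt st|h].
  rewrite -ler_pdivrMr ?pos// -lee_fin; apply: le_trans h.
  by apply: ereal_sup_ubound; exists (s, t).
apply: ge_ereal_sup => _ [[s t] /= [Js Jt st] <-].
by rewrite lee_fin ler_pdivrMr ?pos// h.
Qed.

Lemma holder_ltP alpha J F : (holder alpha J F < +oo)%E ->
  exists2 C, 0 <= C & forall s t, J s -> J t -> s != t ->
    `|F s t| <= C * `|t - s| `^ alpha.
Proof.
move=> h; exists `|fine (holder alpha J F)| => //; apply/holder_leP.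
case: (holder alpha J F) h => //= [x _|_]; last by rewrite leNye.
by rewrite lee_fin ler_norm.
Qed.

Lemma holder_ge0 alpha J F s t : J s -> J t -> s != t -> (0 <= holder alpha J F)%E.
Proof.
move=> Js Jt st; apply: (@le_trans _ _ (`|F s t| / `|t - s| `^ alpha)%:E).
  by rewrite lee_fin divr_ge0// powR_ge0.
by apply: ereal_sup_ubound; exists (s, t).
Qed.

Lemma sup_norm_leP J f C : (sup_norm J f <= C%:E)%E <-> forall t, J t -> `|f t| <= C.
Proof.
split=> [h t Jt|h].
  by rewrite -lee_fin; apply: le_trans h; apply: ereal_sup_ubound; exists t.
by apply: ge_ereal_sup => _ [t Jt <-]; rewrite lee_fin h.
Qed.

Lemma sup_norm_ge0 J f t : J t -> (0 <= sup_norm J f)%E.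
Proof.
move=> Jt; apply: (@le_trans _ _ (`|f t|)%:E); first by rewrite lee_fin.
by apply: ereal_sup_ubound; exists t.
Qed.

End norms.

Lemma le_sum4_ereal (R : realType) (a b c d e : \bar R) :
  (0 <= a -> 0 <= b -> 0 <= c -> 0 <= d -> a + b + c + d <= e ->
  [/\ a <= e, b <= e, c <= e & d <= e])%E.
Proof.
move=> a0 b0 c0 d0 h; split; apply: le_trans h.
- by rewrite -!addeA leeDl// adde_ge0// adde_ge0.
- by rewrite (addeC a) -!addeA leeDl// adde_ge0// adde_ge0.
- by rewrite addeAC leeDr// adde_ge0// adde_ge0.
- by rewrite leeDr// adde_ge0// adde_ge0.
Qed.

Section cnorm.
Context {R : realType} {d n : nat} (beta : R) (X : R -> 'cV[R]_d).
Variables (a b : R).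
Hypothesis ab : a < b.
Implicit Types (m : cpath R d n) (e s t : R).

(** Each summand is below the sum once all are nonnegative; for the Hölder seminorms this takes two
    distinct points, whence [a < b]. *)
Lemma cnorm_le m e : (cnorm beta X `[a, b] m <= e%:E)%E ->
  [/\ forall t, a <= t -> t <= b -> `|m.1 t| <= e,
      forall t, a <= t -> t <= b -> `|m.2 t| <= e,
      forall s t, a <= s -> s < t -> t <= b -> `|m.2 t - m.2 s| <= e * (t - s) `^ beta &
      forall s t, a <= s -> s < t -> t <= b ->
        `|remainder X m s t| <= e * (t - s) `^ (2 * beta)].
Proof.
have Ja : `[a, b]%classic a by rewrite /= in_itv/= lexx ltW.
have Jb : `[a, b]%classic b by rewrite /= in_itv/= lexx ltW.
have nab : a != b by rewrite lt_eqF.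
have J s t : a <= s -> s < t -> t <= b ->
    [/\ `[a, b]%classic s, `[a, b]%classic t, s != t & `|t - s| = t - s].
  move=> as_ st tb; rewrite /= !in_itv/= as_ tb (ltW (lt_le_trans st tb))
    (ltW (le_lt_trans as_ st)) lt_eqF//; split=> //.
  by rewrite ger0_norm// subr_ge0 ltW.
move=> /le_sum4_ereal[||||/sup_norm_leP h1 /sup_norm_leP h2 /holder_leP h3 /holder_leP h4].
- exact: sup_norm_ge0 Ja.
- exact: sup_norm_ge0 Ja.
- exact: holder_ge0 Ja Jb nab.
- exact: holder_ge0 Ja Jb nab.
split=> [t at_ tb|t at_ tb|s t as_ st tb|s t as_ st tb].
- by apply: h1; rewrite /= in_itv/= at_.
- by apply: h2; rewrite /= in_itv/= at_.
- by have [Js Jt nst E] := J s t as_ st tb; rewrite -[X in X `^ _]E; exact: h3.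
- by have [Js Jt nst E] := J s t as_ st tb; rewrite -[X in X `^ _]E; exact: h4.
Qed.


(** The seminorm runs over pairs in both orders, while the remainder is not antisymmetric. The
    correction is a product of two increments and accounts for the factor [1 + d%:R * CX] below. *)
Lemma remainder_swap m s t :
  remainder X m t s = - remainder X m s t + (m.2 t - m.2 s) *m (X t - X s).
Proof.
rewrite /remainder /incr mulmxBl -(opprB (X t) (X s)) mulmxN; zmod.
Qed.

Variables (CX : R).
Hypothesis CX0 : 0 <= CX.
Hypothesis hX : forall s t, a <= s -> s < t -> t <= b ->
  `|X t - X s| <= CX * (t - s) `^ beta.

Lemma two_sided (V : normedModType R) (F : R -> R -> V) al e :
  (forall s t, a <= s -> s < t -> t <= b -> `|F s t| <= e * (t - s) `^ al) ->
  (forall s t, a <= s -> s < t -> t <= b -> `|F t s| <= e * (t - s) `^ al) ->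
  (holder al `[a, b] F <= e%:E)%E.
Proof.
move=> h1 h2; apply/holder_leP => s t; rewrite /= !in_itv/= => /andP[as_ sb] /andP[at_ tb].
rewrite neq_lt => /orP[st|ts].
  by rewrite gtr0_norm ?subr_gt0// h1.
by rewrite distrC gtr0_norm ?subr_gt0// h2.
Qed.

Section bounds.
Variables (m : cpath R d n) (e : R).
Hypothesis e0 : 0 <= e.
Hypothesis h2 : forall s t, a <= s -> s < t -> t <= b -> `|m.2 t - m.2 s| <= e * (t - s) `^ beta.
Hypothesis h3 : forall s t, a <= s -> s < t -> t <= b ->
  `|remainder X m s t| <= e * (t - s) `^ (2 * beta).

Lemma holder_deriv_le : (holder beta `[a, b] (incr m.2) <= e%:E)%E.
Proof. by apply: two_sided => // s t *; rewrite /incr distrC h2. Qed.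

Lemma holder_remainder_le :
  (holder (2 * beta) `[a, b] (remainder X m) <= (e * (1 + d%:R * CX))%:E)%E.
Proof.
have k0 : 0 <= d%:R * CX by rewrite mulr_ge0.
apply: two_sided => s t as_ st tb.
  apply: le_trans (h3 as_ st tb) _; rewrite ler_wpM2r ?powR_ge0//.
  by rewrite mulrDr mulr1 lerDl mulr_ge0.
rewrite remainder_swap; apply: le_trans (ler_normD _ _) _; rewrite normrN mulrDr mulr1 mulrDl.
apply: lerD; first exact: h3.
apply: le_trans (mx_norm_mul _ _) _.
have -> : e * (d%:R * CX) * (t - s) `^ (2 * beta) =
    (d%:R * (e * (t - s) `^ beta)) * (CX * (t - s) `^ beta).
  by rewrite mulrC mulrC [2 * beta]mulrC powRrM powR_mulrn ?powR_ge0//; ring.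
by apply: ler_pM; rewrite ?mulr_ge0// ?ler_wpM2l ?h2 ?hX.
Qed.

Lemma controlled_of : controlled beta X `[a, b] m.
Proof.
split; first by apply: le_lt_trans holder_deriv_le (ltry _).
by apply: le_lt_trans holder_remainder_le (ltry _).
Qed.

Lemma cnorm_of : (forall t, a <= t -> t <= b -> `|m.1 t| <= e) ->
  (forall t, a <= t -> t <= b -> `|m.2 t| <= e) ->
  (cnorm beta X `[a, b] m <= (e * (4 + d%:R * CX))%:E)%E.
Proof.
move=> k1 k2; have -> : e * (4 + d%:R * CX) = e + e + e + e * (1 + d%:R * CX) by ring.
rewrite !EFinD; apply: leeD holder_remainder_le; apply: leeD holder_deriv_le.
by apply: leeD; apply/sup_norm_leP => t; rewrite /= in_itv/= => /andP[at_ tb]; auto.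
Qed.

End bounds.

Lemma controlledP m : controlled beta X `[a, b] m -> exists2 C, 0 <= C &
  (forall s t, a <= s -> s < t -> t <= b -> `|m.2 t - m.2 s| <= C * (t - s) `^ beta) /\
  (forall s t, a <= s -> s < t -> t <= b ->
    `|remainder X m s t| <= C * (t - s) `^ (2 * beta)).
Proof.
move=> [/holder_ltP[C1 C10 h1] /holder_ltP[C2 C20 h2]].
have J s t : a <= s -> s < t -> t <= b ->
    [/\ `[a, b]%classic s, `[a, b]%classic t, s != t & `|t - s| = t - s].
  move=> as_ st tb; rewrite /= !in_itv/= as_ tb (ltW (lt_le_trans st tb))
    (ltW (le_lt_trans as_ st)) lt_eqF//; split=> //.
  by rewrite ger0_norm// subr_ge0 ltW.
exists (C1 + C2); first exact: addr_ge0.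
split=> s t as_ st tb; have [Js Jt nst E] := J s t as_ st tb.
  have := h1 _ _ Js Jt nst; rewrite E => /le_trans; apply.
  by rewrite ler_wpM2r ?powR_ge0// lerDl.
have := h2 _ _ Js Jt nst; rewrite E => /le_trans; apply.
by rewrite ler_wpM2r ?powR_ge0// lerDr.
Qed.

End cnorm.

(** * Bounds for a delayed rough path on compact intervals *)

Section rough_path_bounds.
Context {R : realType} {d : nat} (beta gamma r : R) (w : rpath R d).
Hypotheses (beta0 : 0 < beta) (bg : beta <= gamma) (rw : delayed_rough_path gamma r w).
Implicit Types (s t u T C : R).

Lemma powR_exponent_le (C T al al' x : R) : 0 <= C -> al <= al' -> 0 <= x -> x <= T ->
  0 < al -> 1 <= T -> C * x `^ al' <= C * T `^ (al' - al) * x `^ al.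
Proof.
move=> C0 aa x0 xT al0 T1; rewrite -mulrA ler_wpM2l//.
have -> : x `^ al' = x `^ (al' - al) * x `^ al.
  rewrite -powRD subrK//; apply/implyP => /eqP a0; move: aa; rewrite a0; lra.
by rewrite ler_wpM2r ?powR_ge0// ge0_ler_powR ?nnegrE ?subr_ge0// (le_trans x0).
Qed.

(** The seminorm says nothing about the diagonal; the value there is recovered by continuity from
    the right. *)
Lemma diag_eq0 (V : normedModType R) (F : R * R -> V) s C al : 0 <= C -> 0 < al ->
  continuous F -> (forall t, s < t -> t <= s + 1 -> `|F (s, t)| <= C * (t - s) `^ al) ->
  F (s, s) = 0.
Proof.
move=> C0 al0 cF hF; apply/eqP; rewrite -normr_le0; apply/ler_addgt0Pr => e e0.
rewrite add0r; have e2 : 0 < e / 2 by rewrite divr_gt0.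
have [d1 d10 h1] := small_power C0 al0 e2.
have cs : {for s, continuous (fun t => F (s, t))}.
  apply: (@continuous_comp _ _ _ (fun t : R => (s, t)) F); last exact: cF.
  have c1 : (fun _ : R => s : R^o) @ s --> (s : R^o) by exact: cvg_cst.
  have c2 : (fun t : R => t : R^o) @ s --> (s : R^o) by exact: cvg_id.
  exact: (cvg_pair c1 c2).
have [d2 /= d20 h2] : exists2 d2 : R, 0 < d2 & forall t, `|s - t| < d2 ->
    `|F (s, s) - F (s, t)| < e / 2.
  have /cvgrPdist_lt/(_ _ e2) := cs.
  by move=> /nbhs_ballP[d2 /= d20 h]; exists d2 => // t; exact: h.
pose k := Num.min 1 (Num.min d1 (d2 / 2)).
have k0 : 0 < k by rewrite !lt_min ltr01 d10 divr_gt0.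
have [k1 kd1 kd2] : [/\ k <= 1, k <= d1 & k <= d2 / 2].
  by rewrite /k !ge_min !lexx !orbT.
have F1 : `|F (s, s + k)| <= e / 2.
  apply: le_trans (hF (s + k) _ _) _; rewrite ?ltrDl ?lerD2l//.
  by rewrite addrAC subrr add0r; apply: h1 => //; exact: ltW.
have F2 : `|F (s, s) - F (s, s + k)| < e / 2.
  apply: h2; rewrite opprD addrA subrr add0r normrN gtr0_norm//; lra.
rewrite -[F (s, s)](subrK (F (s, s + k))); apply: le_trans (ler_normD _ _) _; lra.
Qed.

(** Lowering the exponent from [gamma] to [beta] costs a power of the length of the interval, which
    is absorbed in [C]. The diagonal is included, as sewing requires. *)
Lemma rough_path_bounds T : exists2 C, 1 <= C & forall s t, - T <= s -> s <= t -> t <= T ->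
  [/\ `|base w t - base w s| <= C * powd beta s t,
      `|area w (s, t)| <= C * powd beta s t ^+ 2 &
      `|darea w (s, t)| <= C * powd beta s t ^+ 2].
Proof.
(* The margin of one unit lets [diag_eq0] approach the diagonal from the right even at the end point
   [T]. *)
pose J := `[- T - 1, T + 1]%classic : set R.
have [/(_ J (@segment_compact R _ _))[/holder_ltP[C1 C10 h1] /holder_ltP[C2 C20 h2]
  /holder_ltP[C3 C30 h3]] _ _] := rw.
have inJ s : - T - 1 <= s -> s <= T + 1 -> J s by rewrite /J /= in_itv/= => -> ->.
have gamma0 : 0 < gamma by apply: lt_le_trans bg.
have E s t : s < t -> `|t - s| = t - s by move=> st; rewrite gtr0_norm// subr_gt0.
have diag (F : R * R -> 'M[R]_d) C s : continuous F -> 0 <= C ->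
    (forall s t, J s -> J t -> s != t -> `|F (s, t)| <= C * `|t - s| `^ (2 * gamma)) ->
    - T <= s -> s <= T -> F (s, s) = 0.
  move=> cF C0 hF Ts sT; apply: (@diag_eq0 _ F s C (2 * gamma)) => //.
    by rewrite mulr_gt0.
  move=> t st ts; rewrite -[X in X `^ _](E _ _ st); apply: hF; rewrite ?lt_eqF//.
    by apply: inJ; lra.
  by apply: inJ; lra.
pose L := 2 * `|T| + 1.
have L1 : 1 <= L by rewrite /L lerDr mulr_ge0.
pose K := (C1 * L `^ (gamma - beta) + (C2 + C3) * L `^ (2 * gamma - 2 * beta) + 1).
have k1 : 0 <= C1 * L `^ (gamma - beta) by rewrite mulr_ge0// powR_ge0.
have k2 : 0 <= C2 * L `^ (2 * gamma - 2 * beta) by rewrite mulr_ge0// powR_ge0.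
have k3 : 0 <= C3 * L `^ (2 * gamma - 2 * beta) by rewrite mulr_ge0// powR_ge0.
exists K; first by rewrite /K [(C2 + C3) * _]mulrDl; lra.
move=> s t Ts st tT.
have Js : J s by apply: inJ; lra.
have Jt : J t by apply: inJ; lra.
have p0 := powd_ge0 (beta := beta) s t.
have sT := le_trans st tT; move: st; rewrite le_eqVlt => /predU1P[<-|st].
  rewrite (diag _ C2)// ?(diag _ C3)//; [|exact: darea_continuous|exact: area_continuous].
  rewrite subrr !normr0; split; rewrite mulr_ge0 ?exprn_ge0 ?powd_ge0//;
    by rewrite /K [(C2 + C3) * _]mulrDl; lra.
have st' : s != t by rewrite lt_eqF.
have ts0 : 0 <= t - s by rewrite subr_ge0 ltW.
have tsL : t - s <= L by have := ler_norm T; rewrite /L; lra.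
have b2 : 2 * beta <= 2 * gamma by rewrite ler_wpM2l.
have b20 : 0 < 2 * beta by rewrite mulr_gt0.
rewrite powd2 /powd; split.
- apply: le_trans (h1 s t Js Jt st') _; rewrite E//.
  apply: le_trans (powR_exponent_le C10 bg ts0 tsL beta0 L1) _.
  by rewrite ler_wpM2r ?powR_ge0// /K [(C2 + C3) * _]mulrDl; lra.
- apply: le_trans (h2 s t Js Jt st') _; rewrite E//.
  apply: le_trans (powR_exponent_le C20 b2 ts0 tsL b20 L1) _.
  by rewrite ler_wpM2r ?powR_ge0// /K [(C2 + C3) * _]mulrDl; lra.
apply: le_trans (h3 s t Js Jt st') _; rewrite E//.
apply: le_trans (powR_exponent_le C30 b2 ts0 tsL b20 L1) _.
by rewrite ler_wpM2r ?powR_ge0// /K [(C2 + C3) * _]mulrDl; lra.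
Qed.

End rough_path_bounds.

(** * The one-interval solution map *)

Section flow.
Context {R : realType} {d n : nat} {beta gamma r : R}.
Context {A : {linear ('cV[R]_n * 'cV[R]_n)%type -> 'cV[R]_n}}.
Context {nu : 'I_n -> 'I_n -> {charge set (measurableTypeR R) -> \bar R}}.
Context {G : 'cV[R]_n * 'cV[R]_n -> 'M[R]_(n, d)}.
Hypotheses (bgt : 3^-1 < beta) (bgam : beta <= gamma) (glt : gamma < 2^-1).
Hypotheses (r0 : 0 < r) (hG : bounded_Ck 3 G).
Local Notation rough := (@delayed_rough_path R d gamma r).
Local Notation Dr := (drift_integral r A nu).
Local Notation dG := (fun x v : 'cV[R]_n * 'cV[R]_n => 'd G x v).
Local Notation p := (powd beta).
Implicit Types (s t u a b c e h : R) (w : rpath R d) (xi eta : cpath R d n).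

Let beta0 : 0 < beta.
Proof. by apply: lt_trans bgt; rewrite invr_gt0. Qed.
Ltac slra := move: (bgt) (bgam) (glt) (r0) (beta0) => ? ? ? ? ?; lra.

Definition setting w c := rough_setting beta r (base w) (fun t => base w (t - r))
  (fun s t => area w (s, t)) (fun s t => darea w (s, t)) G dG Dr c.

Lemma powd_diag s : p s s = 0.
Proof. by rewrite /powd subrr powR0// gt_eqF. Qed.

Lemma powd_shiftr s t : p (s - r) (t - r) = p s t.
Proof. by congr (_ `^ _); ring. Qed.

(** Valid for all large [c], so that the same constant can be made to dominate the data as well. *)
Lemma setting_exists w : rough w -> exists2 c0, 1 <= c0 &
  forall c, c0 <= c -> setting w c.
Proof.
move=> rw; have [C C1 hC] := rough_path_bounds beta0 bgam rw r.
have [M M0 [dadd dbound ddiff]] := drift_integral_bounds A nu beta0 (ltW r0).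
have [N hN] := bounded_Ck_C3 hG.
have N0 := ler_norm N; have n0 := normr_ge0 N; have d0 := ler0n R d.
exists (C + M + `|N| + d%:R); first by lra.
move=> c c0; have cC : C <= c by lra.
have cM : M <= c by lra.
have chen0 s : - r <= s -> s <= r -> area w (s, s) = 0 /\ darea w (s, s) = 0.
  move=> rs sr; have [_ h1 h2] := hC s s rs (lexx s) sr.
  move: h1 h2; rewrite powd_diag expr0n mulr0.
  by rewrite !normr_le0 => /eqP-> /eqP->.
have pp s t : 0 <= p s t by exact: powR_ge0.
have [_ chX chY] := rw.
(* Chen's relations are assumed for strictly ordered times; vanishing on the diagonal extends them
   to coinciding ones. *)
have weak (F : R * R -> 'M[R]_d) (P Q : R -> 'cV[R]_d) s u t :
    F (s, s) = 0 -> F (t, t) = 0 ->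
    (s < u -> u < t -> F (s, t) = F (s, u) + F (u, t) + (P u - P s) *m (Q t - Q u)^T) ->
    s <= u -> u <= t ->
    F (s, t) = F (s, u) + F (u, t) + (P u - P s) *m (Q t - Q u)^T.
  move=> s00 t00 h; rewrite le_eqVlt => /predU1P[<- _|su].
    by rewrite s00 subrr mul0mx addr0 add0r.
  rewrite le_eqVlt => /predU1P[->|ut]; last exact: h.
  by rewrite t00 subrr trmx0 mulmx0 !addr0.
split=> //; first by slra.
- by lra.
- by lra.
- by apply: C3_bound_le hN _; lra.
- move=> s t s0 st tr; have [|//|//|h _ _] := hC s t; first by slra.
  by apply: le_trans h _; rewrite ler_wpM2r.
- move=> s t s0 st tr; have [||| h _ _] := hC (s - r) (t - r); try slra.
  by apply: le_trans h _; rewrite powd_shiftr ler_wpM2r.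
- move=> s t s0 st tr; have [|//|//|_ h _] := hC s t; first by slra.
  by apply: le_trans h _; rewrite ler_wpM2r// exprn_ge0.
- move=> s t s0 st tr; have [|//|//|_ _ h] := hC s t; first by slra.
  by apply: le_trans h _; rewrite ler_wpM2r// exprn_ge0.
- move=> s u t s0 su ut tr.
  have [||s00 _] := chen0 s; [by slra|by lra|].
  have [||t00 _] := chen0 t; [by slra|by lra|].
  exact: weak s00 t00 (chX s u t) su ut.
- move=> s u t s0 su ut tr.
  have [||_ s00] := chen0 s; [by slra|by lra|].
  have [||_ t00] := chen0 t; [by slra|by lra|].
  exact: (weak _ (fun x => base w (x - r)) (base w) _ _ _ s00 t00 (chY s u t) su ut).
- move=> y b K hy yK s t s0 st tb; apply: le_trans (dbound y b K hy yK s t s0 st tb) _.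
  have K0 : 0 <= K by apply: le_trans (normr_ge0 _) (yK t _ tb); slra.
  by rewrite ler_wpM2r ?subr_ge0// ler_wpM2r.
- move=> y1 y2 b e hy1 hy2 ye s t s0 st tb.
  apply: le_trans (ddiff y1 y2 b e hy1 hy2 ye s t s0 st tb) _.
  have e0 : 0 <= e by apply: le_trans (normr_ge0 _) (ye t _ tb); slra.
  by rewrite ler_wpM2r ?subr_ge0// ler_wpM2r.
Qed.

(** Real-valued counterpart of a bound on [cnorm], for ordered pairs and with the diagonal included;
    a translation by [r] turns it into [delay_ok]. *)
Definition data_bound w c xi : Prop :=
  [/\ forall t, - r <= t -> t <= 0 -> `|xi.1 t| <= c,
      forall t, - r <= t -> t <= 0 -> `|xi.2 t| <= c,
      forall s t, - r <= s -> s <= t -> t <= 0 -> `|xi.2 t - xi.2 s| <= c * p s t &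
      forall s t, - r <= s -> s <= t -> t <= 0 ->
        `|remainder (base w) xi s t| <= c * p s t ^+ 2].

Lemma remainder_diag (X : R -> 'cV[R]_d) xi s : remainder X xi s s = 0.
Proof. by rewrite /remainder /incr !subrr mulmx0 subrr. Qed.

Lemma remainder_csub (X : R -> 'cV[R]_d) xi eta s t :
  remainder X (csub eta xi) s t = remainder X eta s t - remainder X xi s t.
Proof. by rewrite /remainder /incr /csub/= mulmxBl; zmod. Qed.

Lemma data_bound_le w c c' xi : c <= c' -> data_bound w c xi -> data_bound w c' xi.
Proof.
move=> cc [h1 h2 h3 h4]; split.
- by move=> t rt t0; apply: le_trans (h1 t rt t0) _.
- by move=> t rt t0; apply: le_trans (h2 t rt t0) _.
- by move=> s t rs st t0; apply: le_trans (h3 s t rs st t0) _; rewrite ler_wpM2r ?powR_ge0.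
- move=> s t rs st t0; apply: le_trans (h4 s t rs st t0) _.
  by rewrite ler_wpM2r// exprn_ge0// powR_ge0.
Qed.

Lemma data_bound_add w c e xi eta : data_bound w c xi ->
  data_bound w e (csub eta xi) -> data_bound w (c + e) eta.
Proof.
move=> [h1 h2 h3 h4] [k1 k2 k3 k4]; split.
- move=> t rt t0; rewrite -(subrK (xi.1 t) (eta.1 t)) addrC.
  by apply: le_trans (ler_normD _ _) _; apply: lerD; [exact: h1|exact: k1].
- move=> t rt t0; rewrite -(subrK (xi.2 t) (eta.2 t)) addrC.
  by apply: le_trans (ler_normD _ _) _; apply: lerD; [exact: h2|exact: k2].
- move=> s t rs st t0; rewrite mulrDl.
  rewrite (_ : _ - _ = (xi.2 t - xi.2 s) + ((csub eta xi).2 t - (csub eta xi).2 s)).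
    by apply: le_trans (ler_normD _ _) _; apply: lerD; [exact: h3|exact: k3].
  by rewrite /csub/=; zmod.
- move=> s t rs st t0; rewrite mulrDl.
  rewrite (_ : remainder _ _ _ _ = remainder (base w) xi s t + remainder (base w) (csub eta xi) s t).
    by apply: le_trans (ler_normD _ _) _; apply: lerD; [exact: h4|exact: k4].
  by rewrite remainder_csub; zmod.
Qed.

Lemma data_bound_cnorm w e xi :
  (cnorm beta (base w) `[(- r)%R, 0%R] xi <= e%:E)%E -> data_bound w e xi.
Proof.
have rr : - r < 0 by rewrite oppr_lt0.
move=> /(cnorm_le rr)[h1 h2 h3 h4]; split=> // s t rs;
    rewrite le_eqVlt => /predU1P[->|st] t0.
- by rewrite subrr normr0 powd_diag mulr0.
- exact: h3.
- by rewrite remainder_diag normr0 powd_diag expr0n mulr0.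
- by rewrite powd2; exact: h4.
Qed.

(** [controlled] bounds seminorms only; the sup bounds follow from the values at 0 and the finite
    length of the interval. *)
Lemma data_bound_exists w xi : rough w -> controlled beta (base w) `[- r, 0] xi ->
  exists c, data_bound w c xi.
Proof.
move=> rw /controlledP[C C0 [h3 h4]].
have [K K1 hK] := rough_path_bounds beta0 bgam rw r.
have K0 : 0 <= K by lra.
have {}h3 s t : - r <= s -> s <= t -> t <= 0 -> `|xi.2 t - xi.2 s| <= C * p s t.
  move=> rs; rewrite le_eqVlt => /predU1P[->|st] t0; last exact: h3.
  by rewrite subrr normr0 powd_diag mulr0.
have {}h4 s t : - r <= s -> s <= t -> t <= 0 ->
    `|remainder (base w) xi s t| <= C * p s t ^+ 2.
  move=> rs; rewrite le_eqVlt => /predU1P[->|st] t0; last by rewrite powd2; exact: h4.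
  by rewrite remainder_diag normr0 powd_diag expr0n mulr0.
have pr t : - r <= t -> t <= 0 -> p t 0 <= p (- r) 0.
  move=> rt t0; rewrite ge0_ler_powR ?nnegrE ?(ltW beta0)//; slra.
pose q := p (- r) 0; have q0 : 0 <= q by exact: powR_ge0.
have d0 : 0 <= d%:R :> R by [].
pose c2 := `|xi.2 0| + C * q.
have hc2 t : - r <= t -> t <= 0 -> `|xi.2 t| <= c2.
  move=> rt t0; rewrite -(subKr (xi.2 0) (xi.2 t)).
  apply: le_trans (ler_normB _ _) _; rewrite lerD2l.
  by apply: le_trans (h3 t 0 rt t0 (lexx 0)) _; rewrite ler_wpM2l// pr.
have c20 : 0 <= c2 by rewrite addr_ge0// mulr_ge0.
pose c1 := `|xi.1 0| + (d%:R * c2 * (K * q) + C * q ^+ 2).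
have c10 : 0 <= c1 by rewrite !addr_ge0// !mulr_ge0// exprn_ge0.
have hc1 t : - r <= t -> t <= 0 -> `|xi.1 t| <= c1.
  move=> rt t0; have E : xi.1 t = xi.1 0 - (xi.2 t *m (base w 0 - base w t) + remainder (base w) xi t 0).
    by rewrite /remainder /incr; zmod.
  rewrite E; apply: le_trans (ler_normB _ _) _; rewrite lerD2l.
  apply: le_trans (ler_normD _ _) _; apply: lerD.
    apply: le_trans (mx_norm_mul _ _) _; have [||| hX _ _] := hK t 0 => //; first exact: ltW.
    apply: ler_pM; rewrite ?mulr_ge0 ?ler_wpM2l ?hc2//.
    by apply: le_trans hX _; rewrite ler_wpM2l// pr.
  apply: le_trans (h4 t 0 rt t0 (lexx 0)) _; rewrite ler_wpM2l//.
  by rewrite lerXn2r ?nnegrE ?powR_ge0// pr.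
exists (c1 + c2 + C); split.
- by move=> t rt t0; apply: le_trans (hc1 t rt t0) _; rewrite -addrA lerDl addr_ge0.
- by move=> t rt t0; apply: le_trans (hc2 t rt t0) _; rewrite addrAC lerDr addr_ge0.
- move=> s t rs st t0; apply: le_trans (h3 s t rs st t0) _.
  by rewrite ler_wpM2r ?powR_ge0// lerDr addr_ge0.
- move=> s t rs st t0; apply: le_trans (h4 s t rs st t0) _.
  by rewrite ler_wpM2r ?exprn_ge0 ?powR_ge0// lerDr addr_ge0.
Qed.

Lemma data_holder w c xi : rough w -> data_bound w c xi -> holder_path beta r 0 xi.1.
Proof.
move=> rw [_ h2 _ h4]; have [K K1 hK] := rough_path_bounds beta0 bgam rw r.
have K0 : 0 <= K by lra.
have c0 : 0 <= c.
  by apply: le_trans (h2 0 _ (lexx 0)); [exact: normr_ge0|rewrite oppr_le0 ltW].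
exists (d%:R * c * K + c * r `^ beta) => s t rs st t0.
have E : xi.1 t - xi.1 s = xi.2 s *m (base w t - base w s) + remainder (base w) xi s t.
  by rewrite /remainder /incr; zmod.
have s0 : s <= 0 by lra.
rewrite E mulrDl; apply: le_trans (ler_normD _ _) _; apply: lerD.
  apply: le_trans (mx_norm_mul _ _) _; have [||| hX _ _] := hK s t => //; first by slra.
  rewrite -[leRHS]mulrA; apply: ler_pM; rewrite ?mulr_ge0 ?ler_wpM2l ?h2//.
apply: le_trans (h4 s t rs st t0) _.
rewrite expr2 mulrA ler_wpM2r ?powR_ge0// ler_wpM2l// ge0_ler_powR ?nnegrE ?(ltW beta0) ?(ltW r0)//; slra.
Qed.

Local Notation dlyv xi := (fun t => xi.1 (t - r)).
Local Notation dlyd xi := (fun t => xi.2 (t - r)).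

Lemma delay_ok_data w c xi : data_bound w c xi ->
  @delay_ok R n d beta r (fun t => base w (t - r)) c (dlyv xi) (dlyd xi).
Proof.
move=> [_ h2 h3 h4]; split.
- by move=> t t0 tr; apply: h2; slra.
- by move=> s t s0 st tr; rewrite -powd_shiftr; apply: h3; slra.
- by move=> s t s0 st tr; rewrite -powd_shiftr; apply: h4; slra.
Qed.

Lemma delay_close_data w e xi eta : data_bound w e (csub xi eta) ->
  @delay_close R n d beta r (fun t => base w (t - r)) e (dlyv xi) (dlyv eta) (dlyd xi) (dlyd eta).
Proof.
move=> [h1 h2 h3 h4]; split.
- by move=> t t0 tr; apply: h1; slra.
- by move=> t t0 tr; apply: h2; slra.
- move=> s t s0 st tr; rewrite -powd_shiftr.
  rewrite (_ : _ - _ = (csub xi eta).2 (t - r) - (csub xi eta).2 (s - r)).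
    by apply: h3; slra.
  by rewrite /csub/=; zmod.
- move=> s t s0 st tr; rewrite -powd_shiftr.
  rewrite (_ : _ - _ = remainder (base w) (csub xi eta) (s - r) (t - r)).
    by apply: h4; slra.
  by rewrite remainder_csub.
Qed.

Definition step_sol w xi (z : R -> 'cV[R]_n) : Prop :=
  (forall s, - r <= s -> s <= 0 -> z s = xi.1 s) /\
  @solves R n d beta r (base w) (fun s t => area w (s, t)) (fun s t => darea w (s, t))
    G dG Dr (dlyv xi) (dlyd xi) 0 r z.

(** The piece on [[0, r]] as data for the next interval; at time [r + s] the delayed argument is
    [z s]. *)
Definition next_data (z : R -> 'cV[R]_n) : cpath R d n :=
  (fun s => z (r + s), fun s => G (z (r + s), z s)).

Lemma step_bounds w xi : rough w -> controlled beta (base w) `[- r, 0] xi ->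
  exists2 c, data_bound w c xi & setting w c.
Proof.
move=> rw /(data_bound_exists rw)[c1 h1]; have [c2 c21 h2] := setting_exists rw.
exists (Num.max c1 c2); first by apply: data_bound_le h1; rewrite le_max lexx.
by apply: h2; rewrite le_max lexx orbT.
Qed.

Lemma solves_data_eq w xi eta z a b : 0 <= a -> b <= r ->
  (forall s, - r <= s -> s <= 0 -> xi.1 s = eta.1 s /\ xi.2 s = eta.2 s) ->
  @solves R n d beta r (base w) (fun s t => area w (s, t)) (fun s t => darea w (s, t))
    G dG Dr (dlyv xi) (dlyd xi) a b z ->
  @solves R n d beta r (base w) (fun s t => area w (s, t)) (fun s t => darea w (s, t))
    G dG Dr (dlyv eta) (dlyd eta) a b z.
Proof.
move=> a0 br E [hz [h [C [h0 hC]]]]; split=> //; exists h, C; split=> // s t sa st tb tsh.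
have [||E1 E2] := E (s - r); [by slra|by slra|].
have := hC s t sa st tb tsh.
by rewrite /remainder_path /davie_path /germ_path /germ /deriv_path /lin_pair E1 E2.
Qed.

Lemma step_unique w xi eta z1 z2 : rough w -> controlled beta (base w) `[- r, 0] xi ->
  step_sol w xi z1 -> step_sol w eta z2 ->
  (forall s, - r <= s -> s <= 0 -> xi.1 s = eta.1 s /\ xi.2 s = eta.2 s) ->
  forall t, - r <= t -> t <= r -> z1 t = z2 t.
Proof.
move=> rw Dx [i1 s1] [i2 s2] E; have [c hc Sc] := step_bounds rw Dx.
have E' s : - r <= s -> s <= 0 -> eta.1 s = xi.1 s /\ eta.2 s = xi.2 s.
  by move=> rs s0; have [-> ->] := E s rs s0.
apply: (local_uniqueness Sc (delay_ok_data hc) (lexx 0) (ltW r0) (lexx r) s1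
  (solves_data_eq (lexx 0) (lexx r) E' s2)) => t rt t0.
by rewrite i1// i2//; have [-> _] := E t rt t0.
Qed.

(** By uniqueness every solution is the one of [global_existence], so all solutions with data
    bounded by [c] share the scale [h]. This is the uniformity that [global_stability] asks for. *)
Lemma step_exists_uniform w c : setting w c -> rough w ->
  exists h, [/\ 0 < h, h <= 1, @Kst R beta c <= (h `^ beta)^-1 &
  forall xi z, data_bound w c xi -> step_sol w xi z ->
    forall s t, 0 <= s -> s <= t -> t <= r -> t - s <= h ->
    `|@remainder_path R n d (base w) G (dlyv xi) z s t| <= (h `^ beta)^-1 * p s t ^+ 2].
Proof.
move=> Sc rw; have c1 : 1 <= c := rs_c Sc.
(* This choice of [K] dominates both [c ^+ 3 + 1] and the data. *)
have [|h [h0 h1 hK H]] := global_existence (K := c ^+ 3 + 1 + c) Sc; first by lra.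
exists h; split=> // xi z hx [iz sz] s t s0 st tr tsh.
have c30 : 0 <= c ^+ 3 by rewrite exprn_ge0//; lra.
have [|y [yx sy ry]] := H _ _ _ (delay_ok_data hx) (data_holder rw hx).
  by move=> u ru u0; case: hx => /(_ u ru u0) h2 _ _ _; lra.
have E := local_uniqueness Sc (delay_ok_data hx) (lexx 0) (ltW r0) (lexx r) sz sy.
have zy u : - r <= u -> u <= r -> z u = y u.
  by apply: E => v rv v0; rewrite iz// yx.
by rewrite (remainder_eq _ (zy s _ _) (zy t _ _)); [exact: ry|slra..].
Qed.

Lemma step_sol_exists w xi : rough w -> controlled beta (base w) `[- r, 0] xi ->
  exists z, step_sol w xi z.
Proof.
move=> rw Dx; have [c hc Sc] := step_bounds rw Dx.
have c1 : 1 <= c := rs_c Sc.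
have [|h [h0 h1 hK H]] := global_existence (K := c ^+ 3 + 1 + c) Sc; first by lra.
have c30 : 0 <= c ^+ 3 by rewrite exprn_ge0//; lra.
have [|y [yx sy ry]] := H _ _ _ (delay_ok_data hc) (data_holder rw hc).
  by move=> u ru u0; case: hc => /(_ u ru u0) h2 _ _ _; lra.
by exists y; split=> // s _ s0; rewrite yx.
Qed.

Lemma step_path_bounds w xi z : rough w -> controlled beta (base w) `[- r, 0] xi ->
  step_sol w xi z -> exists2 C, 0 <= C & forall s t, 0 <= s -> s <= t -> t <= r ->
    `|@deriv_path R n d G (dlyv xi) z t - @deriv_path R n d G (dlyv xi) z s| <= C * p s t /\
    `|@remainder_path R n d (base w) G (dlyv xi) z s t| <= C * p s t ^+ 2.
Proof.
move=> rw Dx sz; have [c hc Sc] := step_bounds rw Dx.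
have c1 : 1 <= c := rs_c Sc; have c0 : 0 <= c by lra.
have [h [h0 h1 hK H]] := step_exists_uniform Sc rw; have {H}rz := H xi z hc sz.
have [Cz hz] : exists2 Cz, 0 <= Cz & forall s t, - r <= s -> s <= t -> t <= r ->
    `|z t - z s| <= Cz * p s t.
  case: sz => _ [[Cz hCz] _]; exists `|Cz| => // s t rs st tr.
  by apply: le_trans (hCz s t rs st tr) _; rewrite ler_wpM2r ?powR_ge0// ler_norm.
move=> hCz; have eo := delay_ok_data hc.
have pr s t : 0 <= s -> s <= t -> t <= r -> p s t <= r `^ beta.
  by move=> s0 st tr; rewrite ge0_ler_powR ?nnegrE ?(ltW beta0) ?(ltW r0)//; slra.
pose l := Cz + (c ^+ 3 + c * r `^ beta).
have c30 : 0 <= c ^+ 3 by exact: exprn_ge0.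
have cr0 : 0 <= c * r `^ beta by rewrite mulr_ge0// powR_ge0.
have rho0 : 0 <= (h `^ beta)^-1 by rewrite invr_ge0 powR_ge0.
have K0 : 0 <= (Cz + c * c * c) * (h `^ beta)^-1.
  by rewrite mulr_ge0// addr_ge0// !mulr_ge0.
have l0 : 0 <= l by rewrite addr_ge0// addr_ge0.
exists (c * l + (h `^ beta)^-1 + (Cz + c * c * c) * (h `^ beta)^-1).
  by rewrite !addr_ge0// mulr_ge0.
move=> s t s0 st tr; have p0 : 0 <= p s t by exact: powR_ge0.
have rs : - r <= s by slra.
have sr : s <= r by slra.
split.
  apply: le_trans (deriv_dy Sc (k := Cz) (l := l) _ _ _) _.
  - exact: hCz.
  - apply: le_trans (delay_dy Sc eo s0 st tr) _; rewrite ler_wpM2r//.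
    apply: (@le_trans _ _ (c ^+ 3 + c * r `^ beta)); last by rewrite lerDr.
    by rewrite lerD2l ler_wpM2l// pr.
  - by rewrite lerDl addr_ge0.
  - by rewrite ler_wpM2r// -addrA lerDl addr_ge0.
have [tsh|tsh] := leP (t - s) h.
  apply: le_trans (rz s t s0 st tr tsh) _; rewrite ler_wpM2r ?exprn_ge0//.
  by rewrite addrAC lerDr addr_ge0// mulr_ge0.
have hp : 1 <= (h `^ beta)^-1 * p s t.
  rewrite mulrC ler_pdivlMr ?powR_gt0// mul1r ge0_ler_powR ?nnegrE ?(ltW beta0)//.
  - exact: ltW.
  - by rewrite subr_ge0.
  - exact: ltW.
apply: (@le_trans _ _ ((Cz + c * c * c) * p s t)).
  rewrite /remainder_path mulrDl; apply: le_trans (ler_normB _ _) _; apply: lerD; first exact: hCz.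
  apply: le_trans (norm_mulmx_le (rs_d Sc) (C3_bound0 (rs_C3 Sc) _) (rs_X Sc s0 st tr)) _.
  by rewrite !mulrA.
apply: (@le_trans _ _ ((Cz + c * c * c) * (h `^ beta)^-1 * p s t ^+ 2)).
  rewrite expr2 -[leRHS]mulrA ler_wpM2l ?addr_ge0 ?mulr_ge0// mulrA.
  by rewrite ler_peMl.
by rewrite ler_wpM2r ?exprn_ge0// lerDr addr_ge0// mulr_ge0.
Qed.

Lemma next_deriv w xi z s : step_sol w xi z -> - r <= s -> s <= 0 ->
  (next_data z).2 s = @deriv_path R n d G (dlyv xi) z (r + s).
Proof.
move=> [iz _] rs s0; rewrite /next_data /deriv_path /=; congr (G (_, _)).
by rewrite iz//; congr (xi.1 _); ring.
Qed.

Lemma next_remainder w xi z s t : step_sol w xi z -> - r <= s -> s <= 0 ->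
  remainder (base (path_shift r w)) (next_data z) s t =
  @remainder_path R n d (base w) G (dlyv xi) z (r + s) (r + t).
Proof.
move=> sz rs s0; rewrite /remainder /incr (next_deriv sz rs s0) /remainder_path /=.
congr (_ - _ *m _); rewrite (addrC s) (addrC t); zmod.
Qed.

Lemma shift_base_le w c s t : setting w c -> - r <= s -> s < t -> t <= 0 ->
  `|base (path_shift r w) t - base (path_shift r w) s| <= c * (t - s) `^ beta.
Proof.
move=> Sc rs st t0; have := rs_X Sc (s := r + s) (t := r + t).
rewrite /powd (_ : r + t - (r + s) = t - s); last by ring.
move=> H; rewrite (_ : base _ t - _ = base w (r + t) - base w (r + s)).
  by apply: H; slra.
by rewrite /= (addrC s) (addrC t); zmod.
Qed.

Let rr : - r < 0. Proof. by rewrite oppr_lt0. Qed.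

Lemma next_controlled w xi z : rough w -> controlled beta (base w) `[- r, 0] xi ->
  step_sol w xi z -> controlled beta (base (path_shift r w)) `[- r, 0] (next_data z).
Proof.
move=> rw Dx sz; have [c hc Sc] := step_bounds rw Dx.
have c0 : 0 <= c by apply: le_trans (rs_c Sc).
have [C C0 hC] := step_path_bounds rw Dx sz.
apply: (controlled_of c0 (fun s t => @shift_base_le w c s t Sc) C0) => s t rs st t0.
  rewrite !(next_deriv sz) //; try slra.
  have [|||H _] := hC (r + s) (r + t); try slra.
  by move: H; rewrite /powd (_ : r + t - (r + s) = t - s)//; ring.
rewrite (next_remainder _ sz)//; last by slra.
have [|||_ H] := hC (r + s) (r + t); try slra.
by move: H; rewrite powd2 (_ : r + t - (r + s) = t - s)//; ring.
Qed.

Lemma step_continuous w xi e : rough w -> controlled beta (base w) `[- r, 0] xi -> 0 < e ->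
  exists2 delta, 0 < delta & forall eta, controlled beta (base w) `[- r, 0] eta ->
    (cnorm beta (base w) `[(- r)%R, 0%R] (csub eta xi) < delta%:E)%E ->
    forall z1 z2, step_sol w xi z1 -> step_sol w eta z2 ->
    (cnorm beta (base (path_shift r w)) `[(- r)%R, 0%R] (csub (next_data z2) (next_data z1)) < e%:E)%E.
Proof.
move=> rw Dx e0; have [c1 hc1] := data_bound_exists rw Dx.
have [c2 c21 hc2] := setting_exists rw.
(* The extra 1 makes the same setting serve all [eta] at distance at most 1 from [xi]. *)
pose c := Num.max (c1 + 1) c2.
have cc1 : c1 + 1 <= c by rewrite le_max lexx.
have Sc : setting w c by apply: hc2; rewrite le_max lexx orbT.
have c0 : 0 <= c by apply: le_trans (rs_c Sc).
have [h [h0 h1 hK rem]] := step_exists_uniform Sc rw.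
have [C [C0 stab]] := global_stability Sc h0 h1 hK.
(* A Lipschitz constant in [cnorm] near [xi]: that of [global_stability] times the factor of
   [cnorm_of]. *)
pose L := C * (4 + d%:R * c).
have L0 : 0 <= L by rewrite mulr_ge0// addr_ge0// mulr_ge0.
pose delta := Num.min 1 (e / (L + 1)).
have L1 : 0 < L + 1 by rewrite ltr_wpDl.
have d0 : 0 < delta by rewrite lt_min ltr01 divr_gt0.
have d1 : delta <= 1 by rewrite ge_min lexx.
have dL : L * delta < e.
  apply: (@lt_le_trans _ _ ((L + 1) * delta)); first by rewrite ltr_pM2r// ltrDl.
  by rewrite mulrC -ler_pdivlMr// ge_min lexx orbT.
exists delta => // eta De /ltW/data_bound_cnorm close z1 z2 s1 s2.
have hx : data_bound w c xi by apply: data_bound_le hc1; lra.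
have he : data_bound w c eta.
  by apply: data_bound_le (data_bound_add hc1 close); lra.
have [|H1 H2 H3 H4] := stab delta _ _ _ _ z2 z1 (ltW d0) (delay_ok_data he) (delay_ok_data hx)
  (delay_close_data close) s2.2 s1.2 (rem eta z2 he s2) (rem xi z1 hx s1).
  move=> t rt t0; case: s1 s2 => i1 _ [i2 _]; rewrite i1// i2//.
  by case: close => + _ _ _; apply.
have Cd : 0 <= C * delta by rewrite mulr_ge0// ltW.
apply: (@le_lt_trans _ _ (C * delta * (4 + d%:R * c))%:E); last first.
  by rewrite lte_fin; move: dL; rewrite /L; lra.
apply: (cnorm_of c0 (fun s t => @shift_base_le w c s t Sc) Cd).
- move=> s t rs st t0; have := H3 (r + s) (r + t).
  have rt : - r <= t by slra.
  have s0 : s <= 0 by slra.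
  have -> : (csub (next_data z2) (next_data z1)).2 t - (csub (next_data z2) (next_data z1)).2 s =
    (next_data z2).2 t - (next_data z1).2 t - ((next_data z2).2 s - (next_data z1).2 s) by [].
  rewrite (next_deriv s1 rs s0) (next_deriv s1 rt t0).
  rewrite (next_deriv s2 rs s0) (next_deriv s2 rt t0).
  rewrite (_ : forall x y z' v : 'M[R]_(n, d), x - y - (z' - v) = x - z' - (y - v)); last first.
    by move=> x y z' v; zmod.
  rewrite /powd (_ : r + t - (r + s) = t - s); last by ring.
  by apply; slra.
- move=> s t rs st t0; rewrite remainder_csub.
  rewrite (next_remainder _ s1)//; last by slra.
  rewrite (next_remainder _ s2)//; last by slra.
  have := H4 (r + s) (r + t); rewrite powd2 (_ : r + t - (r + s) = t - s); last by ring.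
  by apply; slra.
- by move=> t rt t0; apply: H1; slra.
- move=> t rt t0.
  have -> : (csub (next_data z2) (next_data z1)).2 t = (next_data z2).2 t - (next_data z1).2 t by [].
  rewrite (next_deriv s1 rt t0) (next_deriv s2 rt t0).
  by apply: H2; slra.
Qed.

End flow.

(** * Solutions on the half-line and the cocycle *)

Section global.
Context {R : realType} {d n : nat} {beta gamma r : R}.
Context {A : {linear ('cV[R]_n * 'cV[R]_n)%type -> 'cV[R]_n}}.
Context {nu : 'I_n -> 'I_n -> {charge set (measurableTypeR R) -> \bar R}}.
Context {G : 'cV[R]_n * 'cV[R]_n -> 'M[R]_(n, d)}.
Hypotheses (bgt : 3^-1 < beta) (bgam : beta <= gamma) (glt : gamma < 2^-1).
Hypotheses (r0 : 0 < r) (hG : bounded_Ck 3 G).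
Variable good : rpath R d -> Prop.
Hypothesis good_rough : forall w, good w -> delayed_rough_path gamma r w.
Hypothesis good_shift : forall (t : R) w, good w -> good (path_shift t w).
Hypothesis shift0 : @path_shift R d 0 = id.
Hypothesis shiftD : forall s t : R, @path_shift R d (s + t) = @path_shift R d s \o @path_shift R d t.
Local Notation rough := (@delayed_rough_path R d gamma r).
Local Notation Dr := (drift_integral r A nu).
Local Notation dG := (fun x v : 'cV[R]_n * 'cV[R]_n => 'd G x v).
Local Notation p := (powd beta).
Local Notation D w := (controlled beta (base w) `[- r, 0]%classic).
Local Notation theta k := (@path_shift R d (k%:R * r)).
Local Notation step_sol := (@step_sol R d n beta r A nu G).
Local Notation sol := (@is_solution R d n beta r A nu G).
Local Notation gub := (gubinelli r G).
Local Notation next_data := (@next_data R d n r G).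
Implicit Types (s t u a b c e h : R) (w : rpath R d) (xi eta : cpath R d n) (y : R -> 'cV[R]_n).

Let beta0 : 0 < beta.
Proof. by apply: lt_trans bgt; rewrite invr_gt0. Qed.
Ltac slra := move: (bgt) (bgam) (glt) (r0) (beta0) => ? ? ? ? ?; lra.

(** The case [k = 0] is separate because the Gubinelli derivative of the initial path is part of the
    data and may differ from [G] along the path. *)
Definition seg (k : nat) y xi : cpath R d n :=
  if k is 0%N then xi else
  (fun s => y (k%:R * r + s), fun s => gub y (k%:R * r + s)).

(** The delay equation interval by interval. Bounds, uniqueness and the cocycle property are proved
    in this form, which [sol_steps] and [steps_sol] show to be equivalent to [is_solution]. *)
Definition steps w xi y : Prop := forall k,
  step_sol (theta k w) (seg k y xi) (fun s => y (k%:R * r + s)).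

Lemma seg_next k y xi : seg k.+1 y xi = next_data (fun s => y (k%:R * r + s)).
Proof.
rewrite /seg /next_data /gubinelli -natr1; congr pair; apply/funext => s.
  by congr y; ring.
by congr (G (y _, y _)); ring.
Qed.

Lemma theta0 w : theta 0 w = w.
Proof. by rewrite mul0r shift0. Qed.

Lemma thetaD k q w : theta k (theta q w) = theta (k + q) w.
Proof. by rewrite natrD mulrDl shiftD. Qed.

Lemma thetaS k w : path_shift r (theta k w) = theta k.+1 w.
Proof. by rewrite -[k.+1]add1n -thetaD mul1r. Qed.

Lemma seg_controlledS w xi y k : good w -> D (theta k w) (seg k y xi) ->
  step_sol (theta k w) (seg k y xi) (fun s => y (k%:R * r + s)) ->
  D (theta k.+1 w) (seg k.+1 y xi).
Proof.
move=> gw Dk sk; rewrite seg_next -thetaS.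
exact: (next_controlled bgt bgam glt r0 hG (good_rough (good_shift _ gw)) Dk sk).
Qed.

Lemma steps_controlled w xi y : good w -> D w xi -> steps w xi y ->
  forall k, D (theta k w) (seg k y xi).
Proof.
move=> gw Dx st; elim=> [|k IH]; first by rewrite theta0.
exact: seg_controlledS.
Qed.

Definition rough_germ w xi y s t : 'cV[R]_n :=
  gub y s *m incr (base w) s t +
  tensor_apply (fun i => 'd G (y s, y (s - r)) (col i (gub y s), 0)) (area w (s, t)) +
  tensor_apply (fun i => 'd G (y s, y (s - r)) (0, col i (delayed_gubinelli r G xi y s)))
    (darea w (s, t)).

Lemma norm_col_le (i : 'I_d) (M : 'M[R]_(n, d)) : `|col i M| <= `|M|.
Proof. by apply: mx_norm_le => // j k; rewrite mxE mx_norm_ge_entry. Qed.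

(** A first order bound that holds at every point, including those where the delayed derivative is
    not the one of the one-interval equation. *)
Lemma rough_germ_le w xi y T : rough w -> D w xi -> exists2 C, 0 <= C &
  forall s t, 0 <= s -> s <= t -> t <= T -> `|rough_germ w xi y s t| <= C * p s t.
Proof.
move=> rw Dx; have [M HM] := bounded_Ck_C3 hG.
have M0 : 0 <= M by apply: le_trans (C3_bound0 HM 0); exact: normr_ge0.
have [K K1 hK] := rough_path_bounds beta0 bgam rw `|T|.
have K0 : 0 <= K by lra.
have [c hc] := data_bound_exists bgt bgam glt r0 rw Dx.
have c0 : 0 <= c.
  by case: hc => + _ _ _ => /(_ 0 _ (lexx 0)) H; apply: le_trans (H _); [exact: normr_ge0|slra].
pose N := M + c; have N0 : 0 <= N by rewrite addr_ge0.
pose q := `|T| `^ beta; have q0 : 0 <= q by exact: powR_ge0.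
exists (d%:R * M * K + 2 * (d%:R ^+ 2 * (M * N) * (K * q))).
  by rewrite addr_ge0 ?mulr_ge0// ?exprn_ge0.
move=> s t s0 st tT; have TT := ler_norm T.
have [|||hX hXX hYX] := hK s t => //; try slra.
have p0 : 0 <= p s t by exact: powR_ge0.
have pq : p s t <= q.
  by rewrite ge0_ler_powR ?nnegrE ?(ltW beta0)//; slra.
have p2 : K * p s t ^+ 2 <= K * q * p s t by rewrite expr2 mulrA ler_wpM2r// ler_wpM2l.
have z0 i : `|'d G (y s, y (s - r)) (col i (gub y s), 0)| <= M * N.
  apply: le_trans (C3_bound1 HM _ _) _; rewrite ler_wpM2l//; apply: prod_norm_le => /=.
    apply: le_trans (norm_col_le _ _) _; apply: le_trans (C3_bound0 HM _) _.
    by rewrite lerDl.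
  by rewrite normr0.
have z1 i : `|'d G (y s, y (s - r)) (0, col i (delayed_gubinelli r G xi y s))| <= M * N.
  apply: le_trans (C3_bound1 HM _ _) _; rewrite ler_wpM2l//; apply: prod_norm_le => /=.
    by rewrite normr0.
  apply: le_trans (norm_col_le _ _) _; rewrite /delayed_gubinelli.
  have [sr|sr] := leP (s - r) 0; last first.
    by apply: le_trans (C3_bound0 HM _) _; rewrite lerDl.
  by case: hc => _ h2 _ _; apply: le_trans (h2 _ _ sr) _; [slra|rewrite lerDr].
rewrite /rough_germ mulrDl; apply: le_trans (ler_normD _ _) _.
apply: le_trans (lerD (ler_normD _ _) (lexx _)) _; rewrite -addrA; apply: lerD.
  apply: le_trans (mx_norm_mul _ _) _; rewrite -!mulrA ler_wpM2l//.
  by apply: ler_pM => //; exact: (C3_bound0 HM).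
have E : 2 * (d%:R ^+ 2 * (M * N) * (K * q)) * p s t =
  d%:R ^+ 2 * (M * N) * (K * q * p s t) + d%:R ^+ 2 * (M * N) * (K * q * p s t) by ring.
have k0 : 0 <= d%:R ^+ 2 * (M * N) by rewrite mulr_ge0 ?exprn_ge0 ?mulr_ge0.
rewrite E; apply: lerD.
  by apply: le_trans (tensor_apply_le _ z0) _; rewrite ler_wpM2l// (le_trans hXX).
by apply: le_trans (tensor_apply_le _ z1) _; rewrite ler_wpM2l// (le_trans hYX).
Qed.

Lemma rough_germE w xi y k u v :
  (seg k y xi).1 (u - r) = y (k%:R * r + (u - r)) ->
  (seg k y xi).2 (u - r) = delayed_gubinelli r G xi y (k%:R * r + u) ->
  rough_germ w xi y (k%:R * r + u) (k%:R * r + v) =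
  @germ_path R n d (base (theta k w)) (fun s t => area (theta k w) (s, t))
    (fun s t => darea (theta k w) (s, t)) G dG
    (fun t => (seg k y xi).1 (t - r)) (fun t => (seg k y xi).2 (t - r))
    (fun s => y (k%:R * r + s)) u v.
Proof.
move=> E1 E2; rewrite /germ_path /germ /rough_germ /tensor_pair /lin_pair /deriv_path E1 E2.
rewrite /= !mulmx0 /gubinelli -[k%:R * r + u - r]addrA.
rewrite -[LHS]addrA; congr (_ + (_ + _)).
- by rewrite /incr; congr (_ *m _); rewrite (addrC u (k%:R * r)) (addrC v (k%:R * r)); zmod.
- by rewrite (addrC u (k%:R * r)) (addrC v (k%:R * r)); congr (tensor_apply _ _); apply: funext => i; rewrite colE.
- by rewrite (addrC u (k%:R * r)) (addrC v (k%:R * r)); congr (tensor_apply _ _); apply: funext => i; rewrite colE.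
Qed.

Lemma holder_of_remainder w y T C : rough w -> 0 <= T -> 0 <= C ->
  (forall s t, 0 <= s -> s <= t -> t <= T ->
    `|remainder (base w) (y, gub y) s t| <= C * p s t ^+ 2) ->
  exists2 C', C <= C' & forall s t, 0 <= s -> s <= t -> t <= T ->
    `|y t - y s| <= C' * p s t.
Proof.
move=> rw T0 C0 rem; have [M HM] := bounded_Ck_C3 hG.
have M0 : 0 <= M by apply: le_trans (C3_bound0 HM 0); exact: normr_ge0.
have [K K1 hK] := rough_path_bounds beta0 bgam rw T.
have K0 : 0 <= K by lra.
pose q := T `^ beta; have q0 : 0 <= q by exact: powR_ge0.
have k1 : 0 <= d%:R * M * K by rewrite !mulr_ge0.
have k2 : 0 <= C * q by rewrite mulr_ge0.
exists (d%:R * M * K + C * q + C); first by rewrite lerDr addr_ge0.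
move=> s t s0 st tT; have p0 : 0 <= p s t by exact: powR_ge0.
have pq : p s t <= q.
  by rewrite ge0_ler_powR ?nnegrE ?(ltW beta0)//; slra.
have -> : y t - y s = gub y s *m (base w t - base w s) + remainder (base w) (y, gub y) s t.
  by rewrite /remainder /incr/=; zmod.
have [|||hX _ _] := hK s t => //; first by slra.
apply: le_trans (ler_normD _ _) _; rewrite -addrA mulrDl; apply: lerD.
  apply: le_trans (mx_norm_mul _ _) _; rewrite -!mulrA ler_wpM2l//.
  by apply: ler_pM => //; exact: (C3_bound0 HM).
apply: le_trans (rem s t s0 st tT) _; rewrite expr2 mulrA ler_wpM2r//.
by rewrite (le_trans (ler_wpM2l C0 pq))// lerDl.
Qed.

Lemma sol_holder w xi y T : rough w -> sol w xi y -> 0 < T -> exists2 C, 0 <= C &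
  forall s t, 0 <= s -> s <= t -> t <= T ->
    `|y t - y s| <= C * p s t /\ `|remainder (base w) (y, gub y) s t| <= C * p s t ^+ 2.
Proof.
move=> rw [_ yc _] T0; have /controlledP[C C0 [_ h2]] := yc 0 T (lexx 0) T0.
have rem s t : 0 <= s -> s <= t -> t <= T ->
    `|remainder (base w) (y, gub y) s t| <= C * p s t ^+ 2.
  move=> s0; rewrite le_eqVlt => /predU1P[->|st] tT; last by rewrite powd2; exact: h2.
  by rewrite remainder_diag normr0 mulr_ge0// exprn_ge0// powR_ge0.
have [C' CC hC'] := holder_of_remainder rw (ltW T0) C0 rem.
exists C'; first exact: le_trans CC.
move=> s t s0 st tT; split; first exact: hC'.
by apply: le_trans (rem s t s0 st tT) _; rewrite ler_wpM2r ?exprn_ge0 ?powR_ge0.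
Qed.

Lemma step_holder w xi z C T : rough w -> D w xi -> 0 <= C ->
  (forall s, - r <= s -> s <= 0 -> z s = xi.1 s) ->
  (forall s t, 0 <= s -> s <= t -> t <= T -> `|z t - z s| <= C * p s t) ->
  holder_path beta r T z.
Proof.
move=> rw Dx C0 iz hz; have [c hc Sc] := step_bounds bgt bgam glt r0 hG rw Dx (A := A) (nu := nu).
have [C1 h1] := data_holder bgt bgam glt r0 rw hc.
exists (`|C1| + C) => s t rs st tr.
have {}h1 s' t' : - r <= s' -> s' <= t' -> t' <= 0 -> `|z t' - z s'| <= `|C1| * p s' t'.
  move=> rs' st' t0; have rt' := le_trans rs' st'; have s0' := le_trans st' t0.
  rewrite (iz _ rs' s0') (iz _ rt' t0).
  by apply: le_trans (h1 _ _ rs' st' t0) _; rewrite ler_wpM2r ?powR_ge0// ler_norm.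
have mono a b a' b' : a <= b -> b - a <= b' - a' -> p a b <= p a' b'.
  by move=> ab h; rewrite ge0_ler_powR ?nnegrE ?(ltW beta0)//; lra.
rewrite mulrDl; have [t0|t0] := leP t 0.
  by apply: le_trans (h1 s t rs st t0) _; rewrite lerDl mulr_ge0// powR_ge0.
have [s0|s0] := leP 0 s.
  by apply: le_trans (hz s t s0 st tr) _; rewrite lerDr mulr_ge0// powR_ge0.
rewrite (_ : z t - z s = (z 0 - z s) + (z t - z 0)); last by zmod.
apply: le_trans (ler_normD _ _) _; apply: lerD.
  apply: le_trans (h1 s 0 rs (ltW s0) (lexx 0)) _; rewrite ler_wpM2l// mono//; lra.
apply: le_trans (hz 0 t (lexx 0) (ltW t0) tr) _; rewrite ler_wpM2l// mono//; lra.
Qed.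

Lemma seg_value xi y k u : (forall s, - r <= s <= 0 -> y s = xi.1 s) ->
  0 <= u -> u <= r -> (seg k y xi).1 (u - r) = y (k%:R * r + (u - r)).
Proof.
move=> iy u0 ur; case: k => [|k]//=; rewrite mul0r add0r iy//; apply/andP; split; slra.
Qed.

(** The value [u = 0] is excluded: for [k = 1] the left side is then [G] along [y] at time 0, the
    right side the derivative of [xi] at 0. *)
Lemma seg_gubinelli xi y k u : 0 < u -> u <= r ->
  (seg k y xi).2 (u - r) = delayed_gubinelli r G xi y (k%:R * r + u).
Proof.
move=> u0 ur; rewrite /delayed_gubinelli; case: k => [|k].
  by rewrite mul0r add0r /=; case: ifPn => //; rewrite -ltNge subr_gt0 ltNge ur.
rewrite ifF; first by rewrite /= addrA.
apply/negbTE; rewrite -ltNge -natr1 mulrDl mul1r.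
have : 0 <= k%:R * r by rewrite mulr_ge0// ltW.
lra.
Qed.

Lemma seg_remainder w xi y k s t : (forall s, - r <= s <= 0 -> y s = xi.1 s) ->
  0 <= s -> s <= r ->
  @remainder_path R n d (base (theta k w)) G (fun t => (seg k y xi).1 (t - r))
    (fun s => y (k%:R * r + s)) s t =
  remainder (base w) (y, gub y) (k%:R * r + s) (k%:R * r + t).
Proof.
move=> iy s0 sr; rewrite /remainder_path /remainder /incr /deriv_path /=.
rewrite (seg_value _ iy)// /gubinelli -[k%:R * r + s - r]addrA.
rewrite (addrC s (k%:R * r)) (addrC t (k%:R * r)); congr (_ - _ *m _); zmod.
Qed.

(** Hölder and remainder bounds come from controlledness on [[0, k r + r]]; Davie's estimate comes
    from the rough integral in the equation, by [davie_of_limit] with offset [k r]. *)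
Lemma sol_step w xi y k : good w -> D w xi -> sol w xi y ->
  D (theta k w) (seg k y xi) ->
  step_sol (theta k w) (seg k y xi) (fun s => y (k%:R * r + s)).
Proof.
move=> gw Dx sy Dk; have rw := good_rough gw; have rk := good_rough (good_shift (k%:R * r) gw).
have [c hc Sc] := step_bounds bgt bgam glt r0 hG rk Dk (A := A) (nu := nu).
have [iy _ eqy] := sy; set o := k%:R * r.
have o0 : 0 <= o by rewrite mulr_ge0// ltW.
have T0 : 0 < o + r by rewrite ltr_wpDl.
have [C C0 hC] := sol_holder rw sy T0.
have [CF CF0 hF] := rough_germ_le y (o + r) rw Dx.
have init s : - r <= s -> s <= 0 -> y (o + s) = (seg k y xi).1 s.
  move=> rs s0; have sr0 : 0 <= s + r by lra.
  have srr : s + r <= r by lra.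
  by have := seg_value k iy sr0 srr; rewrite addrK.
have zh s t : 0 <= s -> s <= t -> t <= r -> `|y (o + t) - y (o + s)| <= C * p s t.
  move=> s0 st tr; rewrite -(powd_shift o).
  by have [|||] := hC (o + s) (o + t); rewrite ?addr_ge0 ?lerD2l.
have zr s t : 0 <= s -> s <= t -> t <= r ->
    `|@remainder_path R n d (base (theta k w)) G (fun t => (seg k y xi).1 (t - r))
      (fun s => y (o + s)) s t| <= C * p s t ^+ 2.
  move=> s0 st tr; rewrite seg_remainder//; last exact: le_trans tr.
  rewrite -(powd_shift o).
  by have [|||] := hC (o + s) (o + t); rewrite ?addr_ge0 ?lerD2l.
have hz := step_holder rk Dk C0 init zh.
split; first exact: init.
(* On such a window the remainder constant [C] of the solution fits into the radius. *)
split=> //; have [h [h0 h1 _ rK rC]] := small_rate Sc C ltr01.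
set rho := (h `^ beta)^-1 in rK rC.
have eo := delay_ok_data bgt bgam glt r0 hc.
have rho0 : 0 <= rho by rewrite invr_ge0 powR_ge0.
have cc0 : 0 <= @cc R c by apply: le_trans (cc1 Sc).
set S := sewing_const (3 * beta) * (11 * @cc R c ^+ 7 * rho).
have th1 : 1 < 3 * beta by slra.
have S0 : 0 <= S.
  apply: mulr_ge0; first by apply: le_trans (sewing_const_ge1 th1).
  by rewrite mulr_ge0// mulr_ge0// exprn_ge0.
exists h, (C + S); split=> // s t s0 st tr tsh.
have p0 : 0 <= p s t by exact: powR_ge0.
split.
  by apply: le_trans (zr s t s0 st tr) _; rewrite ler_wpM2r ?exprn_ge0// lerDl.
apply: (@le_trans _ _ (S * p s t ^+ 3)); last first.
  by rewrite ler_wpM2r ?exprn_ge0// lerDr.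
have sr := le_trans st tr; move: st; rewrite le_eqVlt => /predU1P[<-|st].
  rewrite /davie_path (drift_diag Sc hz s0 sr) (germ_path_diag Sc _ eo s0 sr).
  by rewrite !subrr normr0 mulr_ge0// exprn_ge0// powR_ge0.
have yb := @remainder_in_ball _ _ _ _ _ _ _ _ _ _ _ _ _ Sc s t h s0 (ltW st) tr tsh h0 h1 rK
  _ _ (fun s => y (o + s)) eo.
have ost : o + s < o + t by rewrite ltrD2l.
have [I hI yI] := eqy (o + s) (o + t) (addr_ge0 o0 s0) ost.
rewrite /davie_path yI (drift_integral_shift A nu beta0 (ltW r0) hz s0 (ltW st) tr).
rewrite [_ + I]addrC addrK.
apply: (@davie_of_limit R n d beta r _ _ _ _ G dG Dr c Sc _ _ _ s t h o CF
  (rough_germ w xi y) I s0 st tr tsh h0 h1 rK eo) hI.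
- apply: yb => u v su uv vt; apply: le_trans (zr u v _ uv _) _; [lra|lra|].
  by rewrite ler_wpM2r ?exprn_ge0 ?powR_ge0.
- move=> u v su uv vt; apply: rough_germE.
    by apply: (seg_value _ iy); lra.
  by apply: seg_gubinelli; lra.
- move=> v sv vt; rewrite -(powd_shift o); apply: hF; rewrite ?addr_ge0// ?lerD2l//.
    exact: ltW.
  exact: le_trans tr.
Qed.

Lemma sol_steps w xi y : good w -> D w xi -> sol w xi y -> steps w xi y.
Proof.
move=> gw Dx sy; have Dk k : D (theta k w) (seg k y xi).
  elim: k => [|k IH]; first by rewrite theta0.
  exact: (seg_controlledS gw IH (sol_step gw Dx sy IH)).
by move=> k; exact: (sol_step gw Dx sy (Dk k)).
Qed.

Lemma steps_init w xi y : steps w xi y -> forall s, - r <= s <= 0 -> y s = xi.1 s.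
Proof.
by move=> st s /andP[rs s0]; case: (st 0) => /(_ s rs s0) /=; rewrite mul0r add0r.
Qed.

(** Induction over the intervals. Across [k r] the remainder is additive up to an increment of the
    derivative times one of the driving path, both of order [beta]. *)
Lemma steps_bounds w xi y (k : nat) : good w -> D w xi -> steps w xi y ->
  exists2 C, 0 <= C & forall s t, 0 <= s -> s <= t -> t <= k%:R * r ->
    `|gub y t - gub y s| <= C * p s t /\
    `|remainder (base w) (y, gub y) s t| <= C * p s t ^+ 2.
Proof.
move=> gw Dx st; have iy := steps_init st; elim: k => [|k [C C0 IH]].
  exists 0 => // s t s0; rewrite mul0r => st' t0; have -> : t = s by lra.
  by rewrite remainder_diag subrr !normr0 !mul0r.
set o := k%:R * r in IH *; have -> : k.+1%:R * r = o + r by rewrite -natr1 mulrDl mul1r.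
have o0 : 0 <= o by rewrite mulr_ge0// ltW.
have [K K1 hK] := rough_path_bounds beta0 bgam (good_rough gw) (o + r).
have K0 : 0 <= K by lra.
have [C1 C10 h1] := step_path_bounds bgt bgam glt r0 hG
  (good_rough (good_shift (k%:R * r) gw)) (steps_controlled gw Dx st k) (st k).
have {}h1 s t : o <= s -> s <= t -> t <= o + r ->
    `|gub y t - gub y s| <= C1 * p s t /\
    `|remainder (base w) (y, gub y) s t| <= C1 * p s t ^+ 2.
  move=> os st' tor; have s0 : 0 <= s - o by lra.
  have sr : s - o <= r by lra.
  have t0 : 0 <= t - o by lra.
  have tr : t - o <= r by lra.
  have stt : s - o <= t - o by lra.
  have [] := h1 (s - o) (t - o) s0 stt tr.
  rewrite seg_remainder// /deriv_path !(seg_value _ iy)// -/o.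
  have E u : o + (u - o) = u by ring.
  have E2 u : o + (u - o - r) = u - r by ring.
  rewrite !E !E2 /powd; have -> : t - o - (s - o) = t - s by ring.
  by [].
exists (C + C1 + d%:R * C * K); first by rewrite !addr_ge0 ?mulr_ge0.
have k3 : 0 <= d%:R * C * K by rewrite !mulr_ge0.
move=> s t s0 st' tor; have p0 : 0 <= p s t by exact: powR_ge0.
have p20 : 0 <= p s t ^+ 2 by exact: exprn_ge0.
have [to|to] := leP t o.
  have [H1 H2] := IH s t s0 st' to; split.
    by apply: le_trans H1 _; rewrite ler_wpM2r// -addrA lerDl addr_ge0.
  by apply: le_trans H2 _; rewrite ler_wpM2r// -addrA lerDl addr_ge0.
have [os|os] := leP o s.
  have [H1 H2] := h1 s t os st' tor; split.
    by apply: le_trans H1 _; rewrite ler_wpM2r// addrAC lerDr addr_ge0.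
  by apply: le_trans H2 _; rewrite ler_wpM2r// addrAC lerDr addr_ge0.
have mono a b : s <= a -> a <= b -> b <= t -> p a b <= p s t.
  move=> sa ab bt; rewrite ge0_ler_powR ?nnegrE ?(ltW beta0)//; lra.
have mono2 a b : s <= a -> a <= b -> b <= t -> p a b ^+ 2 <= p s t ^+ 2.
  by move=> sa ab bt; rewrite lerXn2r ?nnegrE ?powR_ge0// mono.
have [H1 H2] := IH s o s0 (ltW os) (lexx o).
have [H3 H4] := h1 o t (lexx o) (ltW to) tor.
split.
  rewrite (_ : _ - _ = (gub y o - gub y s) + (gub y t - gub y o)); last by zmod.
  apply: le_trans (ler_normD _ _) _; rewrite -addrA mulrDl; apply: lerD.
    by apply: le_trans H1 _; rewrite ler_wpM2l// mono// ltW.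
  apply: le_trans H3 _; apply: ler_pM => //; first exact: powR_ge0.
    by rewrite lerDl.
  by rewrite mono// ltW.
rewrite (_ : remainder _ _ _ _ = remainder (base w) (y, gub y) s o +
  remainder (base w) (y, gub y) o t + (gub y o - gub y s) *m (base w t - base w o)); last first.
  rewrite /remainder /incr/= mulmxBl.
  have -> : base w t - base w s = (base w o - base w s) + (base w t - base w o) by zmod.
  by rewrite mulmxDr; zmod.
apply: le_trans (ler_normD _ _) _; apply: le_trans (lerD (ler_normD _ _) (lexx _)) _.
rewrite !mulrDl; apply: lerD; first apply: lerD.
- by apply: le_trans H2 _; rewrite ler_wpM2l// mono2// ltW.
- by apply: le_trans H4 _; rewrite ler_wpM2l// mono2// ltW.
have [|||hX _ _] := hK o t; [slra|exact: ltW|by []|].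
apply: le_trans (mx_norm_mul _ _) _.
have -> : d%:R * C * K * p s t ^+ 2 = d%:R * (C * p s t) * (K * p s t) by ring.
apply: ler_pM; rewrite ?mulr_ge0//.
  rewrite ler_wpM2l//; apply: le_trans H1 _; rewrite ler_wpM2l// mono// ltW//.
by apply: le_trans hX _; rewrite ler_wpM2l// mono// ltW.
Qed.

Lemma steps_holder w xi y (k : nat) : good w -> D w xi -> steps w xi y ->
  holder_path beta r (k%:R * r) y.
Proof.
move=> gw Dx st; have [C C0 hC] := steps_bounds k gw Dx st.
have k0 : 0 <= k%:R * r by rewrite mulr_ge0// ltW.
have [|C' CC hC'] := holder_of_remainder (y := y) (good_rough gw) k0 C0.
  by move=> s t s0 st' tk; have [] := hC s t s0 st' tk.
apply: (step_holder (good_rough gw) Dx (le_trans C0 CC) _ hC') => s rs s0.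
by apply: (steps_init st); rewrite rs.
Qed.

Lemma holder_path_bounded y T : - r <= T -> holder_path beta r T y ->
  exists2 K, 0 <= K & forall t, - r <= t -> t <= T -> `|y t| <= K.
Proof.
move=> rT [C hC]; exists (`|y (- r)| + `|C| * (T + r) `^ beta).
  by rewrite addr_ge0// mulr_ge0// powR_ge0.
move=> t rt tT; rewrite -(subrK (y (- r)) (y t)) addrC.
apply: le_trans (ler_normD _ _) _; rewrite lerD2l.
apply: le_trans (hC _ _ (lexx _) rt tT) _.
apply: le_trans (ler_wpM2r (powR_ge0 _ _) (ler_norm C)) _; rewrite ler_wpM2l//.
by rewrite ge0_ler_powR ?nnegrE ?(ltW beta0)//; slra.
Qed.

Lemma steps_davie w xi y (N : nat) : steps w xi y -> exists h C, [/\ 0 < h, 0 <= C &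
  forall k, (k < N)%N -> forall s t, 0 <= s -> s <= t -> t <= r -> t - s <= h ->
    `|@davie_path R n d (base (theta k w)) (fun s t => area (theta k w) (s, t))
    (fun s t => darea (theta k w) (s, t)) G dG Dr
    (fun t => (seg k y xi).1 (t - r)) (fun t => (seg k y xi).2 (t - r))
    (fun s => y (k%:R * r + s)) s t| <= C * p s t ^+ 3].
Proof.
move=> st; elim: N => [|N [h [C [h0 C0 IH]]]]; first by exists 1, 0.
case: (st N) => _ [_ [h1 [C1 [h10 H]]]].
exists (Num.min h h1), (C + `|C1|); split; first by rewrite lt_min h0.
  by rewrite addr_ge0.
move=> k kN s t s0 st' tr; rewrite le_min => /andP[th th1].
have p3 : 0 <= p s t ^+ 3 by rewrite exprn_ge0// powR_ge0.
move: kN; rewrite ltnS leq_eqVlt => /predU1P[->|kN].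
  have [_ h3] := H s t s0 st' tr th1.
  apply: le_trans h3 _; rewrite ler_wpM2r//; apply: le_trans (ler_norm _) _.
  by rewrite lerDr.
by apply: le_trans (IH k kN s t s0 st' tr th) _; rewrite ler_wpM2r// lerDl.
Qed.

Lemma steps_controlled_path w xi y a b : good w -> D w xi -> steps w xi y ->
  0 <= a -> a < b -> controlled beta (base w) `[a, b]%classic (y, gub y).
Proof.
move=> gw Dx st a0 ab.
have [N hN] : exists N : nat, b <= N%:R * r.
  exists (Num.bound (b / r)); rewrite -ler_pdivrMr//; apply/ltW/archi_boundP.
  by rewrite divr_ge0// ltW// (le_lt_trans a0).
have [C C0 hC] := steps_bounds N gw Dx st.
have [K K1 hK] := rough_path_bounds beta0 bgam (good_rough gw) b.
have K0 : 0 <= K by lra.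
apply: (@controlled_of R d n beta (base w) a b K K0 _ _ C C0).
- move=> s t as_ st' tb; have [|||//] := hK s t; [lra|exact: ltW|by []].
- move=> s t as_ st' tb.
  by have [|||] := hC s t; [lra|exact: ltW|exact: le_trans tb hN|].
- move=> s t as_ st' tb; rewrite -powd2.
  by have [|||] := hC s t; [lra|exact: ltW|exact: le_trans tb hN|].
Qed.

(** The path [y] minus its drift is compared with the germ: by Davie's estimate inside a delay
    interval, and by first order bounds on the partition intervals that meet some [k r]. *)
Lemma steps_integral w xi y a b : good w -> D w xi -> steps w xi y -> 0 <= a -> a < b ->
  is_partition_limit (rough_germ w xi y) a b (y b - y a - Dr y a b).
Proof.
move=> gw Dx st a0 ab; have iy := steps_init st; have rw := good_rough gw.
have [N hN] : exists N : nat, b < N%:R * r.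
  exists (Num.bound (b / r)); rewrite -ltr_pdivrMr//; apply: archi_boundP.
  by rewrite divr_ge0// ltW// (le_lt_trans a0).
set T := N%:R * r in hN; have T0 : 0 <= T by rewrite mulr_ge0// ltW.
have hy : holder_path beta r T y := steps_holder N gw Dx st.
have [M M0 [Dadd Dbound _]] := drift_integral_bounds A nu beta0 (ltW r0).
have [|K K0 hK] := holder_path_bounded _ hy; first by slra.
have [C1 C10 hC1] := steps_bounds N gw Dx st.
have [|C2 CC hC2] := holder_of_remainder (y := y) rw T0 C10.
  by move=> s t s0 st' tk; have [] := hC1 s t s0 st' tk.
have [CF CF0 hF] := rough_germ_le y T rw Dx.
have [h [CD [h0 CD0 hD]]] := steps_davie (xi := xi) N st.
have C20 : 0 <= C2 by apply: le_trans CC.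
have incrI u v : 0 <= u -> u <= v -> v <= T ->
    (y v - Dr y 0 v) - (y u - Dr y 0 u) = y v - y u - Dr y u v.
  by move=> u0 uv vT; rewrite (Dadd y T hy 0 u v (lexx 0) u0 uv vT); zmod.
rewrite -incrI//; [|exact: ltW|exact: ltW].
have MK0 : 0 <= M * K by rewrite mulr_ge0.
pose Ctot := CD + (C2 + M * K + CF).
have hh0 : 0 < Num.min h 1 by rewrite lt_min h0 ltr01.
apply: (@partition_limit_junctions R _ (rough_germ w xi y) (fun x => y x - Dr y 0 x)
  a b beta (Num.min h 1) Ctot (fun k => k%:R * r) N bgt (ltW ab) hh0).
  move=> x z ax xz zb; rewrite lt_min => /andP[zxh _] noJ.
  have x0 : 0 <= x by lra.
  have zT : z <= T by lra.
  have xr0 : 0 <= x / r by rewrite divr_ge0// ltW.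
  (* [k] is the index of the delay interval of [x]. As no multiple of [r] lies in [[x, z[], even
     [k r < x] and [z <= k r + r] hold, so [[x, z]] stays in one delay interval and avoids its left
     end. *)
  have := truncn_itv xr0; set k := Num.truncn _; rewrite ler_pdivlMr// ltr_pdivrMr// => /andP[kx xk].
  have kN : (k < N)%N.
    rewrite -(ltr_nat R) -(ltr_pM2r r0) -/T; apply: le_lt_trans kx _; lra.
  have {}kx : k%:R * r < x.
    rewrite lt_neqAle kx andbT; apply/eqP => E; have := noJ k kN.
    by rewrite E lexx xz.
  have zk : z <= k%:R * r + r.
    rewrite leNgt; apply/negP => kz; have k1 : k.+1%:R * r < z.
      by rewrite -natr1 mulrDl mul1r.
    have k1N : (k.+1 < N)%N.
      by rewrite -(ltr_nat R) -(ltr_pM2r r0) -/T; apply: lt_le_trans k1 _; lra.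
    by have := noJ k.+1 k1N; rewrite k1 (ltW xk).
  rewrite (incrI x z x0 (ltW xz) zT).
  have xE : x = k%:R * r + (x - k%:R * r) by ring.
  have zE : z = k%:R * r + (z - k%:R * r) by ring.
  set u := x - k%:R * r in xE *; set v := z - k%:R * r in zE *.
  have u0 : 0 < u by rewrite subr_gt0.
  have uv : u < v by rewrite ltrD2r.
  have vr : v <= r by rewrite /v; lra.
  have uvE : v - u = z - x by rewrite /u /v; ring.
  have ur : u <= r by lra.
  case: (st k) => _ [hz _].
  have := hD k kN u v (ltW u0) (ltW uv) vr; rewrite uvE => /(_ (ltW zxh)).
  rewrite /davie_path -(drift_integral_shift A nu beta0 (ltW r0) hz (ltW u0) (ltW uv) vr).
  rewrite -rough_germE; [|by apply: (seg_value _ iy) => //; exact: ltW|exact: seg_gubinelli].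
  rewrite -xE -zE powd3 uvE => /le_trans; apply.
  by rewrite ler_wpM2r ?powR_ge0// lerDl !addr_ge0.
move=> x z ax xz zb; rewrite lt_min => /andP[_ zx1].
have x0 : 0 <= x by lra.
have zT : z <= T by lra.
rewrite (incrI x z x0 (ltW xz) zT).
have q0 : 0 <= (z - x) `^ beta by exact: powR_ge0.
have zx0 : 0 <= z - x by rewrite subr_ge0 ltW.
have tq : z - x <= (z - x) `^ beta.
  rewrite -{1}[z - x]powRr1//; apply: ger_powR; last by slra.
  by rewrite subr_gt0 xz ltW.
apply: (@le_trans _ _ ((C2 + M * K + CF) * (z - x) `^ beta)); last first.
  by rewrite ler_wpM2r// lerDr.
rewrite !mulrDl; apply: le_trans (ler_normB _ _) _; apply: lerD; last first.
  exact: (hF x z x0 (ltW xz) zT).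
apply: le_trans (ler_normB _ _) _; apply: lerD; first exact: (hC2 x z x0 (ltW xz) zT).
apply: le_trans (Dbound y T K hy hK x z x0 (ltW xz) zT) _.
by rewrite ler_wpM2l.
Qed.

Lemma steps_sol w xi y : good w -> D w xi -> steps w xi y -> sol w xi y.
Proof.
move=> gw Dx st; split; first exact: steps_init st.
  by move=> a b a0 ab; exact: (steps_controlled_path gw Dx st).
move=> s t s0 st'; exists (y t - y s - Dr y s t).
  exact: (steps_integral gw Dx st).
by rewrite [RHS]addrC subrK.
Qed.

(** Induction over the delay intervals: equality up to [k r] makes the data of the next one-interval
    equation coincide. *)
Lemma steps_unique w xi y z : good w -> D w xi -> steps w xi y -> steps w xi z ->
  forall t, - r <= t -> y t = z t.
Proof.
move=> gw Dx sy sz.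
have H k : forall t, - r <= t -> t <= k%:R * r -> y t = z t.
  elim: k => [|k IH] t rt.
    by rewrite mul0r => t0; rewrite (steps_init sy) ?rt// (steps_init sz) ?rt.
  rewrite -natr1 mulrDl mul1r => tk.
  have [tk'|tk'] := leP t (k%:R * r); first exact: IH.
  have E s : - r <= s -> s <= 0 ->
      (seg k y xi).1 s = (seg k z xi).1 s /\ (seg k y xi).2 s = (seg k z xi).2 s.
    case: k IH {tk tk'} => [|k] IH //= rs s0.
    have kk : k.+1%:R * r = k%:R * r + r by rewrite -natr1 mulrDl mul1r.
    have k0 : 0 <= k%:R * r by rewrite mulr_ge0// ltW.
    have e1 : y (k.+1%:R * r + s) = z (k.+1%:R * r + s) by apply: IH; rewrite kk; slra.
    have e2 : y (k.+1%:R * r + s - r) = z (k.+1%:R * r + s - r).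
      by apply: IH; rewrite kk; slra.
    by rewrite /gubinelli e1 e2.
  have := step_unique bgt bgam glt r0 hG (good_rough (good_shift (k%:R * r) gw))
    (steps_controlled gw Dx sy k) (sy k) (sz k) E.
  move=> /(_ (t - k%:R * r)); rewrite [_ + (t - _)]addrC subrK; apply; slra.
move=> t rt; have [k hk] : exists k : nat, t <= k%:R * r; last exact: (H k).
exists (Num.bound `|t / r|); rewrite -ler_pdivrMr//.
by apply: le_trans (ler_norm _) _; apply/ltW/archi_boundP.
Qed.

Lemma step_sol_ext w xi eta z1 z2 : rough w -> D w xi ->
  (forall s, - r <= s -> s <= 0 -> xi.1 s = eta.1 s /\ xi.2 s = eta.2 s) ->
  (forall s, - r <= s -> s <= r -> z1 s = z2 s) ->
  step_sol w xi z1 -> step_sol w eta z2.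
Proof.
move=> rw Dx E Z [iz sz]; have [c hc Sc] := step_bounds bgt bgam glt r0 hG rw Dx (A := A) (nu := nu).
split.
  move=> s rs s0; rewrite -Z; [|by []|by slra].
  by rewrite iz//; have [] := E s rs s0.
apply: (solves_data_eq bgt bgam glt r0 (lexx 0) (lexx r) E).
apply: (solves_ext Sc (lexx 0) _ Z sz).
case: sz => [[C hC] _]; exists C => s t rs st tr.
by rewrite -!Z ?hC//; [exact: le_trans tr|exact: le_trans st].
Qed.

Definition step_path w xi : R -> 'cV[R]_n := xget (fun=> 0) [set z | step_sol w xi z].

Fixpoint data_seq w xi (k : nat) : cpath R d n :=
  if k is k'.+1 then next_data (step_path (theta k' w) (data_seq w xi k')) else xi.

Definition concat_path w xi (t : R) : 'cV[R]_n :=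
  if t <= 0 then xi.1 t else
  let k := Num.truncn (t / r) in
  step_path (theta k w) (data_seq w xi k) (t - k%:R * r).

Lemma step_path_sol w xi : good w -> D w xi -> step_sol w xi (step_path w xi).
Proof.
move=> gw Dx; have := step_sol_exists bgt bgam glt r0 hG (good_rough gw) Dx (A := A) (nu := nu).
exact: xgetPex.
Qed.

Lemma data_seqP w xi k : good w -> D w xi -> D (theta k w) (data_seq w xi k).
Proof.
move=> gw Dx; elim: k => [|k IH]; first by rewrite theta0.
rewrite -thetaS; have gk := good_shift (k%:R * r) gw.
exact: (next_controlled bgt bgam glt r0 hG (good_rough gk) IH (step_path_sol gk IH)).
Qed.

(** The formula holds on two delay intervals, not only on the one that defines the path, because
    each piece starts from the previous one as initial data. *)
Lemma concat_pathE w xi k s : good w -> D w xi -> - r <= s -> s <= r ->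
  concat_path w xi (k%:R * r + s) = step_path (theta k w) (data_seq w xi k) s.
Proof.
move=> gw Dx; pose z k := step_path (theta k w) (data_seq w xi k).
have zs k' : step_sol (theta k' w) (data_seq w xi k') (z k').
  by apply: step_path_sol (data_seqP _ gw Dx); exact: good_shift.
have zS k' u : - r <= u -> u <= 0 -> z k'.+1 u = z k' (r + u).
  by move=> ru u0; case: (zs k'.+1) => iz _; rewrite iz.
have pos k' u : 0 <= u -> u < r -> concat_path w xi (k'%:R * r + u) = z k' u.
  move=> u0 ur; have k0 : 0 <= k'%:R * r by rewrite mulr_ge0// ltW.
  rewrite /concat_path; case: (leP (k'%:R * r + u) 0) => ku.
    have uE : u = 0 by lra.
    have : k'%:R * r = 0 by lra.
    move=> /eqP; rewrite mulf_eq0 (gt_eqF r0) orbF pnatr_eq0 => /eqP k'E.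
    rewrite k'E uE mul0r addr0; case: (zs 0) => iz _; rewrite iz//; slra.
  rewrite (_ : Num.truncn _ = k') /=; first by rewrite addrAC subrr add0r.
  apply: truncn_def; rewrite ler_pdivlMr// ltr_pdivrMr// lerDl u0/=.
  by rewrite -natr1 mulrDl mul1r ltrD2l.
move=> rs sr; have [s0|s0] := leP 0 s.
  move: sr; rewrite le_eqVlt => /predU1P[->|sr]; last exact: pos.
  have -> : k%:R * r + r = k.+1%:R * r + 0 by rewrite -natr1 mulrDl mul1r addr0.
  by rewrite pos// zS ?addr0// oppr_le0 ltW.
case: k => [|k].
  have -> : 0%:R * r + s = s by rewrite mul0r add0r.
  rewrite /concat_path (ltW s0); case: (zs 0%N) => iz _.
  exact: (esym (iz s rs (ltW s0))).
have -> : k.+1%:R * r + s = k%:R * r + (r + s) by rewrite -natr1; ring.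
by rewrite pos; [rewrite -zS// ltW|lra|lra].
Qed.

Lemma concat_path_steps w xi : good w -> D w xi -> steps w xi (concat_path w xi).
Proof.
move=> gw Dx k; have gk := good_shift (k%:R * r) gw.
apply: (step_sol_ext (good_rough gk) (data_seqP k gw Dx) _ _
  (step_path_sol gk (data_seqP k gw Dx))).
  case: k {gk} => [|k]//= s rs s0.
  have E1 : k.+1%:R * r + s = k%:R * r + (r + s) by rewrite -natr1; ring.
  have E2 : k.+1%:R * r + s - r = k%:R * r + s by rewrite -natr1; ring.
  rewrite /gubinelli E2 E1 !concat_pathE//; slra.
by move=> s rs sr; rewrite concat_pathE.
Qed.

Lemma sol_exists_unique w xi : good w -> D w xi ->
  exists y, sol w xi y /\ forall z, sol w xi z -> forall t, - r <= t -> z t = y t.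
Proof.
move=> gw Dx; have st := concat_path_steps gw Dx; exists (concat_path w xi).
split=> [|z sz t rt]; first exact: steps_sol.
by rewrite (steps_unique gw Dx st (sol_steps gw Dx sz)).
Qed.

Local Notation flow := (@flow R d n beta r A nu G).
Local Notation varphi := (@varphi R d n beta r A nu G).

Lemma flow_sol w xi : good w -> D w xi -> sol w xi (flow w xi).
Proof.
move=> gw Dx; apply: (xgetPex _ (P := [set y | sol w xi y])).
by have [y [sy _]] := sol_exists_unique gw Dx; exists y.
Qed.

Lemma flow_steps w xi : good w -> D w xi -> steps w xi (flow w xi).
Proof. by move=> gw Dx; apply: sol_steps (flow_sol gw Dx). Qed.

Lemma varphiE k w xi : varphi k w xi = seg k (flow w xi) xi.
Proof. by case: k. Qed.

Lemma varphi_controlled k w xi : good w -> D w xi -> D (theta k w) (varphi k w xi).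
Proof.
by move=> gw Dx; rewrite varphiE; exact: (steps_controlled gw Dx (flow_steps gw Dx)).
Qed.

(** The pieces of the flow solve the one-interval equations, so the one-step continuity at
    [varphi k w xi] composes with the continuity of [varphi k]. *)
Lemma varphi_continuous k w xi e : good w -> D w xi -> 0 < e ->
  exists2 delta, 0 < delta & forall eta, D w eta ->
    (cnorm beta (base w) `[(- r)%R, 0%R] (csub eta xi) < delta%:E)%E ->
    (cnorm beta (base (theta k w)) `[(- r)%R, 0%R]
      (csub (varphi k w eta) (varphi k w xi)) < e%:E)%E.
Proof.
move=> gw Dx; elim: k e => [|k IH] e e0.
  exists e; [exact: e0|move=> eta _ close].
  by rewrite (theta0 w); exact: close.
have gk := good_shift (k%:R * r) gw; have Dk := varphi_controlled k gw Dx.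
have [d1 d10 h1] := step_continuous bgt bgam glt r0 hG (good_rough gk) Dk e0 (A := A) (nu := nu).
have [d2 d20 h2] := IH d1 d10; exists d2; [exact: d20|move=> eta De close].
have Dke := varphi_controlled k gw De.
have sx := flow_steps gw Dx k; have se := flow_steps gw De k.
rewrite -(thetaS k w) (varphiE k.+1 w eta) (varphiE k.+1 w xi) !seg_next.
exact: (h1 _ Dke (h2 eta De close) _ _ sx se).
Qed.

Lemma seg_shift k q y xi :
  seg k (fun t => y (q%:R * r + t)) (seg q y xi) = seg (k + q) y xi.
Proof.
case: k => [|k]; first by rewrite add0n.
have E s : q%:R * r + (k.+1%:R * r + s) = (k.+1 + q)%:R * r + s by rewrite natrD; ring.
rewrite addSn /seg -addSn /gubinelli; congr pair; apply/funext => s; first by rewrite E.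
by congr (G (y _, y _)); [exact: E|rewrite -E; ring].
Qed.

Lemma steps_shift q w xi y : steps w xi y ->
  steps (theta q w) (seg q y xi) (fun t => y (q%:R * r + t)).
Proof.
move=> st k; rewrite thetaD seg_shift; have := st (k + q)%N.
congr (step_sol _ _ _); apply/funext => s; congr y; rewrite natrD; ring.
Qed.

(** The flow translated by [q r] solves the equation driven by the shifted path with data
    [varphi q w xi], hence agrees on [[-r, +oo[] with the flow started there. *)
Lemma varphi_cocycle k q w xi : good w -> D w xi ->
  ceq_on `[- r, 0]%classic (varphi (k + q) w xi) (varphi k (theta q w) (varphi q w xi)).
Proof.
move=> gw Dx t; rewrite /= in_itv/= => /andP[rt t0].
case: k => [|k]; first by rewrite add0n.
have gq := good_shift (q%:R * r) gw; have Dq := varphi_controlled q gw Dx.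
rewrite (varphiE _ w) -seg_shift -(varphiE q).
have st : steps (theta q w) (varphi q w xi) (fun t => flow w xi (q%:R * r + t)).
  by rewrite varphiE; apply: steps_shift; exact: flow_steps.
have E := steps_unique gq Dq st (flow_steps gq Dq).
have kk : k.+1%:R * r = k%:R * r + r by rewrite -natr1 mulrDl mul1r.
have k0 : 0 <= k%:R * r by rewrite mulr_ge0// ltW.
rewrite /= /gubinelli; split; first by apply: E; rewrite kk; slra.
by rewrite !E//; rewrite kk; slra.
Qed.

End global.

Theorem theorem8 (R : realType) (d n : nat) (H beta gamma r : R)
    (dT : measure_display) (T : measurableType dT) (Pbar : probability T R)
    (Bbar : {mfun T >-> Omega R d}) (Omega0 : set (Omega R d))
    (A : {linear ('cV[R]_n * 'cV[R]_n)%type -> 'cV[R]_n})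
    (pi : 'I_n -> 'I_n -> {charge set (measurableTypeR R) -> \bar R})
    (G : 'cV[R]_n * 'cV[R]_n -> 'M[R]_(n, d)) :
  3^-1 < beta -> beta <= gamma -> gamma < H -> H < 2^-1 -> 0 < r ->
  fbm_lift Pbar H r Bbar ->
  ergodic_mds (distribution Pbar Bbar) (@path_shift R d) ->
  (distribution Pbar Bbar).-negligible (~` Omega0) ->
  (forall t, @path_shift R d t @^-1` Omega0 = Omega0) ->
  (forall w, Omega0 w -> delayed_rough_path gamma r w) ->
  bounded_Ck 4 G \/ (forall x, A x = 0) /\ bounded_Ck 3 G ->
  let D w := controlled beta (base w) `[- r, 0] : set (cpath R d n) in
  let norm w := cnorm beta (base w) `[- r, 0] in
  let phi := varphi beta r A pi G in
  [/\ forall w xi, Omega0 w -> D w xi ->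
        exists y, is_solution beta r A pi G w xi y /\
          forall z, is_solution beta r A pi G w xi z ->
            forall t, - r <= t -> z t = y t,
      forall (m : nat) w, Omega0 w ->
        (forall xi, D w xi -> D (path_shift (m%:R * r) w) (phi m w xi)) /\
        (forall xi, D w xi -> forall eps : R, 0 < eps ->
           exists2 delta : R, 0 < delta &
             forall eta, D w eta -> (norm w (csub eta xi) < delta%:E)%E ->
               (norm (path_shift (m%:R * r) w)
                  (csub (phi m w eta) (phi m w xi)) < eps%:E)%E) &
      forall (p q : nat) w xi, Omega0 w -> D w xi ->
        ceq_on `[- r, 0] (phi (p + q)%N w xi)
          (phi p (path_shift (q%:R * r) w) (phi q w xi))].
Proof.
move=> bgt bgam gH H2 r0 _ [_ shift0 shiftD _ _] _ inv rough Ck D norm phi.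
have glt : gamma < 2^-1 := lt_trans gH H2.
have hG : bounded_Ck 3 G by case: Ck => [/bounded_CkS|[]].
have shift (t : R) w : Omega0 w -> Omega0 (path_shift t w).
  by move=> ow; have : (path_shift t @^-1` Omega0) w by rewrite inv.
split.
- move=> w xi ow Dx.
  exact: (sol_exists_unique bgt bgam glt r0 hG rough shift shift0 shiftD ow Dx).
- move=> m w ow; split=> [xi Dx|xi Dx eps e0].
    exact: (varphi_controlled bgt bgam glt r0 hG rough shift shift0 shiftD m ow Dx).
  exact: (varphi_continuous bgt bgam glt r0 hG rough shift shift0 shiftD m ow Dx e0).
- move=> p q w xi ow Dx.
  exact: (varphi_cocycle bgt bgam glt r0 hG rough shift shift0 shiftD p q ow Dx).
Qed.
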